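(* Let $H$ be a quasi-Hopf algebra and $A$ an algebra in ${}_H^H\mathcal{YD}$. Let $j:H\to A\# H$, $j(h)=1_A\# h$. Then $(A\# H)^j$ becomes an algebra in ${}_H^H\mathcal{YD}$, with coaction $\lambda_{(A\# H)^j}:(A\# H)^j\to H\otimes(A\# H)^j$, $$\lambda_{(A\# H)^j}(a\# h)=X^1Y^1_1T^1(t^1\cdot a)_{(-1)}t^2h_1g^1S(q^2Y^2_2)Y^3\otimes\big[X^2_1Y^1_{(2,1)}T^2\cdot(t^1\cdot a)_{(0)}\,\#\,X^2_2Y^1_{(2,2)}T^3t^3h_2g^2S(X^3q^1Y^2_1)\big],$$ and the map $j:H_0\to(A\# H)^j$ is a morphism of algebras in ${}_H^H\mathcal{YD}$.
   Context: Throughout, $k$ is a field, all algebras and linear spaces are over $k$, $\otimes=\otimes_k$. A quasi-bialgebra $(H,\Delta,\varepsilon,\Phi)$ is a unital associative algebra $H$ with algebra maps $\Delta:H\to H\otimes H$, $\varepsilon:H\to k$ and an invertible $\Phi\in H^{\otimes 3}$ such that for all $h\in H$: $(id\otimes\Delta)(\Delta(h))=\Phi(\Delta\otimes id)(\Delta(h))\Phi^{-1}$; $(id\otimes\varepsilon)(\Delta(h))=h=(\varepsilon\otimes id)(\Delta(h))$; $(1\otimes\Phi)(id\otimes\Delta\otimes id)(\Phi)(\Phi\otimes 1)=(id\otimes id\otimes\Delta)(\Phi)(\Delta\otimes id\otimes id)(\Phi)$; $(\varepsilon\otimes id\otimes id)(\Phi)=(id\otimes\varepsilon\otimes id)(\Phi)=(id\otimes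 id\otimes\varepsilon)(\Phi)=1\otimes 1$. Notation (summation understood): $\Delta(h)=h_1\otimes h_2$, $(\Delta\otimes id)\Delta(h)=h_{(1,1)}\otimes h_{(1,2)}\otimes h_2$, $(id\otimes\Delta)\Delta(h)=h_1\otimes h_{(2,1)}\otimes h_{(2,2)}$; $\Phi=X^1\otimes X^2\otimes X^3=Y^1\otimes Y^2\otimes Y^3=T^1\otimes T^2\otimes T^3=\cdots$ and $\Phi^{-1}=x^1\otimes x^2\otimes x^3=t^1\otimes t^2\otimes t^3=\cdots$ (different letters denote independent copies); lower indices denote components of $\Delta$, e.g. $\Delta(X^3)=X^3_1\otimes X^3_2$. A quasi-Hopf algebra is a quasi-bialgebra $H$ with an algebra anti-automorphism $S$ and $\alpha,\beta\in H$ such that $S(h_1)\alpha h_2=\varepsilon(h)\alpha$, $h_1\beta S(h_2)=\varepsilon(h)\beta$ for all $h$, $X^1\beta S(X^2)\alpha X^3=1$, $S(x^1)\alpha x^2\beta S(x^3)=1$; normalised (as one may) so that $\varepsilon(\alpha)=\varepsilon(\beta)=1$ and $\varepsilon\circ S=\varepsilon$. Drinfeld twist: let $A^1\otimes A^2\otimes A^3\otimes A^4=(\Phi\otimes 1)(\Delta\otimes id\otimes id)(\Phi^{-1})$, $B^1\otimes B^2\otimes B^3\otimes B^4=(\Delta\otimes id\otimes id)(\Phi)(\Phi^{-1}\otimes 1)$, $\gamma=S(A^2)\alpha A^3\otimes S(A^1)\alpha A^4$, $\delta=B^1\beta S(B^4)\otimes B^2\beta S(B^3)$, $\Delta^{cop}(h)=h_2\otimes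 h_1$. Then $f=f^1\otimes f^2=(S\otimes S)(\Delta^{cop}(x^1))\,\gamma\,\Delta(x^2\beta S(x^3))$ is invertible with inverse $f^{-1}=g^1\otimes g^2=\Delta(S(x^1)\alpha x^2)\,\delta\,(S\otimes S)(\Delta^{cop}(x^3))$. Also $q_R=q^1\otimes q^2=X^1\otimes S^{-1}(\alpha X^3)X^2$. A left $H$-module algebra is a left $H$-module $A$ with a multiplication and (usual) unit $1_A$ such that $(aa')a''=(X^1\cdot a)[(X^2\cdot a')(X^3\cdot a'')]$, $h\cdot(aa')=(h_1\cdot a)(h_2\cdot a')$, $h\cdot 1_A=\varepsilon(h)1_A$. The smash product $A\# H$ is $A\otimes H$ with the associative multiplication $(a\# h)(a'\# h')=(x^1\cdot a)(x^2h_1\cdot a')\# x^3h_2h'$ and unit $1_A\# 1$. A left Yetter-Drinfeld module over $H$ is a left $H$-module $M$ with a linear map $\lambda_M:M\to H\otimes M$, $\lambda_M(m)=m_{(-1)}\otimes m_{(0)}$, such that $X^1m_{(-1)}\otimes(X^2\cdot m_{(0)})_{(-1)}X^3\otimes(X^2\cdot m_{(0)})_{(0)}=X^1(Y^1\cdot m)_{(-1)_1}Y^2\otimes X^2(Y^1\cdot m)_{(-1)_2}Y^3\otimes X^3\cdot(Y^1\cdot m)_{(0)}$, $\varepsilon(m_{(-1)})m_{(0)}=m$, $h_1m_{(-1)}\otimes h_2\cdot m_{(0)}=(h_1\cdot m)_{(-1)}h_2\otimes(h_1\cdot m)_{(0)}$. Morphisms in ${}_H^H\mathcal{YD}$ are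 $H$-linear maps intertwining the coactions. An algebra in ${}_H^H\mathcal{YD}$ is a left $H$-module algebra $A$ that is a Yetter-Drinfeld module with $\lambda_A(1_A)=1\otimes 1_A$ and $\lambda_A(aa')=X^1(x^1Y^1\cdot a)_{(-1)}x^2(Y^2\cdot a')_{(-1)}Y^3\otimes[X^2\cdot(x^1Y^1\cdot a)_{(0)}][X^3x^3\cdot(Y^2\cdot a')_{(0)}]$; morphisms of such algebras are unital multiplicative morphisms in ${}_H^H\mathcal{YD}$. If $B$ is an associative algebra and $v:H\to B$ an algebra map, $B^v$ is the left $H$-module algebra with underlying space $B$, multiplication $b\star b'=v(X^1)bv(S(x^1X^2)\alpha x^2X^3_1)b'v(S(x^3X^3_2))$, unit $v(\beta)$, action $h\triangleright_v b=v(h_1)bv(S(h_2))$. $(A\# H)^j$ is this left $H$-module algebra for $B=A\# H$, $v=j$. $H_0:=H^{id_H}$ is an algebra in ${}_H^H\mathcal{YD}$ with coaction $h\mapsto X^1Y^1_1h_1g^1S(q^2Y^2_2)Y^3\otimes X^2Y^1_2h_2g^2S(X^3q^1Y^2_1)$. *)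

(* Defs.v *)
From HB Require Import structures.
From mathcomp Require Import all_boot all_algebra.
From mathcomp Require Import boolp classical_sets.

Set Implicit Arguments.
Unset Strict Implicit.
Unset Printing Implicit Defensive.

Import GRing.Theory.
Local Open Scope ring_scope.
Local Open Scope quotient_scope.

Definition is_bilinear (k : fieldType) (V W U : lmodType k)
    (F : V -> W -> U) : Prop :=
  (forall w, linear (F^~ w)) /\ (forall v, linear (F v)).

(* V ⊗ W is the set of formal sums of pairs, two formal sums being identified
   when no bilinear map out of V x W separates them; scalars are absorbed in
   the left factor.  The lemmas [pure_bilinear], [tsum_linear], [tsum_pure] and
   [tensor_ext] are the universal property. *)
Section Tensor.
Variables (k : fieldType) (V W : lmodType k).

Definition fsum (U : lmodType k) (F : V -> W -> U) (s : seq (V * W)) : U :=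
  \sum_(p <- s) F p.1 p.2.

Definition teq (s t : seq (V * W)) : bool :=
  `[< forall (U : lmodType k) (F : V -> W -> U),
        is_bilinear F -> fsum F s = fsum F t >].

Lemma teq_equiv : equiv_class_of teq.
Proof.
split=> [s | s t | t s u].
- exact/asboolP.
- by apply/asboolP/asboolP => st U F bF; rewrite st.
- by move=> /asboolP st /asboolP tu; apply/asboolP => U F bF; rewrite st ?tu.
Qed.

Canonical teq_equiv_rel := EquivRelPack teq_equiv.

Definition tensor : Type := {eq_quot teq}.

HB.instance Definition _ := Choice.on tensor.
HB.instance Definition _ := EqQuotient.on tensor.

(* Sum over a decomposition t = sum_i v_i ⊗ w_i into pure tensors; the choice
   of decomposition is immaterial when F is bilinear. *)
Definition tsum (U : lmodType k) (t : tensor) (F : V -> W -> U) : U :=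
  fsum F (repr t).

Lemma tsum_pi (U : lmodType k) (F : V -> W -> U) (s : seq (V * W)) :
  is_bilinear F -> tsum (\pi_tensor s) F = fsum F s.
Proof.
move=> bF; have : \pi_tensor (repr (\pi_tensor s)) = \pi_tensor s :> tensor.
  exact: reprK.
by move=> /eqmodP/asboolP; apply.
Qed.

Lemma tsum_inj (s t : tensor) :
  (forall (U : lmodType k) (F : V -> W -> U),
     is_bilinear F -> tsum s F = tsum t F) -> s = t.
Proof.
move=> st; rewrite -[s]reprK -[t]reprK; apply/eqmodP/asboolP => U F bF.
exact: st.
Qed.

Definition pure (v : V) (w : W) : tensor := \pi_tensor [:: (v, w)].
Definition tzero : tensor := \pi_tensor [::].
Definition tadd (s t : tensor) : tensor := \pi_tensor (repr s ++ repr t).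
Definition tscale (a : k) (s : tensor) : tensor :=
  \pi_tensor [seq (a *: p.1, p.2) | p <- repr s].
Definition topp (s : tensor) : tensor := tscale (-1) s.

Section Ops.
Variables (U : lmodType k) (F : V -> W -> U).
Hypothesis bF : is_bilinear F.

Lemma tsum0 : tsum tzero F = 0.
Proof. by rewrite tsum_pi // /fsum big_nil. Qed.

Lemma tsumD s t : tsum (tadd s t) F = tsum s F + tsum t F.
Proof. by rewrite tsum_pi // /fsum big_cat. Qed.

Lemma tsumZ a s : tsum (tscale a s) F = a *: tsum s F.
Proof.
rewrite tsum_pi // /fsum big_map scaler_sumr; apply: eq_bigr => p _ /=.
exact: (scalable_linear (bF.1 _)).
Qed.

Lemma tsumN s : tsum (topp s) F = - tsum s F.
Proof. by rewrite tsumZ scaleN1r. Qed.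

Lemma tsum_pure v w : tsum (pure v w) F = F v w.
Proof. by rewrite tsum_pi // /fsum big_seq1. Qed.
End Ops.

Lemma taddA : associative tadd.
Proof. by move=> s t u; apply: tsum_inj => U F bF; rewrite !tsumD// addrA. Qed.
Lemma taddC : commutative tadd.
Proof. by move=> s t; apply: tsum_inj => U F bF; rewrite !tsumD// addrC. Qed.
Lemma tadd0 : left_id tzero tadd.
Proof. by move=> s; apply: tsum_inj => U F bF; rewrite tsumD// tsum0// add0r. Qed.
Lemma taddN : left_inverse tzero topp tadd.
Proof.
by move=> s; apply: tsum_inj => U F bF; rewrite tsumD// tsumN// tsum0// addNr.
Qed.

HB.instance Definition _ := GRing.isZmodule.Build tensor taddA taddC tadd0 taddN.

Lemma tscaleA a b s : tscale a (tscale b s) = tscale (a * b) s.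
Proof. by apply: tsum_inj => U F bF; rewrite !tsumZ// scalerA. Qed.
Lemma tscale1 : left_id 1 tscale.
Proof. by move=> s; apply: tsum_inj => U F bF; rewrite !tsumZ// scale1r. Qed.
Lemma tscaleDr : right_distributive tscale +%R.
Proof.
move=> a s t; apply: tsum_inj => U F bF.
by rewrite !tsumD// !tsumZ// tsumD// scalerDr.
Qed.
Lemma tscaleDl s : {morph tscale^~ s : a b / a + b}.
Proof.
move=> a b; apply: tsum_inj => U F bF.
by rewrite !tsumD// !tsumZ// scalerDl.
Qed.

HB.instance Definition _ := GRing.Zmodule_isLmodule.Build k tensor
  tscaleA tscale1 tscaleDr tscaleDl.

Lemma tsum_linear (U : lmodType k) (F : V -> W -> U) :
  is_bilinear F -> linear (fun t => tsum t F).
Proof. by move=> bF a s t; rewrite tsumD// tsumZ. Qed.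

Lemma pure_bilinear : is_bilinear pure.
Proof.
split=> [w a v v'|v a w w']; apply: tsum_inj => U F bF;
  rewrite tsumD// tsumZ// !tsum_pure//; [exact: bF.1 | exact: bF.2].
Qed.

Lemma tensorE (t : tensor) : t = \sum_(p <- repr t) pure p.1 p.2.
Proof.
apply: tsum_inj => U F bF; rewrite [LHS]/tsum /fsum.
elim: (repr t) => [|p s IHs]; first by rewrite !big_nil tsum0.
by rewrite !big_cons tsumD// tsum_pure// IHs.
Qed.

Lemma tensor_ext (U : lmodType k) (f g : tensor -> U) :
  linear f -> linear g -> (forall v w, f (pure v w) = g (pure v w)) -> f =1 g.
Proof.
move=> lf lg fg t; rewrite (tensorE t).
have lin_sum h (s : seq (V * W)) : linear h ->
    h (\sum_(p <- s) pure p.1 p.2) = \sum_(p <- s) h (pure p.1 p.2) :> U.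
  move=> lh; have h0 : h 0 = 0.
    by have := lh (-1) 0 0; rewrite scaler0 addr0 scaleN1r addNr.
  elim: s => [|p s IHs]; first by rewrite !big_nil.
  by rewrite !big_cons -[pure p.1 p.2]scale1r lh IHs !scale1r.
by rewrite !lin_sum//; apply: eq_bigr => p _; exact: fg.
Qed.

Lemma tsum_linear_param (X U : lmodType k) (F : X -> V -> W -> U) (t : tensor) :
  (forall v w, linear (fun x => F x v w)) -> linear (fun x => tsum t (F x)).
Proof.
move=> lF a x x'; rewrite /tsum /fsum scaler_sumr -big_split /=.
by apply: eq_bigr => p _; exact: lF.
Qed.

End Tensor.

Notation "V ⊗ W" := (tensor V%type W%type) (at level 45, left associativity) : type_scope.
Notation "v ⊗ w" := (pure v w) (at level 45, left associativity) : ring_scope.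

(* Sweedler notation: \tsum_(x, y <- t) b is the sum of b over t = sum x ⊗ y;
   with three or four indices t lives in a left-nested tensor product. *)
Notation "\tsum_ ( x , y <- t ) b" := (tsum t (fun x y => b))
  (at level 46, x name, y name, t at level 200, b at level 46,
   format "\tsum_ ( x ,  y  <-  t )  b") : ring_scope.
Notation "\tsum_ ( x , y , z <- t ) b" :=
  (tsum t (fun xy z => tsum xy (fun x y => b)))
  (at level 46, x name, y name, z name, t at level 200, b at level 46,
   format "\tsum_ ( x ,  y ,  z  <-  t )  b") : ring_scope.
Notation "\tsum_ ( x , y , z , w <- t ) b" :=
  (tsum t (fun xyz w => tsum xyz (fun xy z => tsum xy (fun x y => b))))
  (at level 46, x name, y name, z name, w name, t at level 200, b at level 46,
   format "\tsum_ ( x ,  y ,  z ,  w  <-  t )  b") : ring_scope.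

(* A nonzero vector is not killed by every linear form; this is needed to know
   that the tensor product of two nonzero algebras is nonzero. *)
Lemma separating_form (k : fieldType) (V : lmodType k) (v : V) :
  v != 0 -> exists phi : V -> k^o, linear phi /\ phi v = 1.
Proof.
move=> v0.
pose P (X : set V) :=
  (forall (a : k) u w, X u -> X w -> X (a *: u + w)) /\ ~ X v.
have [F FP Ftot | X [[Xlin Xv] Xmax]] := @Zorn_bigcup V P.
  split=> [a u w [Y FY Yu] [Z FZ Zw] | [Y FY Yv]]; last exact: (FP _ FY).2 Yv.
  have [YZ|ZY] := Ftot Y Z FY FZ.
    by exists Z => //; apply: (FP _ FZ).1 => //; exact: YZ.
  by exists Y => //; apply: (FP _ FY).1 => //; exact: ZY.
have X0 : X 0.
  apply: contrapT => X0; apply: (Xmax [set 0]%classic).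
    split=> [u Xu|/(_ 0 erefl)//].
    by case: X0; have := Xlin (-1) _ _ Xu Xu; rewrite scaleN1r addNr.
  split=> [a u w /= -> ->|/= v00]; first by rewrite scaler0 addr0.
  by rewrite v00 eqxx in v0.
have XZ a u : X u -> X (a *: u) by move=> Xu; rewrite -[_ *: _]addr0; exact: Xlin.
have XD u w : X u -> X w -> X (u + w).
  by move=> Xu Xw; rewrite -[u]scale1r; exact: Xlin.
have ex u : exists c : k, X (u - c *: v).
  pose B : set V := fun w : V => exists c : k, X (w - c *: u).
  have XB : (X `<=` B)%classic by move=> w Xw; exists 0; rewrite scale0r subr0.
  have Bu : B u by exists 1; rewrite scale1r subrr.
  have [BX|BX] := pselect (B `<=` X)%classic.
    by exists 0; rewrite scale0r subr0; exact: BX.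
  have [[c Xc]|Bv] := pselect (B v).
    have c0 : c != 0 by apply/eqP => c0; apply: Xv; rewrite c0 scale0r subr0 in Xc.
    exists c^-1; have := XZ (- c^-1) _ Xc.
    by rewrite scalerBr !scaleNr opprK scalerA mulVf// scale1r addrC.
  case: (Xmax B) => //; split=> // a w w' [c Xc] [c' Xc'].
  exists (a * c + c'); have := Xlin a _ _ Xc Xc'.
  by rewrite scalerBr scalerA scalerDl opprD addrACA.
have uniq c c' u : X (u - c *: v) -> X (u - c' *: v) -> c = c'.
  move=> Xc Xc'; apply: contrapT => /eqP; rewrite -subr_eq0 => cc'; apply: Xv.
  have := XZ (c - c')^-1 _ (XD _ _ (XZ (-1) _ Xc) Xc').
  rewrite scaleN1r opprB addrA subrK -scalerBl scalerA mulVf//.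
  by rewrite scale1r.
have [phi phiP] := choice ex.
exists phi; split=> [a u w|].
  apply: uniq (phiP _) _; have := Xlin a _ _ (phiP u) (phiP w).
  by rewrite scalerBr scalerA scalerDl opprD addrACA.
by apply: uniq (phiP v) _; rewrite scale1r subrr.
Qed.

Section TensorAlgebra.
Variables (k : fieldType) (A B : algType k).

Definition tone : A ⊗ B := 1 ⊗ 1.
Definition tmul (s t : A ⊗ B) : A ⊗ B :=
  \tsum_(a, b <- s) \tsum_(a', b' <- t) (a * a') ⊗ (b * b').

Lemma pure_mul_bilinear (a : A) (b : B) :
  is_bilinear (fun a' b' => (a * a') ⊗ (b * b')).
Proof.
split=> [w c v v'|v c w w'] /=.
  by rewrite mulrDr -scalerAr (pure_bilinear _ _).1.
by rewrite mulrDr -scalerAr (pure_bilinear _ _).2.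
Qed.

Lemma tmul_param_bilinear (t : A ⊗ B) :
  is_bilinear (fun a b => \tsum_(a', b' <- t) (a * a') ⊗ (b * b')).
Proof.
split=> [b|a]; apply: tsum_linear_param => a' b' c x y;
  rewrite mulrDl -scalerAl.
  exact: (pure_bilinear _ _).1.
exact: (pure_bilinear _ _).2.
Qed.

Lemma tmul_bilinear : is_bilinear tmul.
Proof.
split=> [t|s]; first exact: tsum_linear (tmul_param_bilinear t).
apply: tsum_linear_param => a b; exact: tsum_linear (pure_mul_bilinear a b).
Qed.

Lemma tmul_pure a b a' b' : tmul (a ⊗ b) (a' ⊗ b') = (a * a') ⊗ (b * b').
Proof.
rewrite /tmul tsum_pure; last exact: tmul_param_bilinear.
by rewrite tsum_pure//; exact: pure_mul_bilinear.
Qed.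

Lemma tmulA : associative tmul.
Proof.
have [lin1 lin2] := tmul_bilinear.
move=> s t u; move: s.
apply: tensor_ext => [c x y|c x y|a b]; [by rewrite lin1 | by rewrite !lin1 |].
move: t; apply: tensor_ext => [c x y|c x y|a' b'].
- by rewrite lin1 lin2.
- by rewrite lin2 lin1.
move: u; apply: tensor_ext => [c x y|c x y|a'' b''].
- by rewrite !lin2.
- by rewrite lin2.
by rewrite !tmul_pure !mulrA.
Qed.

Lemma tmul1 : left_id tone tmul.
Proof.
have [lin1 lin2] := tmul_bilinear.
apply: tensor_ext => [c x y|c x y|a b] //; first by rewrite lin2.
by rewrite tmul_pure !mul1r.
Qed.

Lemma tmulr1 : right_id tone tmul.
Proof.
have [lin1 lin2] := tmul_bilinear.
apply: (tensor_ext (f := tmul^~ tone)) => [c x y|c x y|a b] //.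
  by rewrite lin1.
by rewrite tmul_pure !mulr1.
Qed.

Lemma tmulDl : left_distributive tmul +%R.
Proof.
by move=> s t u; have := tmul_bilinear.1 u 1 s t; rewrite !scale1r.
Qed.

Lemma tmulDr : right_distributive tmul +%R.
Proof.
by move=> s t u; have := tmul_bilinear.2 s 1 t u; rewrite !scale1r.
Qed.

Lemma tone_neq0 : tone != 0.
Proof.
have [phi [lphi phi1]] := separating_form (oner_neq0 A).
have [psi [lpsi psi1]] := separating_form (oner_neq0 B).
pose F (a : A) (b : B) : k^o := phi a * psi b.
have bF : is_bilinear F.
  split=> [b c x y|a c x y]; rewrite /F.
    by rewrite lphi mulrDl -scalerAl.
  by rewrite lpsi mulrDr -scalerAr.
apply/eqP => t0; have := tsum_pure bF 1 1.
rewrite -/tone t0 (tsum0 bF) /F phi1 psi1 mulr1 => /esym/eqP.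
by rewrite oner_eq0.
Qed.

HB.instance Definition _ := GRing.Zmodule_isNzRing.Build (A ⊗ B)%type
  tmulA tmul1 tmulr1 tmulDl tmulDr tone_neq0.

Lemma tscaleAl (a : k) (s t : A ⊗ B) : a *: (s * t) = (a *: s) * t.
Proof. exact/esym/(scalable_linear (tmul_bilinear.1 t)). Qed.

Lemma tscaleAr (a : k) (s t : A ⊗ B) : a *: (s * t) = s * (a *: t).
Proof. exact/esym/(scalable_linear (tmul_bilinear.2 s)). Qed.

HB.instance Definition _ := GRing.Lmodule_isLalgebra.Build k (A ⊗ B)%type tscaleAl.
HB.instance Definition _ := GRing.Lalgebra_isAlgebra.Build k (A ⊗ B)%type tscaleAr.

End TensorAlgebra.

Record quasi_bialgebra (k : fieldType) (H : algType k) := QuasiBialgebra {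
  comul : {lrmorphism H -> H ⊗ H};
  counit : {lrmorphism H -> k | *%R};
  Phi : H ⊗ H ⊗ H;
  Phi_inv : H ⊗ H ⊗ H;
  PhiV : Phi * Phi_inv = 1;
  VPhi : Phi_inv * Phi = 1;
  comul_quasi_assoc : forall h : H,
    \tsum_(h1, h2 <- comul h) \tsum_(h21, h22 <- comul h2) h1 ⊗ h21 ⊗ h22
    = Phi * (\tsum_(h1, h2 <- comul h) comul h1 ⊗ h2) * Phi_inv;
  comul_counitr : forall h : H,
    \tsum_(h1, h2 <- comul h) counit h2 *: h1 = h;
  comul_counitl : forall h : H,
    \tsum_(h1, h2 <- comul h) counit h1 *: h2 = h;
  Phi_pentagon :
    (\tsum_(X1, X2, X3 <- Phi) 1 ⊗ X1 ⊗ X2 ⊗ X3)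
    * (\tsum_(X1, X2, X3 <- Phi) \tsum_(X21, X22 <- comul X2)
         X1 ⊗ X21 ⊗ X22 ⊗ X3)
    * (Phi ⊗ 1)
    = (\tsum_(X1, X2, X3 <- Phi) \tsum_(X31, X32 <- comul X3)
         X1 ⊗ X2 ⊗ X31 ⊗ X32)
      * (\tsum_(X1, X2, X3 <- Phi) comul X1 ⊗ X2 ⊗ X3);
  Phi_counit1 : \tsum_(X1, X2, X3 <- Phi) counit X1 *: (X2 ⊗ X3) = 1 ⊗ 1;
  Phi_counit2 : \tsum_(X1, X2, X3 <- Phi) counit X2 *: (X1 ⊗ X3) = 1 ⊗ 1;
  Phi_counit3 : \tsum_(X1, X2, X3 <- Phi) counit X3 *: (X1 ⊗ X2) = 1 ⊗ 1
}.

Record quasi_hopf (k : fieldType) (H : algType k) := QuasiHopf {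
  quasi_hopf_bialgebra :> quasi_bialgebra H;
  antipode : {linear H -> H};
  antipode_inv : H -> H;
  antipodeK : cancel antipode antipode_inv;
  antipode_invK : cancel antipode_inv antipode;
  antipode1 : antipode 1 = 1;
  antipodeM : forall g h : H, antipode (g * h) = antipode h * antipode g;
  alpha : H;
  beta : H;
  antipode_alpha : forall h : H,
    \tsum_(h1, h2 <- comul quasi_hopf_bialgebra h) antipode h1 * alpha * h2
    = counit quasi_hopf_bialgebra h *: alpha;
  antipode_beta : forall h : H,
    \tsum_(h1, h2 <- comul quasi_hopf_bialgebra h) h1 * beta * antipode h2
    = counit quasi_hopf_bialgebra h *: beta;
  antipode_Phi :
    \tsum_(X1, X2, X3 <- Phi quasi_hopf_bialgebra)
      X1 * beta * antipode X2 * alpha * X3 = 1;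
  antipode_Phi_inv :
    \tsum_(x1, x2, x3 <- Phi_inv quasi_hopf_bialgebra)
      antipode x1 * alpha * x2 * beta * antipode x3 = 1;
  counit_alpha : counit quasi_hopf_bialgebra alpha = 1;
  counit_beta : counit quasi_hopf_bialgebra beta = 1;
  counit_antipode : forall h : H,
    counit quasi_hopf_bialgebra (antipode h) = counit quasi_hopf_bialgebra h
}.

Section DrinfeldTwist.
Variables (k : fieldType) (H : algType k) (Q : quasi_hopf H).
Local Notation Δ := (comul Q).
Local Notation Φ := (Phi Q).
Local Notation Φi := (Phi_inv Q).
Local Notation S := (antipode Q).
Local Notation Si := (antipode_inv Q).
Local Notation α := (alpha Q).
Local Notation β := (beta Q).

Definition drinfeld_gamma : H ⊗ H :=
  \tsum_(A1, A2, A3, A4 <-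
      (Φ ⊗ 1) * (\tsum_(x1, x2, x3 <- Φi) Δ x1 ⊗ x2 ⊗ x3))
    (S A2 * α * A3) ⊗ (S A1 * α * A4).

Definition drinfeld_delta : H ⊗ H :=
  \tsum_(B1, B2, B3, B4 <-
      (\tsum_(X1, X2, X3 <- Φ) Δ X1 ⊗ X2 ⊗ X3) * (Φi ⊗ 1))
    (B1 * β * S B4) ⊗ (B2 * β * S B3).

Definition drinfeld_twist : H ⊗ H :=
  \tsum_(x1, x2, x3 <- Φi) \tsum_(x11, x12 <- Δ x1)
    ((S x12 ⊗ S x11) * drinfeld_gamma * Δ (x2 * β * S x3)).

(* Drinfeld's explicit formula for the inverse g^1 ⊗ g^2 of [drinfeld_twist]. *)
Definition drinfeld_twist_inv : H ⊗ H :=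
  \tsum_(x1, x2, x3 <- Φi) \tsum_(x31, x32 <- Δ x3)
    (Δ (S x1 * α * x2) * drinfeld_delta * (S x32 ⊗ S x31)).

Definition qR : H ⊗ H :=
  \tsum_(X1, X2, X3 <- Φ) X1 ⊗ (Si (α * X3) * X2).

End DrinfeldTwist.

Record modalg_ops (k : fieldType) (H : algType k) (V : lmodType k) := ModAlgOps {
  amul : V -> V -> V;
  aone : V;
  aact : H -> V -> V
}.

Record ydalg_ops (k : fieldType) (H : algType k) (V : lmodType k) := YDAlgOps {
  ydalg_modalg :> modalg_ops H V;
  acoact : V -> H ⊗ V
}.

Section YetterDrinfeld.
Variables (k : fieldType) (H : algType k) (Q : quasi_hopf H).
Local Notation Δ := (comul Q).
Local Notation ε := (counit Q).
Local Notation Φ := (Phi Q).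
Local Notation Φi := (Phi_inv Q).

Definition is_left_module (M : lmodType k) (act : H -> M -> M) : Prop :=
  [/\ is_bilinear act,
      forall m, act 1 m = m
    & forall g h m, act (g * h) m = act g (act h m)].

Definition is_module_algebra (A : lmodType k) (D : modalg_ops H A) : Prop :=
  let mul := amul D in let one := aone D in let act := aact D in
  [/\ is_left_module act,
      is_bilinear mul,
      forall a, mul one a = a /\ mul a one = a &
  [/\ forall a a' a'',
        mul (mul a a') a''
        = \tsum_(X1, X2, X3 <- Φ) mul (act X1 a) (mul (act X2 a') (act X3 a'')),
      forall h a a',
        act h (mul a a') = \tsum_(h1, h2 <- Δ h) mul (act h1 a) (act h2 a')
    & forall h, act h one = ε h *: one]].

Definition is_yd_module (M : lmodType k)
    (act : H -> M -> M) (coact : M -> H ⊗ M) : Prop :=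
  [/\ is_left_module act,
      linear coact &
  [/\ forall m,
        \tsum_(X1, X2, X3 <- Φ) \tsum_(c, n <- coact m)
        \tsum_(d, p <- coact (act X2 n))
          (X1 * c) ⊗ (d * X3) ⊗ p
        = \tsum_(X1, X2, X3 <- Φ) \tsum_(Y1, Y2, Y3 <- Φ)
          \tsum_(c, n <- coact (act Y1 m)) \tsum_(c1, c2 <- Δ c)
            (X1 * c1 * Y2) ⊗ (X2 * c2 * Y3) ⊗ act X3 n,
      forall m, \tsum_(c, n <- coact m) ε c *: n = m
    & forall h m,
        \tsum_(h1, h2 <- Δ h) \tsum_(c, n <- coact m) (h1 * c) ⊗ act h2 n
        = \tsum_(h1, h2 <- Δ h) \tsum_(c, n <- coact (act h1 m))
            (c * h2) ⊗ n]].

Definition is_yd_algebra (A : lmodType k) (D : ydalg_ops H A) : Prop :=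
  let mul := amul D in let one := aone D in
  let act := aact D in let coact := acoact D in
  [/\ is_module_algebra D,
      is_yd_module act coact,
      coact one = 1 ⊗ one
    & forall a a',
        coact (mul a a')
        = \tsum_(X1, X2, X3 <- Φ) \tsum_(x1, x2, x3 <- Φi)
          \tsum_(Y1, Y2, Y3 <- Φ)
          \tsum_(c, n <- coact (act (x1 * Y1) a))
          \tsum_(d, p <- coact (act Y2 a'))
            (X1 * c * x2 * d * Y3) ⊗ mul (act X2 n) (act (X3 * x3) p)].

Definition is_yd_algebra_morphism (A B : lmodType k)
    (D : ydalg_ops H A) (E : ydalg_ops H B) (f : A -> B) : Prop :=
  [/\ linear f,
      forall h a, f (aact D h a) = aact E h (f a),
      forall a, acoact E (f a) = \tsum_(c, n <- acoact D a) c ⊗ f n,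
      f (aone D) = aone E
    & forall a a', f (amul D a a') = amul E (f a) (f a')].

End YetterDrinfeld.

Section Constructions.
Variables (k : fieldType) (H : algType k) (Q : quasi_hopf H).
Local Notation Δ := (comul Q).
Local Notation Φ := (Phi Q).
Local Notation Φi := (Phi_inv Q).
Local Notation S := (antipode Q).
Local Notation α := (alpha Q).
Local Notation β := (beta Q).

(* B^v.  The product of B is passed as a plain operation because A # H, unlike
   an algType, is the zero algebra when A is. *)
Definition twisted_modalg (B : lmodType k) (mulB : B -> B -> B) (v : H -> B) :
    modalg_ops H B :=
  let prod5 b1 b2 b3 b4 b5 := mulB (mulB (mulB (mulB b1 b2) b3) b4) b5 in
  {| amul := fun b b' =>
       \tsum_(X1, X2, X3 <- Φ) \tsum_(x1, x2, x3 <- Φi)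
       \tsum_(X31, X32 <- Δ X3)
         prod5 (v X1) b (v (S (x1 * X2) * α * x2 * X31)) b' (v (S (x3 * X32)));
     aone := v β;
     aact := fun h b => \tsum_(h1, h2 <- Δ h) mulB (mulB (v h1) b) (v (S h2)) |}.

(* H_0 = H^id *)
Definition H0 : ydalg_ops H H :=
  {| ydalg_modalg := twisted_modalg *%R idfun;
     acoact := fun h =>
       \tsum_(X1, X2, X3 <- Φ) \tsum_(Y1, Y2, Y3 <- Φ)
       \tsum_(Y11, Y12 <- Δ Y1) \tsum_(Y21, Y22 <- Δ Y2)
       \tsum_(h1, h2 <- Δ h)
       \tsum_(g1, g2 <- drinfeld_twist_inv Q) \tsum_(q1, q2 <- qR Q)
         (X1 * Y11 * h1 * g1 * S (q2 * Y22) * Y3)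
         ⊗ (X2 * Y12 * h2 * g2 * S (X3 * q1 * Y21)) |}.

Variables (A : lmodType k) (D : ydalg_ops H A).

(* The element a # h of A # H is [a ⊗ h]. *)
Definition smash_mul (s t : A ⊗ H) : A ⊗ H :=
  \tsum_(a, h <- s) \tsum_(a', h' <- t)
  \tsum_(x1, x2, x3 <- Φi) \tsum_(h1, h2 <- Δ h)
    amul D (aact D x1 a) (aact D (x2 * h1) a') ⊗ (x3 * h2 * h').

Definition smash_j (h : H) : A ⊗ H := aone D ⊗ h.

Definition smash_coact (s : A ⊗ H) : H ⊗ (A ⊗ H) :=
  \tsum_(a, h <- s)
  \tsum_(X1, X2, X3 <- Φ) \tsum_(Y1, Y2, Y3 <- Φ) \tsum_(T1, T2, T3 <- Φ)
  \tsum_(t1, t2, t3 <- Φi)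
  \tsum_(g1, g2 <- drinfeld_twist_inv Q) \tsum_(q1, q2 <- qR Q)
  \tsum_(X21, X22 <- Δ X2)
  \tsum_(Y11, Y12 <- Δ Y1) \tsum_(Y121, Y122 <- Δ Y12)
  \tsum_(Y21, Y22 <- Δ Y2)
  \tsum_(h1, h2 <- Δ h)
  \tsum_(c, n <- acoact D (aact D t1 a))
    (X1 * Y11 * T1 * c * t2 * h1 * g1 * S (q2 * Y22) * Y3)
    ⊗ (aact D (X21 * Y121 * T2) n
       ⊗ (X22 * Y122 * T3 * t3 * h2 * g2 * S (X3 * q1 * Y21))).

(* (A # H)^j with its coaction *)
Definition smash_ydalg : ydalg_ops H (A ⊗ H)%type :=
  {| ydalg_modalg := twisted_modalg smash_mul smash_j;
     acoact := smash_coact |}.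

End Constructions.

(* Main.v *)
Require Import Defs.
From HB Require Import structures.
From mathcomp Require Import all_boot all_algebra.
From mathcomp Require Import boolp.

Set Implicit Arguments.
Unset Strict Implicit.
Unset Printing Implicit Defensive.

Import GRing.Theory.
Local Open Scope ring_scope.

(* The proof factors through two general constructions.

   (1) A ⊗ H, with the smash product, is an H-comodule algebra: it is generated
   by the elements i(a) = a ⊗ 1 and by the image of j, and the coaction is
     lam (i(a) j(h)) = G(a) (h_1 ⊗ j(h_2)),
     G(a) = T^1 (t^1.a)_(-1) t^2 ⊗ i(T^2.(t^1.a)_(0)) j(T^3 t^3).
   Only the relations between i and j enter.

   (2) If an H-comodule algebra (B, lam) receives a comodule algebra map v from
   H, then B^v is an algebra in the Yetter-Drinfeld category.  The idea is to
   let b in B^v act on B by theta(b) = v(X^1) b v(S(X^2) α X^3): the map theta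
   satisfies the same relations with v as i does with j, it turns the twisted
   product into the product of B, and the elements theta(h.b) determine b.  The
   coaction of B^v is the one for which G(b) = lam(theta(b)), so the formal
   computations of (1), run backwards, yield the Yetter-Drinfeld axioms for B^v.
   The displayed coaction agrees with this one because g^1 ⊗ g^2 intertwines
   Δ o S with (S ⊗ S) o Δ^cop, by uniqueness of antipodes along Δ.

   When A ⊗ H = 0 there is nothing to prove, while (2) assumes B nonzero. *)

(** Every tensor identity is stated in test form, for an arbitrary multilinear [F] into an arbitrary
    module: this is what allows it to be applied to some legs in the middle of a longer Sweedler
    sum. Behind [theta] stand q_R and p_R = x^1 ⊗ x^2 β S(x^3): theta(b) = q^1 b S(q^2), and b is
    recovered because p_R cancels q_R. The recovery uses theta(x^1.b), not theta(b) alone. Hence an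
    equation for B^v is tested on theta(h.b) for all h, and each side must first be shown compatible
    with h; the lemmas that move [h] through the product and coassociativity formulas exist for
    this. The coaction of B^v is not guessed: the recovery formula, carried over to H ⊗ B, solves
    lam(theta(b)) = G(b) for it, and [ad_coact] records the solution. When the displayed coaction is
    compared with it, the inverse twist meets q_R, and the product is evaluated through g γ =
    Δ(α). *)

Definition tsum3 (k : fieldType) (V1 V2 V3 U : lmodType k)
    (t : V1 ⊗ V2 ⊗ V3) (F : V1 -> V2 -> V3 -> U) : U :=
  \tsum_(x, y, z <- t) F x y z.

(** A constant of its own, so that the tactics below exchange and match a sum over a threefold
    tensor as one block. *)
Notation "\tsum3_ ( x , y , z <- t ) b" := (tsum3 t (fun x y z => b))
  (at level 46, x name, y name, z name, t at level 200, b at level 46,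
   format "\tsum3_ ( x ,  y ,  z  <-  t )  b") : ring_scope.

Definition tsum4 (k : fieldType) (V1 V2 V3 V4 U : lmodType k) (t : V1 ⊗ V2 ⊗ V3 ⊗ V4)
    (F : V1 -> V2 -> V3 -> V4 -> U) : U :=
  tsum t (fun xyz w => \tsum3_(x, y, z <- xyz) F x y z w).

(** * Sums over decompositions into pure tensors, and their linearity *)

Section Sums.
Variable k : fieldType.
Implicit Types V W U : lmodType k.

Lemma eq_tsum V W U (t : V ⊗ W) (F G : V -> W -> U) :
  (forall x y, F x y = G x y) -> tsum t F = tsum t G.
Proof. by move=> FG; apply: eq_bigr => p _; exact: FG. Qed.

Lemma eq_tsum3 V1 V2 V3 U (t : V1 ⊗ V2 ⊗ V3) (F G : V1 -> V2 -> V3 -> U) :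
  (forall x y z, F x y z = G x y z) -> tsum3 t F = tsum3 t G.
Proof. by move=> FG; apply: eq_tsum => ? ?; apply: eq_tsum. Qed.

(** Both sides are finite double sums over the chosen representatives of [s] and [t]. *)
Lemma tsum_exchange V W V' W' U (s : V ⊗ W) (t : V' ⊗ W')
    (F : V -> W -> V' -> W' -> U) :
  tsum s (fun a b => tsum t (F a b))
  = tsum t (fun c d => tsum s (fun a b => F a b c d)).
Proof. exact: exchange_big. Qed.

Lemma tsum_tsum3 V W V1 V2 V3 U (s : V ⊗ W) (t : V1 ⊗ V2 ⊗ V3)
    (F : V -> W -> V1 -> V2 -> V3 -> U) :
  tsum s (fun a b => tsum3 t (F a b))
  = tsum3 t (fun x y z => tsum s (fun a b => F a b x y z)).
Proof.
rewrite /tsum3 tsum_exchange; apply: eq_tsum => xy z; exact: tsum_exchange.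
Qed.

Lemma tsum3_tsum V W V1 V2 V3 U (s : V ⊗ W) (t : V1 ⊗ V2 ⊗ V3)
    (F : V1 -> V2 -> V3 -> V -> W -> U) :
  tsum3 t (fun x y z => tsum s (F x y z))
  = tsum s (fun a b => tsum3 t (fun x y z => F x y z a b)).
Proof. by rewrite tsum_tsum3. Qed.

Lemma tsum3_exchange V1 V2 V3 W1 W2 W3 U (s : V1 ⊗ V2 ⊗ V3) (t : W1 ⊗ W2 ⊗ W3)
    (F : V1 -> V2 -> V3 -> W1 -> W2 -> W3 -> U) :
  tsum3 s (fun a b c => tsum3 t (F a b c))
  = tsum3 t (fun x y z => tsum3 s (fun a b c => F a b c x y z)).
Proof.
transitivity (tsum s (fun ab c => tsum3 t (fun x y z =>
  tsum ab (fun a b => F a b c x y z)))); last exact: tsum_tsum3.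
by apply: eq_tsum => ab c; exact: tsum_tsum3.
Qed.

(** Multilinearity is a class so that the side conditions of the rewriting rules are found by
    instance search, through hints that call [lin]. *)
Class Lin V W (f : V -> W) : Prop := lin_p : linear f.
Class Bilin V W U (F : V -> W -> U) : Prop := bilin_p : is_bilinear F.
Class Trilin V1 V2 V3 U (F : V1 -> V2 -> V3 -> U) : Prop := Trilinear {
  trilin1 : forall y z, Lin (fun x => F x y z);
  trilin2 : forall x z, Lin (fun y => F x y z);
  trilin3 : forall x y, Lin (fun z => F x y z) }.
Class Quadrilin V1 V2 V3 V4 U (F : V1 -> V2 -> V3 -> V4 -> U) : Prop :=
  Quadrilinear {
  quadrilin1 : forall y z w, Lin (fun x => F x y z w);
  quadrilin2 : forall x z w, Lin (fun y => F x y z w);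
  quadrilin3 : forall x y w, Lin (fun z => F x y z w);
  quadrilin4 : forall x y z, Lin (fun w => F x y z w) }.

Lemma lin0 V W (f : V -> W) : linear f -> f 0 = 0.
Proof.
by move=> lf; have := lf (-1) 0 0; rewrite scaler0 addr0 scaleN1r addNr.
Qed.
Lemma linD V W (f : V -> W) x y : linear f -> f (x + y) = f x + f y.
Proof. by move=> lf; have := lf 1 x y; rewrite !scale1r. Qed.
Lemma linZ V W (f : V -> W) a x : linear f -> f (a *: x) = a *: f x.
Proof. by move=> lf; have := lf a x 0; rewrite !addr0 lin0// addr0. Qed.

Lemma lin_tsum V W U U' (f : U -> U') (t : V ⊗ W) (F : V -> W -> U) :
  linear f -> f (tsum t F) = tsum t (fun x y => f (F x y)).
Proof.
move=> lf; rewrite /tsum /fsum; elim: (repr t) => [|p s IHs].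
  by rewrite !big_nil lin0.
by rewrite !big_cons linD// IHs.
Qed.

Lemma lin_tsum3 V1 V2 V3 U U' (f : U -> U') (t : V1 ⊗ V2 ⊗ V3) F :
  linear f -> f (tsum3 t F) = tsum3 t (fun x y z => f (F x y z)).
Proof.
by move=> lf; rewrite /tsum3 lin_tsum//; apply: eq_tsum => ? ?; rewrite lin_tsum.
Qed.

Lemma Lin_id V : Lin (fun x : V => x).
Proof. by []. Qed.
Lemma Lin_comp V W U (f : W -> U) (g : V -> W) :
  Lin f -> Lin g -> Lin (fun x => f (g x)).
Proof. by move=> lf lg a x y; rewrite lg lf. Qed.
Lemma Lin_mull V (A : algType k) (c : A) (g : V -> A) :
  Lin g -> Lin (fun x => c * g x).
Proof. by move=> lg a x y; rewrite lg mulrDr scalerAr. Qed.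
Lemma Lin_mulr V (A : algType k) (c : A) (g : V -> A) :
  Lin g -> Lin (fun x => g x * c).
Proof. by move=> lg a x y; rewrite lg mulrDl scalerAl. Qed.
Lemma Lin_purel V W W' (c : W') (g : V -> W) : Lin g -> Lin (fun x => g x ⊗ c).
Proof.
move=> lg; apply: (@Lin_comp _ _ _ (fun v => v ⊗ c)) => //.
exact: (pure_bilinear _ _).1.
Qed.
Lemma Lin_purer V W W' (c : W') (g : V -> W) : Lin g -> Lin (fun x => c ⊗ g x).
Proof.
move=> lg; apply: (@Lin_comp _ _ _ (fun v => c ⊗ v)) => //.
exact: (pure_bilinear _ _).2.
Qed.
Lemma Lin_scaler V W (a : k) (g : V -> W) : Lin g -> Lin (fun x => a *: g x).
Proof. by move=> lg b x y; rewrite lg scalerDr !scalerA mulrC. Qed.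
Lemma Lin_tsum_param V W (X : lmodType k) U (F : X -> V -> W -> U) (t : V ⊗ W) :
  (forall v w, Lin (fun x => F x v w)) -> Lin (fun x => tsum t (F x)).
Proof. exact: tsum_linear_param. Qed.
Lemma Lin_tsum_src V W (X : lmodType k) U (F : V -> W -> U) (t : X -> V ⊗ W) :
  is_bilinear F -> Lin t -> Lin (fun x => tsum (t x) F).
Proof.
by move=> bF lt; apply: (@Lin_comp _ _ _ (fun t => tsum t F)) => //; exact: tsum_linear.
Qed.
Lemma Lin_tsum3_param V1 V2 V3 (X : lmodType k) U (F : X -> V1 -> V2 -> V3 -> U)
    (t : V1 ⊗ V2 ⊗ V3) :
  (forall v w z, Lin (fun x => F x v w z)) -> Lin (fun x => tsum3 t (F x)).
Proof. by move=> lF; do 2!apply: Lin_tsum_param => ? ?. Qed.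

Lemma tri_bilin V1 V2 V3 U (F : V1 -> V2 -> V3 -> U) : Trilin F ->
  is_bilinear (fun xy z => tsum xy (fun x y => F x y z)).
Proof.
move=> [l1 l2 l3]; split=> [z|xy]; last by apply: Lin_tsum_param.
by apply: tsum_linear; split=> [y|x]; [exact: l1 | exact: l2].
Qed.
Lemma Lin_tsum3_src V1 V2 V3 (X : lmodType k) U (F : V1 -> V2 -> V3 -> U)
    (t : X -> V1 ⊗ V2 ⊗ V3) :
  Trilin F -> Lin t -> Lin (fun x => tsum3 (t x) F).
Proof. move=> tF lt; apply: Lin_tsum_src => //; exact: tri_bilin. Qed.
Lemma Lin_counit (H : algType k) (Q : quasi_bialgebra H) V W (g : V -> H) (c : W) :
  Lin g -> Lin (fun x => counit Q (g x) *: c).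
Proof. by move=> lg a x y; rewrite lg linearP scalerDl scalerA. Qed.

Lemma tsumE V W U (F : V -> W -> U) v w : Bilin F -> tsum (v ⊗ w) F = F v w.
Proof. by move=> bF; exact: tsum_pure. Qed.
Lemma tsum3E V1 V2 V3 U (F : V1 -> V2 -> V3 -> U) x y z : Trilin F ->
  tsum3 (x ⊗ y ⊗ z) F = F x y z.
Proof.
move=> tF; rewrite /tsum3 tsum_pure; last exact: tri_bilin.
by rewrite tsum_pure//; split=> ?; [exact: trilin1 | exact: trilin2].
Qed.

Lemma pureM (A B : algType k) (a a' : A) (b b' : B) :
  (a ⊗ b) * (a' ⊗ b') = (a * a') ⊗ (b * b').
Proof. exact: tmul_pure. Qed.

Lemma tsumK V W (t : V ⊗ W) : \tsum_(a, b <- t) (a ⊗ b) = t.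
Proof. by symmetry; exact: tensorE. Qed.

Lemma mulr_tsuml V W (A : algType k) (t : V ⊗ W) (F : V -> W -> A) c :
  tsum t F * c = tsum t (fun x y => F x y * c).
Proof. by apply: (lin_tsum (f := fun x => x * c)); apply: Lin_mulr. Qed.
Lemma mulr_tsumr V W (A : algType k) (t : V ⊗ W) (F : V -> W -> A) c :
  c * tsum t F = tsum t (fun x y => c * F x y).
Proof. by apply: (lin_tsum (f := fun x => c * x)); apply: Lin_mull. Qed.
Lemma mulr_tsum3l V1 V2 V3 (A : algType k) (t : V1 ⊗ V2 ⊗ V3) (F : V1 -> V2 -> V3 -> A) c :
  tsum3 t F * c = tsum3 t (fun x y z => F x y z * c).
Proof. by apply: (lin_tsum3 (f := fun x => x * c)); apply: Lin_mulr. Qed.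
Lemma mulr_tsum3r V1 V2 V3 (A : algType k) (t : V1 ⊗ V2 ⊗ V3) (F : V1 -> V2 -> V3 -> A) c :
  c * tsum3 t F = tsum3 t (fun x y z => c * F x y z).
Proof. by apply: (lin_tsum3 (f := fun x => c * x)); apply: Lin_mull. Qed.
End Sums.

Lemma bilin1 (k : fieldType) (V W U : lmodType k) (F : V -> W -> U) c :
  Bilin F -> Lin (fun x => F x c).
Proof. by case=> l1 l2; exact: l1. Qed.
Lemma bilin2 (k : fieldType) (V W U : lmodType k) (F : V -> W -> U) c :
  Bilin F -> Lin (F c).
Proof. by case=> l1 l2; exact: l2. Qed.

(** * Automatic proofs of multilinearity *)

Ltac lin_base :=
  match goal with
  | H : linear ?f |- Lin (fun x => ?f x) => exact H
  | H : Lin ?f |- Lin (fun x => ?f x) => exact H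
  | H : is_bilinear ?f |- Lin (fun x => ?f ?c x) => exact (bilin2 c H)
  | H : is_bilinear ?f |- Lin (fun x => ?f x ?c) => exact (bilin1 c H)
  | H : Bilin ?f |- Lin (fun x => ?f ?c x) => exact (bilin2 c H)
  | H : Bilin ?f |- Lin (fun x => ?f x ?c) => exact (bilin1 c H)
  | H : Trilin ?F |- Lin (fun x => ?F _ _ _) =>
    first [ exact (@trilin1 _ _ _ _ _ _ H _ _) | exact (@trilin2 _ _ _ _ _ _ H _ _)
          | exact (@trilin3 _ _ _ _ _ _ H _ _)]
  | H : Quadrilin ?F |- Lin (fun x => ?F _ _ _ _) =>
    first [ exact (@quadrilin1 _ _ _ _ _ _ _ H _ _ _) | exact (@quadrilin2 _ _ _ _ _ _ _ H _ _ _)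
          | exact (@quadrilin3 _ _ _ _ _ _ _ H _ _ _) | exact (@quadrilin4 _ _ _ _ _ _ _ H _ _ _) ]
  | |- _ => exact (linearP _)
  end.

(** Syntax-directed: at each product, tensor or sum the pattern [fun _ => ?z] recognises the
    argument free of the variable, and the recursion enters the other one. *)
Ltac lin :=
  cbv beta;
  try lazymatch goal with
      | |- Lin (fun _ => _) => idtac
      | |- Lin ?f => change (Lin (fun x => f x))
      end;
  lazymatch goal with
  | |- Trilin _ => split=> ? ?; lin
  | |- Quadrilin _ => split=> ? ? ?; lin
  | |- Bilin _ => split=> ?; lin
  | |- is_bilinear _ => split=> ?; lin
  | |- linear ?f => change (Lin f); lin
  | |- Lin (fun x => x) => exact: Lin_id
  | |- Lin (fun x => tsum (@?t x) (@?F x)) =>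
    lazymatch t with
    | fun _ => ?z => notypeclasses refine (Lin_tsum_param _ _) => ? ?
    | _ => notypeclasses refine (Lin_tsum_src _ _)
    end; lin
  | |- Lin (fun x => tsum3 (@?t x) (@?F x)) =>
    lazymatch t with
    | fun _ => ?z => notypeclasses refine (Lin_tsum3_param _ _) => ? ? ?
    | _ => notypeclasses refine (Lin_tsum3_src _ _)
    end; lin
  | |- Lin (fun x => tsum4 (@?t x) (@?F x)) => rewrite /tsum4; lin
  | |- Lin (fun x => @?c x * @?g x) =>
    lazymatch c with
    | fun _ => ?z => notypeclasses refine (Lin_mull _ _)
    | _ => notypeclasses refine (Lin_mulr _ _)
    end; lin
  | |- Lin (fun x => @?c x ⊗ @?g x) =>
    lazymatch c with
    | fun _ => ?z => notypeclasses refine (Lin_purer _ _)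
    | _ => notypeclasses refine (Lin_purel _ _)
    end; lin
  | |- Lin (fun x => @?c x *: @?g x) =>
    lazymatch c with
    | fun _ => ?z => notypeclasses refine (Lin_scaler _ _)
    | _ => notypeclasses refine (Lin_counit _ _ _)
    end; lin
  | |- _ =>
    first
    [ solve [lin_base]
    | match goal with
      | |- Lin (fun x => ?f (@?g x)) =>
        notypeclasses refine (@Lin_comp _ _ _ _ (fun y => f y) g _ _);
        [lin_base | lin]
      | |- Lin (fun x => ?f (@?g x) ?c) =>
        notypeclasses refine (@Lin_comp _ _ _ _ (fun y => f y c) g _ _);
        [lin_base | lin]
      | |- Lin (fun x => ?f (@?g x) ?c ?d) =>
        notypeclasses refine (@Lin_comp _ _ _ _ (fun y => f y c d) g _ _);
        [lin_base | lin]
      | |- Lin (fun x => ?f (@?g x) ?c ?d ?e) =>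
        notypeclasses refine (@Lin_comp _ _ _ _ (fun y => f y c d e) g _ _);
        [lin_base | lin]
      end ]
  end.

#[global] Hint Extern 0 (Bilin _) => lin : typeclass_instances.
#[global] Hint Extern 0 (Trilin _) => lin : typeclass_instances.
#[global] Hint Extern 0 (Quadrilin _) => lin : typeclass_instances.
#[global] Hint Extern 0 (Lin _) => lin : typeclass_instances.

(** * Sums over products and sums of tensors *)

Section TensorMul.
Variables (k : fieldType).
Implicit Types (A B C E : algType k) (U : lmodType k).

Lemma tensor3_ext (V1 V2 V3 U : lmodType k) (f g : V1 ⊗ V2 ⊗ V3 -> U) :
  linear f -> linear g ->
  (forall x y z, f (x ⊗ y ⊗ z) = g (x ⊗ y ⊗ z)) -> f =1 g.
Proof.
move=> lf lg fg; apply: tensor_ext => // xy z; move: xy.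
by apply: tensor_ext => [||x y]; [lin | lin | exact: fg].
Qed.

Lemma tsumM A B U (s t : A ⊗ B) (F : A -> B -> U) : Bilin F ->
  tsum (s * t) F = \tsum_(a, b <- s) \tsum_(a', b' <- t) F (a * a') (b * b').
Proof.
move=> bF; move: s; apply: tensor_ext; [lin | lin | move=> a b].
rewrite tsumE; move: t; apply: tensor_ext; [lin | lin | move=> a' b'].
by rewrite pureM !tsumE.
Qed.

Lemma tsum3M A B C U (s t : A ⊗ B ⊗ C) (F : A -> B -> C -> U) : Trilin F ->
  tsum3 (s * t) F
  = \tsum3_(x, y, z <- s) \tsum3_(x', y', z' <- t) F (x * x') (y * y') (z * z').
Proof.
move=> tF; move: s; apply: tensor3_ext; [lin | lin | move=> a b c].
rewrite tsum3E; move: t; apply: tensor3_ext; [lin | lin | move=> a' b' c'].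
by rewrite !pureM !tsum3E.
Qed.

Section Comul.
Variables (H : algType k) (Q : quasi_bialgebra H).
Local Notation Δ := (comul Q).

Lemma tsum_comulM U (F : H -> H -> U) g h : Bilin F ->
  tsum (Δ (g * h)) F
  = \tsum_(g1, g2 <- Δ g) \tsum_(h1, h2 <- Δ h) F (g1 * h1) (g2 * h2).
Proof. by move=> bF; rewrite rmorphM /= tsumM. Qed.

Lemma tsum_comul1 U (F : H -> H -> U) : Bilin F -> tsum (Δ 1) F = F 1 1.
Proof. by move=> bF; rewrite rmorph1 tsumE. Qed.

End Comul.

Lemma tsum_tsum_src (V W V' W' U : lmodType k) (t : V ⊗ W) (G : V -> W -> V' ⊗ W')
    (F : V' -> W' -> U) : Bilin F ->
  tsum (tsum t G) F = tsum t (fun x y => tsum (G x y) F).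
Proof. move=> bF; apply: (lin_tsum (f := fun t => tsum t F)); exact: tsum_linear. Qed.

Lemma tsum_tsum3_src (V1 V2 V3 V' W' U : lmodType k) (t : V1 ⊗ V2 ⊗ V3)
    (G : V1 -> V2 -> V3 -> V' ⊗ W') (F : V' -> W' -> U) : Bilin F ->
  tsum (tsum3 t G) F = tsum3 t (fun x y z => tsum (G x y z) F).
Proof. move=> bF; apply: (lin_tsum3 (f := fun t => tsum t F)); exact: tsum_linear. Qed.

Lemma tsum3_tsum_src (V W V1 V2 V3 U : lmodType k) (t : V ⊗ W)
    (G : V -> W -> V1 ⊗ V2 ⊗ V3) (F : V1 -> V2 -> V3 -> U) : Trilin F ->
  tsum3 (tsum t G) F = tsum t (fun x y => tsum3 (G x y) F).
Proof.
by move=> tF; apply: (lin_tsum (f := fun t => tsum3 t F)); exact: tsum_linear (tri_bilin tF).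
Qed.

Lemma tsum3_tsum3_src (V1 V2 V3 W1 W2 W3 U : lmodType k) (t : V1 ⊗ V2 ⊗ V3)
    (G : V1 -> V2 -> V3 -> W1 ⊗ W2 ⊗ W3) (F : W1 -> W2 -> W3 -> U) : Trilin F ->
  tsum3 (tsum3 t G) F = tsum3 t (fun x y z => tsum3 (G x y z) F).
Proof.
by move=> tF; apply: (lin_tsum3 (f := fun t => tsum3 t F)); exact: tsum_linear (tri_bilin tF).
Qed.
End TensorMul.

#[global] Arguments tsumE {k V W U} F v w {_}.
#[global] Arguments tsumM {k A B U} s t F {_}.
#[global] Arguments tsum3E {k V1 V2 V3 U} F x y z {_}.
#[global] Arguments tsum3_tsum_src {k V W V1 V2 V3 U} t G F {_}.
#[global] Arguments tsum3_tsum3_src {k V1 V2 V3 W1 W2 W3 U} t G F {_}.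
#[global] Arguments tsum_comulM {k H} Q {U} F g h {_}.
#[global] Arguments tsum_comul1 {k H} Q {U} F {_}.
#[global] Arguments tsum_tsum_src {k V W V' W' U} t G F {_}.
#[global] Arguments tsum_tsum3_src {k V1 V2 V3 V' W' U} t G F {_}.

(** * Automatic comparison of iterated Sweedler sums *)

Ltac same_source s t :=
  first
  [ constr_eq s t
  | lazymatch s with
    | ?f ?x => lazymatch t with ?g ?y => constr_eq f g; unify x y end
    end ].

(* [pull t] rewrites an iterated sum so that a summation over [t] comes first;
   it has one success for each summation over [t], and [psum] backtracks into
   the other ones when two sums fail to agree up to the order of summation. *)
Ltac pull t :=
  (lazymatch goal with
   | |- tsum ?s _ = _ => same_source s t; reflexivity
   | |- tsum3 ?s _ = _ => same_source s t; reflexivity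
   end)
  + (lazymatch goal with
     | |- tsum ?s _ = _ =>
       eapply eq_trans;
       [ eapply eq_tsum; intros; cbv beta; pull t
       | lazymatch goal with
         | |- tsum _ (fun _ _ => tsum _ _) = _ => exact (tsum_exchange _ _ _)
         | |- tsum _ (fun _ _ => tsum3 _ _) = _ => exact (tsum_tsum3 _ _ _)
         end ]
     | |- tsum3 ?s _ = _ =>
       eapply eq_trans;
       [ eapply eq_tsum3; intros; cbv beta; pull t
       | lazymatch goal with
         | |- tsum3 _ (fun _ _ _ => tsum _ _) = _ => exact (tsum3_tsum _ _ _)
         | |- tsum3 _ (fun _ _ _ => tsum3 _ _) = _ => exact (tsum3_exchange _ _ _)
         end ]
     end).

(* Normalisation of summands, and (below) of summation sources; redefined in
   each section with the rewriting rules that it needs. *)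
Ltac leaf_simpl := idtac.
Ltac leaf := leaf_simpl; rewrite ?pureM ?mul1r ?mulr1 ?mulrA; reflexivity.

(** The right-hand side dictates the order: its outermost source is pulled to the front on the left,
    and the recursion goes under both binders. *)
Ltac reorder :=
  cbv beta;
  lazymatch goal with
  | |- _ = tsum ?t _ =>
    eapply eq_trans; [pull t | eapply eq_tsum; intros; reorder]
  | |- _ = tsum3 ?t _ =>
    eapply eq_trans; [pull t | eapply eq_tsum3; intros; reorder]
  | |- _ = _ => leaf
  end.

Ltac src_simpl := idtac.

(* Rewrites every summation over a composite tensor (a coproduct of a product,
   a sum of pure tensors, ...) into summations over atomic ones. *)
Ltac expand :=
  cbv beta;
  lazymatch goal with |- tsum _ _ = _ => src_simpl | |- _ => idtac end;
  lazymatch goal with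
  | |- tsum ?t _ = _ =>
    lazymatch t with
    | _ ⊗ _ => refine (eq_trans (tsumE _ _ _) _)
    | @GRing.mul _ _ _ => refine (eq_trans (tsumM _ _ _) _)
    | tsum _ _ => refine (eq_trans (tsum_tsum_src _ _ _) _)
    | tsum3 _ _ => refine (eq_trans (tsum_tsum3_src _ _ _) _)
    | ?f (@GRing.mul _ _ _) =>
      lazymatch f with
      | context [@comul] => refine (eq_trans (tsum_comulM _ _ _ _) _)
      | _ => apply: eq_tsum => ? ?
      end
    | ?f (@GRing.one _) =>
      lazymatch f with
      | context [@comul] => refine (eq_trans (tsum_comul1 _ _) _)
      | _ => apply: eq_tsum => ? ?
      end
    | _ => apply: eq_tsum => ? ?
    end; expand
  | |- tsum3 ?t _ = _ =>
    lazymatch t with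
    | _ ⊗ _ ⊗ _ => refine (eq_trans (tsum3E _ _ _ _) _)
    | tsum _ _ => refine (eq_trans (tsum3_tsum_src _ _ _) _)
    | tsum3 _ _ => refine (eq_trans (tsum3_tsum3_src _ _ _) _)
    | _ => apply: eq_tsum3 => ? ? ?
    end; expand
  | |- ?e = _ => distribute e
  end
with distribute e :=
  lazymatch e with
  | context C [tsum ?t ?F] =>
    let T := type of (tsum t F) in
    let f := constr:(fun z : T => ltac:(let r := context C [z] in exact r)) in
    refine (eq_trans (lin_tsum (f := f) t F _) _); [lin | expand]
  | context C [tsum3 ?t ?F] =>
    let T := type of (tsum3 t F) in
    let f := constr:(fun z : T => ltac:(let r := context C [z] in exact r)) in
    refine (eq_trans (lin_tsum3 (f := f) t F _) _); [lin | expand]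
  | _ => reflexivity
  end.

(* Proves that two iterated sums agree up to multilinear expansion and order of
   summation; [via R] rewrites the left-hand side with R modulo [psum]. *)
Ltac psum :=
  eapply eq_trans; [expand | eapply eq_trans; [ | symmetry; expand]; reorder].

Ltac via R :=
  let E := fresh in
  pose proof R as E; cbv beta in E;
  refine (eq_trans (eq_trans _ E) _); clear E; [solve [psum] | ].

Section TensorProducts.
Variables (k : fieldType).
Implicit Types (A B C E : algType k) (U : lmodType k).

Lemma tsum4E (V1 V2 V3 V4 U : lmodType k) (F : V1 -> V2 -> V3 -> V4 -> U) x y z w :
  Quadrilin F -> tsum4 (x ⊗ y ⊗ z ⊗ w) F = F x y z w.
Proof. by move=> qF; rewrite /tsum4 tsumE tsum3E. Qed.

Lemma tsum4M A B C E U (s t : A ⊗ B ⊗ C ⊗ E) (F : A -> B -> C -> E -> U) :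
  Quadrilin F ->
  tsum4 (s * t) F = tsum4 s (fun x y z w => tsum4 t (fun x' y' z' w' =>
    F (x * x') (y * y') (z * z') (w * w'))).
Proof.
move=> qF; rewrite /tsum4 tsumM; apply: eq_tsum => s' w.
apply: etrans (tsum_tsum3 _ _ _); apply: eq_tsum => t' w'.
by rewrite tsum3M.
Qed.

Lemma lin_tsum4 (V1 V2 V3 V4 U : lmodType k)
  (F : V1 -> V2 -> V3 -> V4 -> U) (qF : Quadrilin F) : linear (fun t => tsum4 t F).
Proof. by rewrite /tsum4; lin. Qed.

End TensorProducts.

(** * The quasi-bialgebra axioms under multilinear maps *)

Section Rules.
Variables (k : fieldType) (H : algType k) (Q : quasi_hopf H).
Local Notation Δ := (comul Q).
Local Notation ε := (counit Q).
Local Notation Φ := (Phi Q).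
Local Notation Φi := (Phi_inv Q).
Implicit Types (U : lmodType k) (W : H ⊗ H ⊗ H).

Lemma tsum_counitl U (F : H -> U) h : Lin F ->
  \tsum_(h1, h2 <- Δ h) (ε h1 *: F h2) = F h.
Proof.
move=> lF; rewrite -[in RHS](comul_counitl Q h) (lin_tsum _ _ lF).
by apply: eq_tsum => x y; rewrite linZ.
Qed.
#[global] Arguments tsum_counitl {U} F h {_}.

Lemma tsum_counitr U (F : H -> U) h : Lin F ->
  \tsum_(h1, h2 <- Δ h) (ε h2 *: F h1) = F h.
Proof.
move=> lF; rewrite -[in RHS](comul_counitr Q h) (lin_tsum _ _ lF).
by apply: eq_tsum => x y; rewrite linZ.
Qed.
#[global] Arguments tsum_counitr {U} F h {_}.

Lemma PhiK U (F : H -> H -> H -> U) : Trilin F ->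
  \tsum3_(X1, X2, X3 <- Φ) \tsum3_(x1, x2, x3 <- Φi)
    F (X1 * x1) (X2 * x2) (X3 * x3) = F 1 1 1.
Proof. by move=> tF; rewrite -tsum3M PhiV tsum3E. Qed.
#[global] Arguments PhiK {U} F {_}.

Lemma Phi_invK U (F : H -> H -> H -> U) : Trilin F ->
  \tsum3_(x1, x2, x3 <- Φi) \tsum3_(X1, X2, X3 <- Φ)
    F (x1 * X1) (x2 * X2) (x3 * X3) = F 1 1 1.
Proof. by move=> tF; rewrite -tsum3M VPhi tsum3E. Qed.
#[global] Arguments Phi_invK {U} F {_}.

Lemma tsum3_comul_l W U (F : H -> H -> H -> U) h : Trilin F ->
  tsum3 (W * (\tsum_(h1, h2 <- Δ h) Δ h1 ⊗ h2)) F
  = \tsum3_(X1, X2, X3 <- W) \tsum_(h1, h2 <- Δ h) \tsum_(h11, h12 <- Δ h1)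
      F (X1 * h11) (X2 * h12) (X3 * h2).
Proof.
move=> tF; rewrite tsum3M; apply: eq_tsum3 => X1 X2 X3.
rewrite (lin_tsum (f := fun t => tsum3 t _)); last lin.
by apply: eq_tsum => h1 h2; rewrite /tsum3 tsumE.
Qed.

Lemma tsum3_comul_r W U (F : H -> H -> H -> U) h : Trilin F ->
  tsum3 ((\tsum_(h1, h2 <- Δ h) \tsum_(h21, h22 <- Δ h2) h1 ⊗ h21 ⊗ h22) * W) F
  = \tsum3_(X1, X2, X3 <- W) \tsum_(h1, h2 <- Δ h) \tsum_(h21, h22 <- Δ h2)
      F (h1 * X1) (h21 * X2) (h22 * X3).
Proof.
move=> tF; rewrite tsum3M (lin_tsum (f := fun t => tsum3 t _)); last lin.
rewrite tsum3_tsum; apply: eq_tsum => h1 h2.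
rewrite (lin_tsum (f := fun t => tsum3 t _)); last lin.
by rewrite tsum3_tsum; apply: eq_tsum => h21 h22; rewrite tsum3E.
Qed.

Lemma tsum3_comul_l' W U (F : H -> H -> H -> U) h : Trilin F ->
  tsum3 ((\tsum_(h1, h2 <- Δ h) Δ h1 ⊗ h2) * W) F
  = \tsum3_(X1, X2, X3 <- W) \tsum_(h1, h2 <- Δ h) \tsum_(h11, h12 <- Δ h1)
      F (h11 * X1) (h12 * X2) (h2 * X3).
Proof.
move=> tF; rewrite tsum3M (lin_tsum (f := fun t => tsum3 t _)); last lin.
rewrite tsum3_tsum; apply: eq_tsum => h1 h2.
by rewrite tsum3_tsum /tsum3 tsumE.
Qed.

Lemma tsum3_comul_r' W U (F : H -> H -> H -> U) h : Trilin F ->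
  tsum3 (W * (\tsum_(h1, h2 <- Δ h) \tsum_(h21, h22 <- Δ h2) h1 ⊗ h21 ⊗ h22)) F
  = \tsum3_(X1, X2, X3 <- W) \tsum_(h1, h2 <- Δ h) \tsum_(h21, h22 <- Δ h2)
      F (X1 * h1) (X2 * h21) (X3 * h22).
Proof.
move=> tF; rewrite tsum3M; apply: eq_tsum3 => X1 X2 X3.
rewrite (lin_tsum (f := fun t => tsum3 t _)); last lin.
apply: eq_tsum => h1 h2; rewrite (lin_tsum (f := fun t => tsum3 t _)); last lin.
by apply: eq_tsum => h21 h22; rewrite tsum3E.
Qed.

Lemma quasi_assoc U (F : H -> H -> H -> U) h : Trilin F ->
  \tsum3_(X1, X2, X3 <- Φ) \tsum_(h1, h2 <- Δ h) \tsum_(h11, h12 <- Δ h1)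
    F (X1 * h11) (X2 * h12) (X3 * h2)
  = \tsum3_(X1, X2, X3 <- Φ) \tsum_(h1, h2 <- Δ h) \tsum_(h21, h22 <- Δ h2)
    F (h1 * X1) (h21 * X2) (h22 * X3).
Proof.
move=> tF; rewrite -tsum3_comul_l -tsum3_comul_r comul_quasi_assoc.
by rewrite -(mulrA _ Φi) VPhi mulr1.
Qed.
#[global] Arguments quasi_assoc {U} F h {_}.

Lemma quasi_assoc_inv U (F : H -> H -> H -> U) h : Trilin F ->
  \tsum3_(x1, x2, x3 <- Φi) \tsum_(h1, h2 <- Δ h) \tsum_(h21, h22 <- Δ h2)
    F (x1 * h1) (x2 * h21) (x3 * h22)
  = \tsum3_(x1, x2, x3 <- Φi) \tsum_(h1, h2 <- Δ h) \tsum_(h11, h12 <- Δ h1)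
    F (h11 * x1) (h12 * x2) (h2 * x3).
Proof.
move=> tF; rewrite -tsum3_comul_l' -tsum3_comul_r' comul_quasi_assoc.
by rewrite !mulrA VPhi mul1r.
Qed.
#[global] Arguments quasi_assoc_inv {U} F h {_}.

(* The five edges of the pentagon *)
Definition pent_a W : H ⊗ H ⊗ H ⊗ H := \tsum3_(X1, X2, X3 <- W) 1 ⊗ X1 ⊗ X2 ⊗ X3.
Definition pent_b W : H ⊗ H ⊗ H ⊗ H :=
  \tsum3_(X1, X2, X3 <- W) \tsum_(X21, X22 <- Δ X2) X1 ⊗ X21 ⊗ X22 ⊗ X3.
Definition pent_c W : H ⊗ H ⊗ H ⊗ H := W ⊗ 1.
Definition pent_d W : H ⊗ H ⊗ H ⊗ H :=
  \tsum3_(X1, X2, X3 <- W) \tsum_(X31, X32 <- Δ X3) X1 ⊗ X2 ⊗ X31 ⊗ X32.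
Definition pent_e W : H ⊗ H ⊗ H ⊗ H :=
  \tsum3_(X1, X2, X3 <- W) Δ X1 ⊗ X2 ⊗ X3.

Section Edges.
Variables (U : lmodType k) (F : H -> H -> H -> H -> U).
Hypothesis qF : Quadrilin F.

Lemma tsum4_a W : tsum4 (pent_a W) F = \tsum3_(X1, X2, X3 <- W) F 1 X1 X2 X3.
Proof.
rewrite (lin_tsum3 (f := fun t => tsum4 t F)); last exact: (lin_tsum4 qF).
by apply: eq_tsum3 => *; rewrite tsum4E.
Qed.

Lemma tsum4_b W : tsum4 (pent_b W) F
  = \tsum3_(X1, X2, X3 <- W) \tsum_(X21, X22 <- Δ X2) F X1 X21 X22 X3.
Proof.
rewrite (lin_tsum3 (f := fun t => tsum4 t F)); last exact: (lin_tsum4 qF).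
apply: eq_tsum3 => *; rewrite (lin_tsum (f := fun t => tsum4 t F)); last exact: (lin_tsum4 qF).
by apply: eq_tsum => *; rewrite tsum4E.
Qed.

Lemma tsum4_c W : tsum4 (pent_c W) F = \tsum3_(X1, X2, X3 <- W) F X1 X2 X3 1.
Proof. by rewrite /tsum4 tsumE. Qed.

Lemma tsum4_d W : tsum4 (pent_d W) F
  = \tsum3_(X1, X2, X3 <- W) \tsum_(X31, X32 <- Δ X3) F X1 X2 X31 X32.
Proof.
rewrite (lin_tsum3 (f := fun t => tsum4 t F)); last exact: (lin_tsum4 qF).
apply: eq_tsum3 => *; rewrite (lin_tsum (f := fun t => tsum4 t F)); last exact: (lin_tsum4 qF).
by apply: eq_tsum => *; rewrite tsum4E.
Qed.

Lemma tsum4_e W : tsum4 (pent_e W) F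
  = \tsum3_(X1, X2, X3 <- W) \tsum_(X11, X12 <- Δ X1) F X11 X12 X2 X3.
Proof.
rewrite (lin_tsum3 (f := fun t => tsum4 t F)); last exact: (lin_tsum4 qF).
by apply: eq_tsum3 => *; rewrite /tsum4 tsumE /tsum3 tsumE.
Qed.
End Edges.

End Rules.

Ltac eval4 :=
  first [rewrite tsum4_a | rewrite tsum4_b | rewrite tsum4_c
        | rewrite tsum4_d | rewrite tsum4_e | idtac];
  lazymatch goal with
  | |- tsum3 _ _ = _ => apply: eq_tsum3 => * /=; eval4
  | |- tsum _ _ = _ => apply: eq_tsum => * /=; eval4
  | |- _ => rewrite ?mul1r ?mulr1
  end.

(** * The pentagon, solved for its various edges *)

Section PentagonRules.
Variables (k : fieldType) (H : algType k) (Q : quasi_hopf H).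
Local Notation Δ := (comul Q).
Local Notation Φ := (Phi Q).
Local Notation Φi := (Phi_inv Q).
Implicit Types (U : lmodType k) (W : H ⊗ H ⊗ H).

Lemma pentagon U (F : H -> H -> H -> H -> U) : Quadrilin F ->
  \tsum3_(Z1, Z2, Z3 <- Φ) \tsum3_(X1, X2, X3 <- Φ) \tsum_(X21, X22 <- Δ X2)
  \tsum3_(Y1, Y2, Y3 <- Φ)
    F (X1 * Y1) (Z1 * X21 * Y2) (Z2 * X22 * Y3) (Z3 * X3)
  = \tsum3_(U1, U2, U3 <- Φ) \tsum_(U31, U32 <- Δ U3)
    \tsum3_(V1, V2, V3 <- Φ) \tsum_(V11, V12 <- Δ V1)
    F (U1 * V11) (U2 * V12) (U31 * V2) (U32 * V3).
Proof.
move=> qF.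
have E : tsum4 (pent_a Φ * pent_b Q Φ * pent_c Φ) F = tsum4 (pent_d Q Φ * pent_e Q Φ) F.
  by rewrite /pent_a /pent_b /pent_c /pent_d /pent_e /tsum3 Phi_pentagon.
transitivity (tsum4 (pent_a Φ * pent_b Q Φ * pent_c Φ) F).
  by symmetry; rewrite !tsum4M; eval4.
by rewrite E !tsum4M; eval4.
Qed.
#[global] Arguments pentagon {U} F {_}.

Section PentagonVariants.
Variable U : lmodType k.
Implicit Types F : H -> H -> H -> H -> U.

(* [op_x W F] composes F with right multiplication by [pent_x W], so that edges
   can be moved across the pentagon by cancelling inverse operators. *)
Definition op_a W F x y z w := \tsum3_(X1, X2, X3 <- W) F x (y * X1) (z * X2) (w * X3).
Definition op_b W F x y z w :=
  \tsum3_(X1, X2, X3 <- W) \tsum_(X21, X22 <- Δ X2)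
    F (x * X1) (y * X21) (z * X22) (w * X3).
Definition op_c W F x y z w := \tsum3_(X1, X2, X3 <- W) F (x * X1) (y * X2) (z * X3) w.
Definition op_d W F x y z w :=
  \tsum3_(X1, X2, X3 <- W) \tsum_(X31, X32 <- Δ X3)
    F (x * X1) (y * X2) (z * X31) (w * X32).
Definition op_e W F x y z w :=
  \tsum3_(X1, X2, X3 <- W) \tsum_(X11, X12 <- Δ X1)
    F (x * X11) (y * X12) (z * X2) (w * X3).

#[local] Instance op_a_lin W F : Quadrilin F -> Quadrilin (op_a W F).
Proof. by move=> qF; rewrite /op_a; lin. Qed.
#[local] Instance op_b_lin W F : Quadrilin F -> Quadrilin (op_b W F).
Proof. by move=> qF; rewrite /op_b; lin. Qed.
#[local] Instance op_c_lin W F : Quadrilin F -> Quadrilin (op_c W F).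
Proof. by move=> qF; rewrite /op_c; lin. Qed.
#[local] Instance op_d_lin W F : Quadrilin F -> Quadrilin (op_d W F).
Proof. by move=> qF; rewrite /op_d; lin. Qed.
#[local] Instance op_e_lin W F : Quadrilin F -> Quadrilin (op_e W F).
Proof. by move=> qF; rewrite /op_e; lin. Qed.

Lemma funext4 F G : (forall x y z w, F x y z w = G x y z w) -> F = G.
Proof. by move=> FG; do 4![apply/funext => ?]. Qed.

(** The outer operator puts its factors to the left of those of the inner one, so the composite is
    the operator of [W * W']. For edges that contain a coproduct, multiplicativity of Δ gives the
    same. *)
Lemma op_aK W W' F : W * W' = 1 -> Quadrilin F -> op_a W (op_a W' F) = F.
Proof.
move=> WW qF; apply: funext4 => x y z w; rewrite /op_a.
transitivity (\tsum3_(X1, X2, X3 <- W * W') F x (y * X1) (z * X2) (w * X3)).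
  by rewrite tsum3M; psum.
by rewrite WW tsum3E !mulr1.
Qed.

Lemma op_bK W W' F : W * W' = 1 -> Quadrilin F -> op_b W (op_b W' F) = F.
Proof.
move=> WW qF; apply: funext4 => x y z w; rewrite /op_b.
transitivity (\tsum3_(X1, X2, X3 <- W * W') \tsum_(X21, X22 <- Δ X2)
    F (x * X1) (y * X21) (z * X22) (w * X3)).
  rewrite tsum3M; apply: eq_tsum3 => *.
  by rewrite tsum_tsum3; apply: eq_tsum3 => *; rewrite tsum_comulM; psum.
by rewrite WW tsum3E tsum_comul1 !mulr1.
Qed.

Lemma op_cK W W' F : W * W' = 1 -> Quadrilin F -> op_c W (op_c W' F) = F.
Proof.
move=> WW qF; apply: funext4 => x y z w; rewrite /op_c.
transitivity (\tsum3_(X1, X2, X3 <- W * W') F (x * X1) (y * X2) (z * X3) w).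
  by rewrite tsum3M; psum.
by rewrite WW tsum3E !mulr1.
Qed.

Lemma op_dK W W' F : W * W' = 1 -> Quadrilin F -> op_d W (op_d W' F) = F.
Proof.
move=> WW qF; apply: funext4 => x y z w; rewrite /op_d.
transitivity (\tsum3_(X1, X2, X3 <- W * W') \tsum_(X31, X32 <- Δ X3)
    F (x * X1) (y * X2) (z * X31) (w * X32)).
  rewrite tsum3M; apply: eq_tsum3 => *.
  by rewrite tsum_tsum3; apply: eq_tsum3 => *; rewrite tsum_comulM; psum.
by rewrite WW tsum3E tsum_comul1 !mulr1.
Qed.

Lemma op_eK W W' F : W * W' = 1 -> Quadrilin F -> op_e W (op_e W' F) = F.
Proof.
move=> WW qF; apply: funext4 => x y z w; rewrite /op_e.
transitivity (\tsum3_(X1, X2, X3 <- W * W') \tsum_(X11, X12 <- Δ X1)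
    F (x * X11) (y * X12) (z * X2) (w * X3)).
  rewrite tsum3M; apply: eq_tsum3 => *.
  by rewrite tsum_tsum3; apply: eq_tsum3 => *; rewrite tsum_comulM; psum.
by rewrite WW tsum3E tsum_comul1 !mulr1.
Qed.

Lemma op_pentagon F : Quadrilin F ->
  op_a Φ (op_b Φ (op_c Φ F)) = op_d Φ (op_e Φ F).
Proof.
move=> qF; apply: funext4 => x y z w; rewrite /op_a /op_b /op_c /op_d /op_e.
via (pentagon (fun a b c d => F (x * a) (y * b) (z * c) (w * d))).
by psum.
Qed.

(** This and the following [op_] identities carry edges of the pentagon to the other side, each
    cancelled against its inverse operator. *)
Lemma op_ce F : Quadrilin F ->
  op_c Φ (op_e Φi F) = op_b Φi (op_a Φi (op_d Φ F)).
Proof.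
move=> qF; have PV := PhiV Q; have VP := VPhi Q.
transitivity (op_b Φi (op_a Φi (op_a Φ (op_b Φ (op_c Φ (op_e Φi F)))))).
  by rewrite (op_aK VP) (op_bK VP).
by rewrite op_pentagon (op_eK PV).
Qed.

Lemma op_ec F : Quadrilin F ->
  op_e Φ (op_c Φi F) = op_d Φi (op_a Φ (op_b Φ F)).
Proof.
move=> qF; have PV := PhiV Q; have VP := VPhi Q.
transitivity (op_d Φi (op_d Φ (op_e Φ (op_c Φi F)))).
  by rewrite (op_dK VP).
by rewrite -op_pentagon (op_cK PV).
Qed.

Lemma op_cba F : Quadrilin F ->
  op_c Φi (op_b Φi (op_a Φi F)) = op_e Φi (op_d Φi F).
Proof.
move=> qF; have PV := PhiV Q; have VP := VPhi Q.
pose G := op_e Φi (op_d Φi F); have qG : Quadrilin G by rewrite /G; exact: _.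
transitivity (op_c Φi (op_b Φi (op_a Φi (op_a Φ (op_b Φ (op_c Φ G)))))).
  by rewrite op_pentagon (op_eK PV) (op_dK PV).
by rewrite (op_aK VP) (op_bK VP) (op_cK VP).
Qed.

Lemma op_ad F : Quadrilin F ->
  op_a Φi (op_d Φ F) = op_b Φ (op_c Φ (op_e Φi F)).
Proof.
move=> qF; have PV := PhiV Q; have VP := VPhi Q.
transitivity (op_a Φi (op_a Φ (op_b Φ (op_c Φ (op_e Φi F))))).
  by rewrite op_pentagon (op_eK PV).
by rewrite (op_aK VP).
Qed.

Lemma op_ced F : Quadrilin F ->
  op_c Φ (op_e Φi (op_d Φi F)) = op_b Φi (op_a Φi F).
Proof.
move=> qF; have PV := PhiV Q; have VP := VPhi Q.
by rewrite -op_cba (op_cK PV).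
Qed.

Lemma op_cV F : Quadrilin F ->
  op_c Φi F = op_e Φi (op_d Φi (op_a Φ (op_b Φ F))).
Proof.
move=> qF; have PV := PhiV Q; have VP := VPhi Q.
transitivity (op_e Φi (op_d Φi (op_d Φ (op_e Φ (op_c Φi F))))).
  by rewrite (op_dK VP) (op_eK VP).
by rewrite -op_pentagon (op_cK PV).
Qed.

(** The edge Φ^{-1} ⊗ 1 in terms of the four others; meant for sums over a single Φ^{-1}, seen as
    having a trivial fourth leg. *)
Lemma pentagon_c F : Quadrilin F ->
  \tsum3_(x1, x2, x3 <- Φi) F x1 x2 x3 1
  = \tsum3_(y1, y2, y3 <- Φi) \tsum_(y11, y12 <- Δ y1)
    \tsum3_(x1, x2, x3 <- Φi) \tsum_(x31, x32 <- Δ x3)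
    \tsum3_(X1, X2, X3 <- Φ)
    \tsum3_(Y1, Y2, Y3 <- Φ) \tsum_(Y21, Y22 <- Δ Y2)
    F (y11 * x1 * Y1) (y12 * x2 * X1 * Y21) (y2 * x31 * X2 * Y22)
      (y3 * x32 * X3 * Y3).
Proof.
move=> qF; have := congr1 (fun G => G 1 1 1 1) (op_cV qF).
rewrite /op_a /op_b /op_c /op_d /op_e => E.
by apply: etrans (etrans _ E) _; psum.
Qed.
#[global] Arguments pentagon_c F {_}.

Lemma op_ab F : Quadrilin F ->
  op_a Φ (op_b Φ F) = op_d Φ (op_e Φ (op_c Φi F)).
Proof. by move=> qF; rewrite -op_pentagon (op_cK (PhiV Q)). Qed.

Lemma pentagon_ab F : Quadrilin F ->
  \tsum3_(Z1, Z2, Z3 <- Φ) \tsum3_(X1, X2, X3 <- Φ) \tsum_(X21, X22 <- Δ X2)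
    F X1 (Z1 * X21) (Z2 * X22) (Z3 * X3)
  = \tsum3_(U1, U2, U3 <- Φ) \tsum_(U31, U32 <- Δ U3)
    \tsum3_(V1, V2, V3 <- Φ) \tsum_(V11, V12 <- Δ V1)
    \tsum3_(y1, y2, y3 <- Φi)
    F (U1 * V11 * y1) (U2 * V12 * y2) (U31 * V2 * y3) (U32 * V3).
Proof.
move=> qF; have := congr1 (fun G => G 1 1 1 1) (op_ab qF).
rewrite /op_a /op_b /op_c /op_d /op_e => E.
by apply: etrans (etrans _ E) _; psum.
Qed.
#[global] Arguments pentagon_ab F {_}.

Lemma pentagon_ce F : Quadrilin F ->
  \tsum3_(X1, X2, X3 <- Φ) \tsum3_(x1, x2, x3 <- Φi) \tsum_(x11, x12 <- Δ x1)
    F (X1 * x11) (X2 * x12) (X3 * x2) x3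
  = \tsum3_(u1, u2, u3 <- Φi) \tsum_(u21, u22 <- Δ u2)
    \tsum3_(z1, z2, z3 <- Φi)
    \tsum3_(Y1, Y2, Y3 <- Φ) \tsum_(Y31, Y32 <- Δ Y3)
    F (u1 * Y1) (u21 * z1 * Y2) (u22 * z2 * Y31) (u3 * z3 * Y32).
Proof.
move=> qF; have := congr1 (fun G => G 1 1 1 1) (op_ce qF).
rewrite /op_a /op_b /op_c /op_d /op_e => E.
by apply: etrans (etrans _ E) _; psum.
Qed.
#[global] Arguments pentagon_ce F {_}.

Lemma pentagon_ec F : Quadrilin F ->
  \tsum3_(V1, V2, V3 <- Φ) \tsum_(V11, V12 <- Δ V1) \tsum3_(y1, y2, y3 <- Φi)
    F (V11 * y1) (V12 * y2) (V2 * y3) V3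
  = \tsum3_(x1, x2, x3 <- Φi) \tsum_(x31, x32 <- Δ x3)
    \tsum3_(Z1, Z2, Z3 <- Φ)
    \tsum3_(X1, X2, X3 <- Φ) \tsum_(X21, X22 <- Δ X2)
    F (x1 * X1) (x2 * Z1 * X21) (x31 * Z2 * X22) (x32 * Z3 * X3).
Proof.
move=> qF; have := congr1 (fun G => G 1 1 1 1) (op_ec qF).
rewrite /op_a /op_b /op_c /op_d /op_e => E.
by apply: etrans (etrans _ E) _; psum.
Qed.
#[global] Arguments pentagon_ec F {_}.

Lemma pentagon_inv F : Quadrilin F ->
  \tsum3_(x1, x2, x3 <- Φi)
  \tsum3_(y1, y2, y3 <- Φi) \tsum_(y21, y22 <- Δ y2)
  \tsum3_(z1, z2, z3 <- Φi)
    F (x1 * y1) (x2 * y21 * z1) (x3 * y22 * z2) (y3 * z3)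
  = \tsum3_(x1, x2, x3 <- Φi) \tsum_(x11, x12 <- Δ x1)
    \tsum3_(y1, y2, y3 <- Φi) \tsum_(y31, y32 <- Δ y3)
    F (x11 * y1) (x12 * y2) (x2 * y31) (x3 * y32).
Proof.
move=> qF; have := congr1 (fun G => G 1 1 1 1) (op_cba qF).
rewrite /op_a /op_b /op_c /op_d /op_e => E.
by apply: etrans (etrans _ E) _; psum.
Qed.
#[global] Arguments pentagon_inv F {_}.

Lemma pentagon_ad F : Quadrilin F ->
  \tsum3_(x1, x2, x3 <- Φi) \tsum3_(X1, X2, X3 <- Φ) \tsum_(X31, X32 <- Δ X3)
    F X1 (x1 * X2) (x2 * X31) (x3 * X32)
  = \tsum3_(X1, X2, X3 <- Φ) \tsum_(X21, X22 <- Δ X2)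
    \tsum3_(Y1, Y2, Y3 <- Φ)
    \tsum3_(x1, x2, x3 <- Φi) \tsum_(x11, x12 <- Δ x1)
    F (X1 * Y1 * x11) (X21 * Y2 * x12) (X22 * Y3 * x2) (X3 * x3).
Proof.
move=> qF; have := congr1 (fun G => G 1 1 1 1) (op_ad qF).
rewrite /op_a /op_b /op_c /op_d /op_e => E.
by apply: etrans (etrans _ E) _; psum.
Qed.
#[global] Arguments pentagon_ad F {_}.

Lemma pentagon_ced F : Quadrilin F ->
  \tsum3_(X1, X2, X3 <- Φ) \tsum3_(y1, y2, y3 <- Φi) \tsum_(y11, y12 <- Δ y1)
  \tsum3_(x1, x2, x3 <- Φi) \tsum_(x31, x32 <- Δ x3)
    F (X1 * y11 * x1) (X2 * y12 * x2) (X3 * y2 * x31) (y3 * x32)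
  = \tsum3_(x1, x2, x3 <- Φi) \tsum_(x21, x22 <- Δ x2)
    \tsum3_(y1, y2, y3 <- Φi)
    F x1 (x21 * y1) (x22 * y2) (x3 * y3).
Proof.
move=> qF; have := congr1 (fun G => G 1 1 1 1) (op_ced qF).
rewrite /op_a /op_b /op_c /op_d /op_e => E.
by apply: etrans (etrans _ E) _; psum.
Qed.
#[global] Arguments pentagon_ced F {_}.
End PentagonVariants.
End PentagonRules.

Ltac leaf_simpl ::= rewrite ?antipodeM ?antipode1.

(** * Antipode, α and β; the elements p_R and q_R *)

Section Antipode.
Variables (k : fieldType) (H : algType k) (Q : quasi_hopf H).
Local Notation Δ := (comul Q).
Local Notation ε := (counit Q).
Local Notation Φ := (Phi Q).
Local Notation Φi := (Phi_inv Q).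
Local Notation S := (antipode Q).
Local Notation α := (alpha Q).
Local Notation β := (beta Q).
Implicit Types (U : lmodType k) (W : H ⊗ H ⊗ H).

(** Isolates what Φ and Φ^{-1} share, so that the cancellation rules for α and β are stated once for
    both. *)
Definition counital W := forall U (F : H -> H -> U), Bilin F ->
  [/\ \tsum3_(X1, X2, X3 <- W) (ε X1 *: F X2 X3) = F 1 1,
      \tsum3_(X1, X2, X3 <- W) (ε X2 *: F X1 X3) = F 1 1
    & \tsum3_(X1, X2, X3 <- W) (ε X3 *: F X1 X2) = F 1 1].

Lemma counital_Phi : counital Φ.
Proof.
move=> U F bF; split.
- rewrite -[RHS]tsumE -(Phi_counit1 Q).
  transitivity (\tsum3_(X1, X2, X3 <- Φ) tsum (ε X1 *: (X2 ⊗ X3)) F).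
    by apply: eq_tsum3 => *; rewrite (linZ _ _ (tsum_linear bF)) tsumE.
  by symmetry; apply: (lin_tsum3 (f := fun t => tsum t F)); exact: tsum_linear.
- rewrite -[RHS]tsumE -(Phi_counit2 Q).
  transitivity (\tsum3_(X1, X2, X3 <- Φ) tsum (ε X2 *: (X1 ⊗ X3)) F).
    by apply: eq_tsum3 => *; rewrite (linZ _ _ (tsum_linear bF)) tsumE.
  by symmetry; apply: (lin_tsum3 (f := fun t => tsum t F)); exact: tsum_linear.
- rewrite -[RHS]tsumE -(Phi_counit3 Q).
  transitivity (\tsum3_(X1, X2, X3 <- Φ) tsum (ε X3 *: (X1 ⊗ X2)) F).
    by apply: eq_tsum3 => *; rewrite (linZ _ _ (tsum_linear bF)) tsumE.
  by symmetry; apply: (lin_tsum3 (f := fun t => tsum t F)); exact: tsum_linear.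
Qed.

(** A copy of Φ with one leg under ε is trivial; inserted next to Φ^{-1}, it merges with it by
    multiplicativity of ε and cancels it. *)
Lemma counital_Phi_inv : counital Φi.
Proof.
move=> U F bF; split.
- transitivity (\tsum3_(x1, x2, x3 <- Φi) \tsum3_(X1, X2, X3 <- Φ)
     (ε (x1 * X1) *: F (x2 * X2) (x3 * X3))).
    apply: eq_tsum3 => x1 x2 x3; rewrite -[in LHS](mulr1 x2) -[in LHS](mulr1 x3).
    have [<- _ _] := @counital_Phi _ (fun a b => ε x1 *: F (x2 * a) (x3 * b)) _.
    by apply: eq_tsum3 => *; rewrite scalerA rmorphM mulrC.
  by rewrite (Phi_invK Q (fun a b c => ε a *: F b c)) rmorph1 scale1r.
- transitivity (\tsum3_(x1, x2, x3 <- Φi) \tsum3_(X1, X2, X3 <- Φ)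
     (ε (x2 * X2) *: F (x1 * X1) (x3 * X3))).
    apply: eq_tsum3 => x1 x2 x3; rewrite -[in LHS](mulr1 x1) -[in LHS](mulr1 x3).
    have [_ <- _] := @counital_Phi _ (fun a b => ε x2 *: F (x1 * a) (x3 * b)) _.
    by apply: eq_tsum3 => *; rewrite scalerA rmorphM mulrC.
  by rewrite (Phi_invK Q (fun a b c => ε b *: F a c)) rmorph1 scale1r.
- transitivity (\tsum3_(x1, x2, x3 <- Φi) \tsum3_(X1, X2, X3 <- Φ)
     (ε (x3 * X3) *: F (x1 * X1) (x2 * X2))).
    apply: eq_tsum3 => x1 x2 x3; rewrite -[in LHS](mulr1 x1) -[in LHS](mulr1 x2).
    have [_ _ <-] := @counital_Phi _ (fun a b => ε x3 *: F (x1 * a) (x2 * b)) _.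
    by apply: eq_tsum3 => *; rewrite scalerA rmorphM mulrC.
  by rewrite (Phi_invK Q (fun a b c => ε c *: F a b)) rmorph1 scale1r.
Qed.

Lemma tsum_alpha U (F : H -> U) h : Lin F ->
  \tsum_(h1, h2 <- Δ h) F (S h1 * α * h2) = ε h *: F α.
Proof.
move=> lF; rewrite -linZ // -(antipode_alpha Q).
by symmetry; exact: lin_tsum.
Qed.
#[global] Arguments tsum_alpha {U} F h {_}.

Lemma tsum_beta U (F : H -> U) h : Lin F ->
  \tsum_(h1, h2 <- Δ h) F (h1 * β * S h2) = ε h *: F β.
Proof.
move=> lF; rewrite -linZ // -(antipode_beta Q).
by symmetry; exact: lin_tsum.
Qed.
#[global] Arguments tsum_beta {U} F h {_}.

Section Kill.
Variables (U : lmodType k) (W : H ⊗ H ⊗ H) (F : H -> H -> H -> U).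
Hypotheses (cW : counital W) (tF : Trilin F).

(** The two halves of the coproduct collapse around α to the scalar [ε X1], and counitality then
    removes the whole copy of [W]. The five variants below work alike. *)
Lemma alpha_kill1 : \tsum3_(X1, X2, X3 <- W) \tsum_(X11, X12 <- Δ X1)
  F (S X11 * α * X12) X2 X3 = F α 1 1.
Proof.
have [<- _ _] := @cW _ (F α) _.
by apply: eq_tsum3 => X1 X2 X3; rewrite (tsum_alpha (fun a => F a X2 X3)).
Qed.

Lemma alpha_kill2 : \tsum3_(X1, X2, X3 <- W) \tsum_(X21, X22 <- Δ X2)
  F X1 (S X21 * α * X22) X3 = F 1 α 1.
Proof.
have [_ <- _] := @cW _ (F^~ α) _.
by apply: eq_tsum3 => X1 X2 X3; rewrite (tsum_alpha (fun a => F X1 a X3)).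
Qed.

Lemma alpha_kill3 : \tsum3_(X1, X2, X3 <- W) \tsum_(X31, X32 <- Δ X3)
  F X1 X2 (S X31 * α * X32) = F 1 1 α.
Proof.
have [_ _ <-] := @cW _ (fun a b => F a b α) _.
by apply: eq_tsum3 => X1 X2 X3; rewrite (tsum_alpha (fun a => F X1 X2 a)).
Qed.

Lemma beta_kill1 : \tsum3_(X1, X2, X3 <- W) \tsum_(X11, X12 <- Δ X1)
  F (X11 * β * S X12) X2 X3 = F β 1 1.
Proof.
have [<- _ _] := @cW _ (F β) _.
by apply: eq_tsum3 => X1 X2 X3; rewrite (tsum_beta (fun a => F a X2 X3)).
Qed.

Lemma beta_kill2 : \tsum3_(X1, X2, X3 <- W) \tsum_(X21, X22 <- Δ X2)
  F X1 (X21 * β * S X22) X3 = F 1 β 1.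
Proof.
have [_ <- _] := @cW _ (F^~ β) _.
by apply: eq_tsum3 => X1 X2 X3; rewrite (tsum_beta (fun a => F X1 a X3)).
Qed.

Lemma beta_kill3 : \tsum3_(X1, X2, X3 <- W) \tsum_(X31, X32 <- Δ X3)
  F X1 X2 (X31 * β * S X32) = F 1 1 β.
Proof.
have [_ _ <-] := @cW _ (fun a b => F a b β) _.
by apply: eq_tsum3 => X1 X2 X3; rewrite (tsum_beta (fun a => F X1 X2 a)).
Qed.
End Kill.
#[global] Arguments alpha_kill1 {U W} F cW {tF}.
#[global] Arguments alpha_kill2 {U W} F cW {tF}.
#[global] Arguments alpha_kill3 {U W} F cW {tF}.
#[global] Arguments beta_kill1 {U W} F cW {tF}.
#[global] Arguments beta_kill2 {U W} F cW {tF}.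
#[global] Arguments beta_kill3 {U W} F cW {tF}.

Lemma antipode_PhiE U (F : H -> U) : Lin F ->
  \tsum3_(X1, X2, X3 <- Φ) F (X1 * β * S X2 * α * X3) = F 1.
Proof. by move=> lF; rewrite -(antipode_Phi Q); symmetry; exact: lin_tsum3. Qed.
#[global] Arguments antipode_PhiE {U} F {_}.

Lemma antipode_Phi_invE U (F : H -> U) : Lin F ->
  \tsum3_(x1, x2, x3 <- Φi) F (S x1 * α * x2 * β * S x3) = F 1.
Proof. by move=> lF; rewrite -(antipode_Phi_inv Q); symmetry; exact: lin_tsum3. Qed.
#[global] Arguments antipode_Phi_invE {U} F {_}.

Let cΦ := counital_Phi.
Let cΦi := counital_Phi_inv.

(** This is Δ(q^1) p_R (1 ⊗ S(q^2)) = 1 ⊗ 1. The pentagon supplies coproducts around α and β, which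
    disappear, and one antipode axiom remains. *)
Lemma qp_cancel U (F : H -> H -> U) : Bilin F ->
  \tsum3_(Y1, Y2, Y3 <- Φ) \tsum_(Y11, Y12 <- Δ Y1) \tsum3_(y1, y2, y3 <- Φi)
    F (Y11 * y1) (Y12 * y2 * β * S (Y2 * y3) * α * Y3) = F 1 1.
Proof.
move=> bF.
via (pentagon_ec Q (fun a b c d => F a (b * β * S c * α * d))).
via (alpha_kill3 (fun x1 x2 y => \tsum3_(Z1, Z2, Z3 <- Φ) \tsum3_(X1, X2, X3 <- Φ)
  \tsum_(X21, X22 <- Δ X2)
  F (x1 * X1) (x2 * Z1 * X21 * β * S (Z2 * X22) * y * Z3 * X3)) cΦi).
via (beta_kill2 (fun X1 y X3 => \tsum3_(Z1, Z2, Z3 <- Φ)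
  F X1 (Z1 * y * S Z2 * α * Z3 * X3)) cΦ).
via (antipode_PhiE (fun z => F 1 z)).
by [].
Qed.
#[global] Arguments qp_cancel {U} F {_}.

(** The companion (1 ⊗ S^{-1}(p^2)) q_R Δ(p^1) = 1 ⊗ 1, with S applied to the second leg so that
    S^{-1} does not occur. *)
Lemma pq_cancel U (F : H -> H -> U) : Bilin F ->
  \tsum3_(X1, X2, X3 <- Φ) \tsum3_(x1, x2, x3 <- Φi) \tsum_(x11, x12 <- Δ x1)
    F (X1 * x11) (S (X2 * x12) * α * X3 * x2 * β * S x3) = F 1 1.
Proof.
move=> bF.
via (pentagon_ce Q (fun a b c d => F a (S b * α * c * β * S d))).
via (alpha_kill2 (fun u1 y u3 => \tsum3_(z1, z2, z3 <- Φi)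
  \tsum3_(Y1, Y2, Y3 <- Φ) \tsum_(Y31, Y32 <- Δ Y3)
  F (u1 * Y1) (S (z1 * Y2) * y * z2 * Y31 * β * S (u3 * z3 * Y32))) cΦi).
via (beta_kill3 (fun Y1 Y2 y => \tsum3_(z1, z2, z3 <- Φi)
  F Y1 (S (z1 * Y2) * α * z2 * y * S z3)) cΦ).
via (antipode_Phi_invE (fun z => F 1 z)).
by [].
Qed.
#[global] Arguments pq_cancel {U} F {_}.

(** In terms of p_R: Δ(h_1) p_R (1 ⊗ S(h_2)) = p_R (h ⊗ 1). After quasi-associativity, β absorbs
    h_2. *)
Lemma pR_comul U (F : H -> H -> U) h : Bilin F ->
  \tsum3_(y1, y2, y3 <- Φi) \tsum_(h1, h2 <- Δ h) \tsum_(h11, h12 <- Δ h1)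
    F (h11 * y1) (h12 * y2 * β * S (h2 * y3))
  = \tsum3_(y1, y2, y3 <- Φi) F (y1 * h) (y2 * β * S y3).
Proof.
move=> bF.
via (esym (quasi_assoc_inv Q (fun a b c => F a (b * β * S c)) h)).
apply: eq_tsum3 => y1 y2 y3.
rewrite -(tsum_counitr Q (fun h => F (y1 * h) (y2 * β * S y3)) h).
apply: eq_tsum => h1 h2.
by rewrite -(tsum_beta (fun z => F (y1 * h1) (y2 * z * S y3))); psum.
Qed.
#[global] Arguments pR_comul {U} F h {_}.

(** In terms of q_R: (1 ⊗ S^{-1}(h_2)) q_R Δ(h_1) = (h ⊗ 1) q_R, with S applied to the second
    leg. *)
Lemma qR_comul U (F : H -> H -> U) h : Bilin F ->
  \tsum3_(X1, X2, X3 <- Φ) \tsum_(h1, h2 <- Δ h) \tsum_(h11, h12 <- Δ h1)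
    F (X1 * h11) (S (X2 * h12) * α * X3 * h2)
  = \tsum3_(X1, X2, X3 <- Φ) F (h * X1) (S X2 * α * X3).
Proof.
move=> bF.
via (quasi_assoc Q (fun a b c => F a (S b * α * c)) h).
apply: eq_tsum3 => y1 y2 y3.
rewrite -(tsum_counitr Q (fun h => F (h * y1) (S y2 * α * y3)) h).
apply: eq_tsum => h1 h2.
by rewrite -(tsum_alpha (fun z => F (h1 * y1) (S y2 * z * y3))); psum.
Qed.
#[global] Arguments qR_comul {U} F h {_}.
End Antipode.

Section AntipodeComul.
Variables (k : fieldType) (H : algType k) (Q : quasi_hopf H).
Local Notation Δ := (comul Q).
Local Notation S := (antipode Q).
Local Notation α := (alpha Q).
Local Notation β := (beta Q).
Variables (U : lmodType k) (F : H -> H -> U) (h : H).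
Hypothesis bF : Bilin F.

Lemma alpha_comul_l : \tsum_(h1, h2 <- Δ h) \tsum_(h11, h12 <- Δ h1)
  F (S h11 * α * h12) h2 = F α h.
Proof.
rewrite -(tsum_counitl Q (F α)); apply: eq_tsum => h1 h2.
exact: (tsum_alpha Q (F^~ h2)).
Qed.

Lemma beta_comul_r : \tsum_(h1, h2 <- Δ h) \tsum_(h21, h22 <- Δ h2)
  F h1 (h21 * β * S h22) = F h β.
Proof.
rewrite -(tsum_counitr Q (F^~ β)); apply: eq_tsum => h1 h2.
exact: (tsum_beta Q (F h1)).
Qed.
End AntipodeComul.
Arguments alpha_comul_l {k H} Q {U} F h {bF}.
Arguments beta_comul_r {k H} Q {U} F h {bF}.

(* Uniqueness of antipodes: [S', gamma, delta] is another antipode along the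
   algebra map [f], and [g] compares it with the image of [S, alpha, beta]. *)
Section Uniqueness.
Variables (k : fieldType) (H : algType k) (Q : quasi_hopf H) (T : algType k).
Local Notation Δ := (comul Q).
Local Notation ε := (counit Q).
Local Notation Φ := (Phi Q).
Local Notation Φi := (Phi_inv Q).
Local Notation S := (antipode Q).
Local Notation α := (alpha Q).
Variables (f : {lrmorphism H -> T}) (S' : H -> T) (gamma delta : T).
Hypotheses (lS' : linear S') (S'1 : S' 1 = 1)
  (S'M : forall a b, S' (a * b) = S' b * S' a)
  (gammaE : forall h, \tsum_(h1, h2 <- Δ h) (S' h1 * gamma * f h2) = ε h *: gamma)
  (deltaE : forall h, \tsum_(h1, h2 <- Δ h) (f h1 * delta * S' h2) = ε h *: delta)
  (PhiE : \tsum3_(X1, X2, X3 <- Φ) (f X1 * delta * S' X2 * gamma * f X3) = 1).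

(** For [f] the coproduct of [H] this is Drinfeld's formula for the inverse twist; see
    [drinfeld_twist_invE]. *)
Definition antipode_cmp : T :=
  \tsum3_(x1, x2, x3 <- Φi) (f (S x1 * α * x2) * delta * S' x3).

#[local] Ltac leaf_simpl ::=
  rewrite ?antipodeM ?antipode1 ?S'M ?S'1 ?rmorphM ?rmorph1 /=.

(** The α inside is expanded by parts of the coproduct of [h], which quasi-associativity carries
    through Φ^{-1}; then [delta] absorbs two of the three parts and the remaining one leaves on the
    left as [f (S h)]. *)
Lemma antipode_cmp_comm h : antipode_cmp * S' h = f (S h) * antipode_cmp.
Proof.
rewrite /antipode_cmp mulr_tsum3l mulr_tsum3r.
transitivity (\tsum3_(x1, x2, x3 <- Φi)
  (f (S x1 * α * x2) * delta * S' (h * x3))).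
  by psum.
via (esym (eq_tsum3 Φi (fun x1 x2 x3 => alpha_comul_l Q (fun a b =>
  f (S x1 * a * x2) * delta * S' (b * x3)) h))).
via (esym (quasi_assoc_inv Q (fun a b c => f (S a * α * b) * delta * S' c) h)).
apply: eq_tsum3 => x1 x2 x3.
have E : f (S (x1 * h) * α * x2) * delta * S' x3
   = f (S h) * (f (S x1 * α * x2) * delta * S' x3) by leaf.
rewrite -{}E -(tsum_counitr Q (fun h => f (S (x1 * h) * α * x2) * delta * S' x3)).
apply: eq_tsum => h1 h2.
rewrite [RHS]scalerAl [X in _ = X * _]scalerAr -deltaE mulr_tsumr mulr_tsuml.
by psum.
Qed.

(** [pentagon_c] replaces the sum over Φ^{-1} by four copies of Φ^{±1}. One is killed by α, one by
    [gamma], one by [delta], and the last gives 1 by [PhiE]. *)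
Lemma antipode_cmp_gamma : antipode_cmp * gamma = f α.
Proof.
rewrite /antipode_cmp mulr_tsum3l.
via (pentagon_c Q (fun a b c d => f (S a * α * b) * delta * S' c * gamma * f d)).
via (alpha_kill1 (fun y y2 y3 => \tsum3_(x1, x2, x3 <- Φi)
  \tsum_(x31, x32 <- Δ x3) \tsum3_(X1, X2, X3 <- Φ)
  \tsum3_(Y1, Y2, Y3 <- Φ) \tsum_(Y21, Y22 <- Δ Y2)
  f (S (x1 * Y1) * y * x2 * X1 * Y21) * delta * S' (y2 * x31 * X2 * Y22) * gamma
   * f (y3 * x32 * X3 * Y3)) (@counital_Phi_inv _ _ Q)).
have gammaF (U : lmodType k) (F : T -> U) h (lF : Lin F) :
    \tsum_(h1, h2 <- Δ h) F (S' h1 * gamma * f h2) = ε h *: F gamma.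
  by rewrite -linZ // -gammaE; symmetry; exact: lin_tsum.
have deltaF (U : lmodType k) (F : T -> U) h (lF : Lin F) :
    \tsum_(h1, h2 <- Δ h) F (f h1 * delta * S' h2) = ε h *: F delta.
  by rewrite -linZ // -deltaE; symmetry; exact: lin_tsum.
via (eq_tsum3 Φi (fun x1 x2 x3 => gammaF _ (fun y =>
  \tsum3_(X1, X2, X3 <- Φ)
  \tsum3_(Y1, Y2, Y3 <- Φ) \tsum_(Y21, Y22 <- Δ Y2)
  (f (S (x1 * Y1) * α * x2 * X1 * Y21) * delta * S' (X2 * Y22) * y
   * f (X3 * Y3))) x3 _)).
have [_ _ ->] := @counital_Phi_inv _ _ Q _ (fun x1 x2 =>
  \tsum3_(X1, X2, X3 <- Φ)
  \tsum3_(Y1, Y2, Y3 <- Φ) \tsum_(Y21, Y22 <- Δ Y2)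
  (f (S (x1 * Y1) * α * x2 * X1 * Y21) * delta * S' (X2 * Y22) * gamma
   * f (X3 * Y3))) _.
via (eq_tsum3 Φ (fun Y1 Y2 Y3 => deltaF _ (fun y =>
  \tsum3_(X1, X2, X3 <- Φ)
  (f (S Y1 * α * X1) * y * S' X2 * gamma * f (X3 * Y3))) Y2 _)).
have [_ -> _] := @counital_Phi _ _ Q _ (fun Y1 Y3 =>
  \tsum3_(X1, X2, X3 <- Φ)
  (f (S Y1 * α * X1) * delta * S' X2 * gamma * f (X3 * Y3))) _.
rewrite -[RHS]mulr1 -PhiE mulr_tsum3r.
by apply: eq_tsum3 => *; rewrite antipode1; leaf.
Qed.
End Uniqueness.

(** * The inverse Drinfeld twist and its product with q_R *)

Section DrinfeldTwist.
Variables (k : fieldType) (H : algType k) (Q : quasi_hopf H).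
Local Notation Δ := (comul Q).
Local Notation ε := (counit Q).
Local Notation Φ := (Phi Q).
Local Notation Φi := (Phi_inv Q).
Local Notation S := (antipode Q).
Local Notation Si := (antipode_inv Q).
Local Notation α := (alpha Q).
Local Notation β := (beta Q).
Let cΦ := @counital_Phi _ _ Q.
Let cΦi := @counital_Phi_inv _ _ Q.
#[local] Ltac leaf_simpl ::= rewrite ?antipodeM ?antipode1.

Definition antipode2 (h : H) : H ⊗ H := \tsum_(h1, h2 <- Δ h) (S h2 ⊗ S h1).

Lemma antipode2_linear : linear antipode2.
Proof. by rewrite /antipode2; lin. Qed.

Lemma antipode2_1 : antipode2 1 = 1.
Proof. by rewrite /antipode2 tsum_comul1 antipode1. Qed.

Lemma antipode2M a b : antipode2 (a * b) = antipode2 b * antipode2 a.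
Proof.
rewrite /antipode2 mulr_tsuml.
transitivity (\tsum_(b1, b2 <- Δ b) \tsum_(a1, a2 <- Δ a)
  ((S b2 ⊗ S b1) * (S a2 ⊗ S a1))).
  by psum.
by apply: eq_tsum => *; rewrite mulr_tsumr.
Qed.

Local Notation gamma := (drinfeld_gamma Q).
Local Notation delta := (drinfeld_delta Q).

(** After [pentagon_ce], α kills one copy of Φ^{-1}. In the form obtained, Φ and Φ^{-1} stand where
    quasi-associativity can move a coproduct through them. *)
Lemma gammaE : gamma =
  \tsum3_(X1, X2, X3 <- Φ) \tsum_(X31, X32 <- Δ X3) \tsum3_(x1, x2, x3 <- Φi)
    ((S (x1 * X2) * α * x2 * X31) ⊗ (S X1 * α * x3 * X32)).
Proof.
pose F (a b c d : H) := (S b * α * c) ⊗ (S a * α * d).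
have qF : Quadrilin F by rewrite /F; lin.
transitivity (tsum4 (pent_c Φ * pent_e Q Φi) F); first by [].
transitivity (\tsum3_(X1, X2, X3 <- Φ) \tsum3_(x1, x2, x3 <- Φi)
  \tsum_(x11, x12 <- Δ x1) F (X1 * x11) (X2 * x12) (X3 * x2) x3).
  by rewrite tsum4M; eval4.
rewrite pentagon_ce /F.
via (alpha_kill2 (fun u1 y u3 => \tsum3_(z1, z2, z3 <- Φi)
    \tsum3_(Y1, Y2, Y3 <- Φ) \tsum_(Y31, Y32 <- Δ Y3)
    ((S (z1 * Y2) * y * z2 * Y31) ⊗ (S (u1 * Y1) * α * u3 * z3 * Y32))) cΦi).
by psum.
Qed.

Lemma deltaE : delta =
  \tsum3_(X1, X2, X3 <- Φ) \tsum_(X11, X12 <- Δ X1) \tsum3_(x1, x2, x3 <- Φi)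
    ((X11 * x1 * β * S X3) ⊗ (X12 * x2 * β * S (X2 * x3))).
Proof.
pose F (a b c d : H) := (a * β * S d) ⊗ (b * β * S c).
have qF : Quadrilin F by rewrite /F; lin.
transitivity (tsum4 (pent_e Q Φ * pent_c Φi) F); first by [].
by rewrite tsum4M; eval4.
Qed.

(** Together with [delta_comul] and [delta_gamma_Phi] this makes γ and δ the α and β of the antipode
    [antipode2] along Δ. Quasi-associativity brings the parts of [h] around the two copies of α,
    which absorb them one after the other. *)
Lemma gamma_comul h :
  \tsum_(h1, h2 <- Δ h) (antipode2 h1 * gamma * Δ h2) = ε h *: gamma.
Proof.
transitivity (\tsum_(h1, h2 <- Δ h)
    (antipode2 h1 * gamma * \tsum_(h21, h22 <- Δ h2) (h21 ⊗ h22))).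
  by apply: eq_tsum => *; rewrite tsumK.
rewrite gammaE /antipode2.
via (quasi_assoc Q (fun a b c => \tsum_(c1, c2 <- Δ c) \tsum3_(x1, x2, x3 <- Φi)
  ((S (x1 * b) * α * x2 * c1) ⊗ (S a * α * x3 * c2))) h).
via (eq_tsum (Δ h) (fun h1 h2 => quasi_assoc_inv Q (fun a b c =>
  \tsum3_(X1, X2, X3 <- Φ) \tsum_(X31, X32 <- Δ X3)
  ((S (a * X2) * α * b * X31) ⊗ (S (h1 * X1) * α * c * X32))) h2)).
via (eq_tsum (Δ h) (fun h1 h2 => alpha_comul_l Q (fun a b =>
  \tsum3_(X1, X2, X3 <- Φ) \tsum_(X31, X32 <- Δ X3) \tsum3_(x1, x2, x3 <- Φi)
  ((S (x1 * X2) * a * x2 * X31) ⊗ (S (h1 * X1) * α * b * x3 * X32))) h2)).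
via (tsum_alpha Q (fun a =>
  \tsum3_(X1, X2, X3 <- Φ) \tsum_(X31, X32 <- Δ X3) \tsum3_(x1, x2, x3 <- Φi)
  ((S (x1 * X2) * α * x2 * X31) ⊗ (S X1 * a * x3 * X32))) h).
by [].
Qed.

Lemma delta_comul h :
  \tsum_(h1, h2 <- Δ h) (Δ h1 * delta * antipode2 h2) = ε h *: delta.
Proof.
transitivity (\tsum_(h1, h2 <- Δ h)
    ((\tsum_(h11, h12 <- Δ h1) (h11 ⊗ h12)) * delta * antipode2 h2)).
  by apply: eq_tsum => *; rewrite tsumK.
rewrite deltaE /antipode2.
via (esym (quasi_assoc Q (fun a b c => \tsum_(a1, a2 <- Δ a) \tsum3_(x1, x2, x3 <- Φi)
  ((a1 * x1 * β * S c) ⊗ (a2 * x2 * β * S (b * x3)))) h)).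
via (esym (eq_tsum (Δ h) (fun h1 h2 => quasi_assoc_inv Q (fun a b c =>
  \tsum3_(X1, X2, X3 <- Φ) \tsum_(X11, X12 <- Δ X1)
  ((X11 * a * β * S (X3 * h2)) ⊗ (X12 * b * β * S (X2 * c)))) h1))).
via (eq_tsum (Δ h) (fun h1 h2 => beta_comul_r Q (fun a b =>
  \tsum3_(X1, X2, X3 <- Φ) \tsum_(X11, X12 <- Δ X1) \tsum3_(x1, x2, x3 <- Φi)
  ((X11 * x1 * a * β * S (X3 * h2)) ⊗ (X12 * x2 * b * S (X2 * x3)))) h1)).
via (tsum_beta Q (fun a =>
  \tsum3_(X1, X2, X3 <- Φ) \tsum_(X11, X12 <- Δ X1) \tsum3_(x1, x2, x3 <- Φi)
  ((X11 * x1 * a * S X3) ⊗ (X12 * x2 * β * S (X2 * x3)))) h).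
by [].
Qed.

(** The pentagon and quasi-associativity bring coproducts around α and β, where they vanish; the
    first leg then closes by an antipode axiom, and what is left is [qp_cancel]. *)
Lemma delta_gamma_Phi :
  \tsum3_(X1, X2, X3 <- Φ) (Δ X1 * delta * antipode2 X2 * gamma * Δ X3) = 1.
Proof.
transitivity (\tsum3_(X1, X2, X3 <- Φ)
   ((\tsum_(X11, X12 <- Δ X1) (X11 ⊗ X12)) * delta * antipode2 X2 * gamma
    * \tsum_(X31, X32 <- Δ X3) (X31 ⊗ X32))).
  by apply: eq_tsum3 => *; rewrite !tsumK.
rewrite gammaE deltaE /antipode2.
via (pentagon Q (fun a b c d => \tsum_(a1, a2 <- Δ a) \tsum_(d1, d2 <- Δ d)
  \tsum3_(y1, y2, y3 <- Φi) \tsum3_(z1, z2, z3 <- Φi)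
  ((a1 * y1 * β * S (z1 * c) * α * z2 * d1)
   ⊗ (a2 * y2 * β * S (b * y3) * α * z3 * d2)))).
via (esym (eq_tsum3 Φ (fun V1 V2 V3 => quasi_assoc_inv Q (fun a b c =>
  \tsum3_(U1, U2, U3 <- Φ) \tsum_(U11, U12 <- Δ U1) \tsum_(U31, U32 <- Δ U3)
  \tsum_(U321, U322 <- Δ U32) \tsum_(V31, V32 <- Δ V3)
  \tsum3_(z1, z2, z3 <- Φi)
  ((U11 * a * β * S (z1 * U31 * V2) * α * z2 * U321 * V31)
   ⊗ (U12 * b * β * S (U2 * c) * α * z3 * U322 * V32))) V1))).
via (eq_tsum3 Φ (fun V1 V2 V3 => beta_comul_r Q (fun a b =>
  \tsum3_(U1, U2, U3 <- Φ) \tsum_(U11, U12 <- Δ U1) \tsum_(U31, U32 <- Δ U3)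
  \tsum_(U321, U322 <- Δ U32) \tsum_(V31, V32 <- Δ V3)
  \tsum3_(y1, y2, y3 <- Φi) \tsum3_(z1, z2, z3 <- Φi)
  ((U11 * y1 * a * β * S (z1 * U31 * V2) * α * z2 * U321 * V31)
   ⊗ (U12 * y2 * b * S (U2 * y3) * α * z3 * U322 * V32))) V1)).
via (eq_tsum3 Φ (fun U1 U2 U3 => quasi_assoc_inv Q (fun a b c =>
  \tsum_(U11, U12 <- Δ U1)
  \tsum3_(V1, V2, V3 <- Φ) \tsum_(V31, V32 <- Δ V3) \tsum3_(y1, y2, y3 <- Φi)
  ((U11 * y1 * V1 * β * S (a * V2) * α * b * V31)
   ⊗ (U12 * y2 * β * S (U2 * y3) * α * c * V32))) U3)).
via (eq_tsum3 Φ (fun U1 U2 U3 => alpha_comul_l Q (fun a b =>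
  \tsum_(U11, U12 <- Δ U1)
  \tsum3_(V1, V2, V3 <- Φ) \tsum_(V31, V32 <- Δ V3)
  \tsum3_(y1, y2, y3 <- Φi) \tsum3_(z1, z2, z3 <- Φi)
  ((U11 * y1 * V1 * β * S (z1 * V2) * a * z2 * V31)
   ⊗ (U12 * y2 * β * S (U2 * y3) * α * b * z3 * V32))) U3)).
via (pentagon_ad Q (fun a b c d =>
  \tsum3_(U1, U2, U3 <- Φ) \tsum_(U11, U12 <- Δ U1) \tsum3_(y1, y2, y3 <- Φi)
  ((U11 * y1 * a * β * S b * α * c)
   ⊗ (U12 * y2 * β * S (U2 * y3) * α * U3 * d)))).
via (alpha_kill2 (fun X1 a X3 =>
  \tsum3_(U1, U2, U3 <- Φ) \tsum_(U11, U12 <- Δ U1) \tsum3_(y1, y2, y3 <- Φi)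
  \tsum3_(Y1, Y2, Y3 <- Φ) \tsum3_(x1, x2, x3 <- Φi) \tsum_(x11, x12 <- Δ x1)
  ((U11 * y1 * X1 * Y1 * x11 * β * S (Y2 * x12) * a * Y3 * x2)
   ⊗ (U12 * y2 * β * S (U2 * y3) * α * U3 * X3 * x3))) cΦ).
via (beta_kill1 (fun a x2 x3 =>
  \tsum3_(U1, U2, U3 <- Φ) \tsum_(U11, U12 <- Δ U1) \tsum3_(y1, y2, y3 <- Φi)
  \tsum3_(Y1, Y2, Y3 <- Φ)
  ((U11 * y1 * Y1 * a * S Y2 * α * Y3 * x2)
   ⊗ (U12 * y2 * β * S (U2 * y3) * α * U3 * x3))) cΦi).
via (antipode_PhiE Q (fun a =>
  \tsum3_(U1, U2, U3 <- Φ) \tsum_(U11, U12 <- Δ U1) \tsum3_(y1, y2, y3 <- Φi)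
  ((U11 * y1 * a) ⊗ (U12 * y2 * β * S (U2 * y3) * α * U3)))).
via (qp_cancel Q (fun a b => a ⊗ b)).
by [].
Qed.

(** The right-hand side is S(q^2) ⊗ S(q^1). Writing it through γ lets the inverse twist, multiplied
    from the left, meet γ and turn it into Δ(α). *)
Lemma gamma_pR :
  \tsum3_(w1, w2, w3 <- Φi) \tsum3_(y1, y2, y3 <- Φi)
    (antipode2 w1 * gamma * Δ w2 * (y1 ⊗ (y2 * β * S (w3 * y3))))
  = \tsum3_(X1, X2, X3 <- Φ) ((S X2 * α * X3) ⊗ S X1).
Proof.
transitivity (\tsum3_(w1, w2, w3 <- Φi) \tsum3_(y1, y2, y3 <- Φi)
    (antipode2 w1 * gamma * (\tsum_(w21, w22 <- Δ w2) (w21 ⊗ w22))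
     * (y1 ⊗ (y2 * β * S (w3 * y3))))).
  by apply: eq_tsum3 => *; apply: eq_tsum3 => *; rewrite !tsumK.
rewrite gammaE /antipode2.
via (pentagon_ce Q (fun a b c d => \tsum3_(x1, x2, x3 <- Φi)
  \tsum_(c1, c2 <- Δ c) \tsum3_(y1, y2, y3 <- Φi)
  ((S (x1 * b) * α * x2 * c1 * y1)
   ⊗ (S a * α * x3 * c2 * y2 * β * S (d * y3))))).
via (eq_tsum3 Φ (fun Y1 Y2 Y3 => pR_comul Q (fun a b =>
  \tsum3_(u1, u2, u3 <- Φi) \tsum_(u21, u22 <- Δ u2) \tsum_(u221, u222 <- Δ u22)
  \tsum3_(z1, z2, z3 <- Φi) \tsum_(z21, z22 <- Δ z2) \tsum3_(x1, x2, x3 <- Φi)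
  ((S (x1 * u21 * z1 * Y2) * α * x2 * u221 * z21 * a)
   ⊗ (S (u1 * Y1) * α * x3 * u222 * z22 * b * S (u3 * z3)))) Y3)).
via (eq_tsum3 Φi (fun u1 u2 u3 => quasi_assoc_inv Q (fun a b c =>
  \tsum3_(Y1, Y2, Y3 <- Φ) \tsum3_(y1, y2, y3 <- Φi)
  \tsum3_(z1, z2, z3 <- Φi) \tsum_(z21, z22 <- Δ z2)
  ((S (a * z1 * Y2) * α * b * z21 * y1 * Y3)
   ⊗ (S (u1 * Y1) * α * c * z22 * y2 * β * S (u3 * z3 * y3)))) u2)).
via (eq_tsum3 Φi (fun u1 u2 u3 => alpha_comul_l Q (fun a b =>
  \tsum3_(Y1, Y2, Y3 <- Φ) \tsum3_(y1, y2, y3 <- Φi) \tsum3_(x1, x2, x3 <- Φi)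
  \tsum3_(z1, z2, z3 <- Φi) \tsum_(z21, z22 <- Δ z2)
  ((S (x1 * z1 * Y2) * a * x2 * z21 * y1 * Y3)
   ⊗ (S (u1 * Y1) * α * b * x3 * z22 * y2 * β * S (u3 * z3 * y3)))) u2)).
via (pentagon_inv Q (fun a b c d =>
  \tsum3_(Y1, Y2, Y3 <- Φ) \tsum3_(u1, u2, u3 <- Φi)
  ((S (a * Y2) * α * b * Y3) ⊗ (S (u1 * Y1) * α * u2 * c * β * S (u3 * d))))).
via (beta_kill3 (fun y1 y2 b =>
  \tsum3_(Y1, Y2, Y3 <- Φ) \tsum3_(u1, u2, u3 <- Φi)
  \tsum3_(x1, x2, x3 <- Φi) \tsum_(x11, x12 <- Δ x1)
  ((S (x11 * y1 * Y2) * α * x12 * y2 * Y3)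
   ⊗ (S (u1 * Y1) * α * u2 * x2 * b * S (u3 * x3)))) cΦi).
via (alpha_kill1 (fun a x2 x3 =>
  \tsum3_(Y1, Y2, Y3 <- Φ) \tsum3_(u1, u2, u3 <- Φi)
  ((S Y2 * a * Y3) ⊗ (S (u1 * Y1) * α * u2 * x2 * β * S (u3 * x3)))) cΦi).
via (antipode_Phi_invE Q (fun a =>
  \tsum3_(Y1, Y2, Y3 <- Φ) ((S Y2 * α * Y3) ⊗ (S Y1 * a)))).
by psum.
Qed.

Lemma drinfeld_twist_invE : drinfeld_twist_inv Q = antipode_cmp Q Δ antipode2 delta.
Proof.
rewrite /drinfeld_twist_inv /antipode_cmp /tsum3.
do 2!apply: eq_tsum => ? ?; rewrite /antipode2.
by rewrite (mulr_tsumr (Δ _)).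
Qed.

Lemma qR_tsum3 : qR Q = \tsum3_(X1, X2, X3 <- Φ) (X1 ⊗ (Si (α * X3) * X2)).
Proof. by []. Qed.

(** Eliminates the twist and q_R from the displayed coaction: the right-hand side involves only
    Φ^{-1}, Δ, S, α and p_R. The inverse twist moves past [antipode2] and then meets γ in
    [gamma_pR]. *)
Lemma twist_inv_qR h :
  drinfeld_twist_inv Q
    * (\tsum_(q1, q2 <- qR Q) \tsum_(h1, h2 <- Δ h) (S (q2 * h2) ⊗ S (q1 * h1)))
  = \tsum3_(w1, w2, w3 <- Φi) \tsum3_(y1, y2, y3 <- Φi)
      (Δ (S (w1 * h) * α * w2) * (y1 ⊗ (y2 * β * S (w3 * y3)))).
Proof.
have -> : \tsum_(q1, q2 <- qR Q) \tsum_(h1, h2 <- Δ h) (S (q2 * h2) ⊗ S (q1 * h1))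
    = antipode2 h * \tsum3_(X1, X2, X3 <- Φ) ((S X2 * α * X3) ⊗ S X1).
  rewrite qR_tsum3 /antipode2.
  transitivity (\tsum3_(X1, X2, X3 <- Φ) \tsum_(h1, h2 <- Δ h)
    ((S h2 * S (Si (α * X3) * X2)) ⊗ (S h1 * S X1))); first by psum.
  transitivity (\tsum3_(X1, X2, X3 <- Φ) \tsum_(h1, h2 <- Δ h)
    ((S h2 * S X2 * α * X3) ⊗ (S h1 * S X1))); last by psum.
  apply: eq_tsum3 => *; apply: eq_tsum => *.
  by rewrite antipodeM antipode_invK !mulrA.
rewrite drinfeld_twist_invE; set cmp := antipode_cmp Q _ _ _.
have comm a : cmp * antipode2 a = Δ (S a) * cmp.
  exact: antipode_cmp_comm antipode2_linear antipode2M delta_comul a.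
have cmp_gamma : cmp * gamma = Δ α.
  exact: (antipode_cmp_gamma antipode2_linear antipode2_1 antipode2M
    gamma_comul delta_comul delta_gamma_Phi).
clearbody cmp; rewrite mulrA comm -gamma_pR mulr_tsum3r.
apply: eq_tsum3 => w1 w2 w3; rewrite mulr_tsum3r; apply: eq_tsum3 => y1 y2 y3.
rewrite !mulrA; congr (_ * _); rewrite -(mulrA _ cmp) comm.
by rewrite -!mulrA (mulrA cmp) cmp_gamma !antipodeM !rmorphM !mulrA.
Qed.
End DrinfeldTwist.

(** * Formal consequences of the relation between v and th *)

Section Covariant.
Variables (k : fieldType) (H : algType k) (Q : quasi_hopf H).
Local Notation Δ := (comul Q).
Local Notation Φ := (Phi Q).
Local Notation Φi := (Phi_inv Q).
Variables (A : lmodType k) (act : H -> A -> A) (L : A -> H ⊗ A).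
Variables (B : algType k) (v : {lrmorphism H -> B}) (th : A -> B).
Hypotheses (bact : is_bilinear act) (act1 : forall m, act 1 m = m)
  (actM : forall g h m, act (g * h) m = act g (act h m)) (lL : linear L)
  (ydL : forall h m,
    \tsum_(h1, h2 <- Δ h) \tsum_(c, n <- L m) ((h1 * c) ⊗ act h2 n)
    = \tsum_(h1, h2 <- Δ h) \tsum_(c, n <- L (act h1 m)) ((c * h2) ⊗ n))
  (lth : linear th)
  (vth : forall h a,
    v h * th a = \tsum_(h1, h2 <- Δ h) (th (act h1 a) * v h2)).

#[local] Ltac leaf_simpl ::= rewrite ?actM ?act1 ?(rmorphM v) ?(rmorph1 v).
#[local] Ltac src_simpl ::= rewrite ?actM ?act1.

Lemma ydLF (U : lmodType k) (F : H -> A -> U) h m : Bilin F ->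
  \tsum_(h1, h2 <- Δ h) \tsum_(c, n <- L m) F (h1 * c) (act h2 n)
  = \tsum_(h1, h2 <- Δ h) \tsum_(c, n <- L (act h1 m)) F (c * h2) n.
Proof.
move=> bF; apply: etrans (etrans (congr1 (fun t => tsum t F) (ydL h m)) _).
  by symmetry; expand.
by expand.
Qed.
#[local] Arguments ydLF {U} F h m {_}.

Lemma vthF (U : lmodType k) (F : B -> U) h a : Lin F ->
  \tsum_(h1, h2 <- Δ h) F (th (act h1 a) * v h2) = F (v h * th a).
Proof. by move=> lF; rewrite vth; symmetry; exact: lin_tsum. Qed.
#[local] Arguments vthF {U} F h a {_}.

(* The coaction of B on th a; the factors t1, t2, t3 are what makes
   [cov_gen_coact] hold, by which th intertwines the coactions up to Φ. *)
Definition cov_gen (a : A) : H ⊗ B :=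
  \tsum3_(t1, t2, t3 <- Φi) \tsum3_(T1, T2, T3 <- Φ)
  \tsum_(c, n <- L (act t1 a))
    ((T1 * c * t2) ⊗ (th (act T2 n) * v (T3 * t3))).
Local Notation G := cov_gen.

Lemma cov_genF (U : lmodType k) (F : H -> B -> U) a : Bilin F ->
  tsum (G a) F
  = \tsum3_(t1, t2, t3 <- Φi) \tsum3_(T1, T2, T3 <- Φ)
    \tsum_(c, n <- L (act t1 a))
      F (T1 * c * t2) (th (act T2 n) * v (T3 * t3)).
Proof. by move=> bF; rewrite /G; expand. Qed.
#[local] Arguments cov_genF {U} F a {_}.

Lemma lin_cov_gen : linear G.
Proof. by rewrite /G; lin. Qed.
Let lG := lin_cov_gen.

Lemma cov_gen_coact (U : lmodType k) (F : H -> B -> U) a : Bilin F ->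
  \tsum3_(T1, T2, T3 <- Φ) \tsum_(c, n <- L a)
    F (T1 * c) (th (act T2 n) * v T3)
  = \tsum3_(X1, X2, X3 <- Φ) \tsum_(g, b <- G (act X1 a)) F (g * X2) (b * v X3).
Proof.
move=> bF; symmetry.
via (eq_tsum3 Φ (fun X1 X2 X3 =>
  cov_genF (fun g b => F (g * X2) (b * v X3)) (act X1 a))).
via (Phi_invK Q (fun x y z => \tsum3_(T1, T2, T3 <- Φ)
  \tsum_(c, n <- L (act x a)) F (T1 * c * y) (th (act T2 n) * v (T3 * z)))).
by psum.
Qed.
#[local] Arguments cov_gen_coact {U} F a {_}.

(** The relation [vth] for G: [h] passes Φ^{-1}, the coaction of [A], Φ and finally [th], each time
    by the matching commutation rule. *)
Lemma cov_gen_act (U : lmodType k) (F : H -> B -> U) h a : Bilin F ->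
  \tsum_(h1, h2 <- Δ h) \tsum_(h21, h22 <- Δ h2) \tsum_(g, b <- G (act h1 a))
    F (g * h21) (b * v h22)
  = \tsum_(h1, h2 <- Δ h) \tsum_(g, b <- G a) F (h1 * g) (v h2 * b).
Proof.
move=> bF.
via (eq_tsum (Δ h) (fun h1 h2 => eq_tsum (Δ h2) (fun h21 h22 =>
  cov_genF (fun g b => F (g * h21) (b * v h22)) (act h1 a)))).
via (quasi_assoc_inv Q (fun x y z => \tsum3_(T1, T2, T3 <- Φ)
  \tsum_(c, n <- L (act x a)) F (T1 * c * y) (th (act T2 n) * v (T3 * z))) h).
via (esym (eq_tsum3 Φi (fun t1 t2 t3 => eq_tsum (Δ h) (fun h1 h2 =>
  ydLF (fun c n => \tsum3_(T1, T2, T3 <- Φ)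
    F (T1 * c * t2) (th (act T2 n) * v (T3 * h2 * t3))) h1 (act t1 a))))).
via (quasi_assoc Q (fun x y z => \tsum3_(t1, t2, t3 <- Φi)
  \tsum_(c, n <- L (act t1 a)) F (x * c * t2) (th (act y n) * v (z * t3))) h).
via (eq_tsum (Δ h) (fun h1 h2 => eq_tsum3 Φi (fun t1 t2 t3 =>
  eq_tsum3 Φ (fun T1 T2 T3 => eq_tsum (L (act t1 a)) (fun c n =>
  vthF (fun b => F (h1 * T1 * c * t2) (b * v (T3 * t3))) h2 (act T2 n)))))).
via (esym (eq_tsum (Δ h) (fun h1 h2 =>
  cov_genF (fun g b => F (h1 * g) (v h2 * b)) a))).
by [].
Qed.

Section Multiplication.
Variables (mul : A -> A -> A).
Hypotheses (bmul : is_bilinear mul)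
  (act_mul : forall h a a',
    act h (mul a a') = \tsum_(h1, h2 <- Δ h) mul (act h1 a) (act h2 a'))
  (th_mul : forall a a', th (mul a a')
    = \tsum3_(X1, X2, X3 <- Φ) (th (act X1 a) * th (act X2 a') * v X3)).

(** The value that the axioms of an algebra in the Yetter-Drinfeld category prescribe for the
    coaction of a product. *)
Definition yd_mul_coact (a a' : A) : H ⊗ A :=
  \tsum3_(X1, X2, X3 <- Φ) \tsum3_(x1, x2, x3 <- Φi) \tsum3_(Y1, Y2, Y3 <- Φ)
  \tsum_(c, n <- L (act (x1 * Y1) a)) \tsum_(d, p <- L (act Y2 a'))
    ((X1 * c * x2 * d * Y3) ⊗ mul (act X2 n) (act (X3 * x3) p)).

Lemma th_act_mul (U : lmodType k) (F : B -> U) h a a' : Lin F ->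
  \tsum_(h1, h2 <- Δ h) \tsum3_(X1, X2, X3 <- Φ)
    F (th (act (X1 * h1) a) * th (act (X2 * h2) a') * v X3)
  = F (th (act h (mul a a'))).
Proof.
move=> lF; rewrite act_mul (lin_tsum _ _ (f := fun m => F (th m))); last lin.
apply: eq_tsum => h1 h2; rewrite th_mul (lin_tsum3 _ _ lF).
by apply: eq_tsum3 => *; rewrite !actM.
Qed.
#[local] Arguments th_act_mul {U} F h a a' {_}.

(** Used in both directions. If the coaction of [A] is multiplicative, it computes G of a product;
    if instead the coaction on [B] is multiplicative, it identifies the coaction of a product in
    B^v. *)
Lemma cov_gen_mul (U : lmodType k) (F : H -> B -> U) a a' : Bilin F ->
  \tsum3_(T1, T2, T3 <- Φ) \tsum_(c, n <- yd_mul_coact a a')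
    F (T1 * c) (th (act T2 n) * v T3)
  = \tsum3_(U1, U2, U3 <- Φ) \tsum_(U31, U32 <- Δ U3)
    \tsum3_(V1, V2, V3 <- Φ) \tsum_(V11, V12 <- Δ V1)
    \tsum_(g, b <- G (act (U1 * V11) a)) \tsum_(g', b' <- G (act (U2 * V12) a'))
    F (g * g' * U31 * V2) (b * b' * v U32 * v V3).
Proof.
move=> bF; rewrite /yd_mul_coact.
via (esym (eq_tsum3 Φ (fun T1 T2 T3 => eq_tsum3 Φ (fun X1 X2 X3 =>
  eq_tsum3 Φi (fun x1 x2 x3 => eq_tsum3 Φ (fun Y1 Y2 Y3 =>
  eq_tsum (L (act (x1 * Y1) a)) (fun c n => eq_tsum (L (act Y2 a')) (fun d p =>
  th_act_mul (fun b => F (T1 * X1 * c * x2 * d * Y3) (b * v T3)) T2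
   (act X2 n) (act (X3 * x3) p))))))))).
via (pentagon Q (fun e f g h =>
  \tsum3_(x1, x2, x3 <- Φi) \tsum3_(Y1, Y2, Y3 <- Φ)
  \tsum_(c, n <- L (act (x1 * Y1) a)) \tsum_(d, p <- L (act Y2 a'))
  F (e * c * x2 * d * Y3) (th (act f n) * th (act (g * x3) p) * v h))).
via (eq_tsum3 Φ (fun V1 V2 V3 => eq_tsum3 Φi (fun x1 x2 x3 =>
  eq_tsum3 Φ (fun Y1 Y2 Y3 => ydLF (fun c n =>
  \tsum3_(U1, U2, U3 <- Φ) \tsum_(U31, U32 <- Δ U3)
  \tsum_(d, p <- L (act Y2 a'))
  F (U1 * c * x2 * d * Y3)
    (th (act U2 n) * th (act (U31 * V2 * x3) p) * v (U32 * V3)))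
  V1 (act (x1 * Y1) a))))).
via (eq_tsum3 Φ (fun V1 V2 V3 => eq_tsum (Δ V1) (fun V11 V12 =>
  eq_tsum3 Φi (fun x1 x2 x3 => eq_tsum3 Φ (fun Y1 Y2 Y3 =>
  eq_tsum (L (act V11 (act (x1 * Y1) a))) (fun c n =>
  eq_tsum3 Φ (fun U1 U2 U3 => eq_tsum (L (act Y2 a')) (fun d p =>
  vthF (fun b => F (U1 * c * V12 * x2 * d * Y3) (th (act U2 n) * b * v V3))
   U3 (act (V2 * x3) p))))))))).
via (pentagon_ec Q (fun e f g h =>
  \tsum3_(U1, U2, U3 <- Φ) \tsum3_(Y1, Y2, Y3 <- Φ)
  \tsum_(c, n <- L (act (e * Y1) a)) \tsum_(d, p <- L (act Y2 a'))
  F (U1 * c * f * d * Y3) (th (act U2 n) * v U3 * th (act g p) * v h))).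
via (eq_tsum3 Φi (fun x1 x2 x3 => eq_tsum3 Φ (fun Z1 Z2 Z3 =>
  eq_tsum3 Φ (fun X1 X2 X3 => eq_tsum (Δ X2) (fun X21 X22 =>
  eq_tsum3 Φ (fun U1 U2 U3 => eq_tsum3 Φ (fun Y1 Y2 Y3 =>
  eq_tsum (L (act (x1 * X1 * Y1) a)) (fun c n => eq_tsum (L (act Y2 a')) (fun d p =>
  vthF (fun b => F (U1 * c * x2 * Z1 * X21 * d * Y3)
    (th (act U2 n) * v U3 * b * v (Z3 * X3))) x3 (act (Z2 * X22) p)))))))))).
via (eq_tsum3 Φi (fun x1 x2 x3 => eq_tsum3 Φ (fun X1 X2 X3 =>
  eq_tsum3 Φ (fun Y1 Y2 Y3 => ydLF (fun d p =>
  \tsum3_(Z1, Z2, Z3 <- Φ) \tsum3_(U1, U2, U3 <- Φ)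
  \tsum_(c, n <- L (act (x1 * X1 * Y1) a))
  F (U1 * c * x2 * Z1 * d * Y3)
    (th (act U2 n) * v (U3 * x3) * th (act Z2 p) * v (Z3 * X3)))
  X2 (act Y2 a'))))).
via (eq_tsum3 Φ (fun X1 X2 X3 => eq_tsum3 Φ (fun Y1 Y2 Y3 =>
  eq_tsum (Δ X2) (fun X21 X22 => cov_gen_coact (fun g b =>
  \tsum3_(x1, x2, x3 <- Φi) \tsum3_(U1, U2, U3 <- Φ)
  \tsum_(c, n <- L (act x1 (act (X1 * Y1) a)))
  F (U1 * c * x2 * g * X22 * Y3)
    (th (act U2 n) * v (U3 * x3) * b * v X3)) (act (X21 * Y2) a'))))).
via (esym (eq_tsum3 Φ (fun X1 X2 X3 => eq_tsum3 Φ (fun Y1 Y2 Y3 =>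
  eq_tsum (Δ X2) (fun X21 X22 => eq_tsum3 Φ (fun W1 W2 W3 =>
  cov_genF (fun g b => \tsum_(g', b' <- G (act (W1 * X21 * Y2) a'))
  F (g * g' * W2 * X22 * Y3) (b * b' * v W3 * v X3)) (act (X1 * Y1) a))))))).
via (pentagon Q (fun e f g h =>
  \tsum_(c, b <- G (act e a)) \tsum_(c', b' <- G (act f a'))
  F (c * c' * g) (b * b' * v h))).
by psum.
Qed.

(** The prescribed value obeys the Yetter-Drinfeld compatibility by itself, so it can be tested
    against all [h]. Each coaction is passed by [ydLF], each Φ by quasi-associativity. *)
Lemma yd_mul_coact_act (U : lmodType k) (F : H -> A -> U) h a a' : Bilin F ->
  \tsum_(h1, h2 <- Δ h) \tsum_(c, n <- yd_mul_coact a a') F (h1 * c) (act h2 n)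
  = \tsum_(h1, h2 <- Δ h) \tsum_(h11, h12 <- Δ h1)
    \tsum_(c, n <- yd_mul_coact (act h11 a) (act h12 a')) F (c * h2) n.
Proof.
move=> bF; rewrite /yd_mul_coact.
have act_mulF (W : lmodType k) (f : A -> W) g m m' : Lin f ->
    \tsum_(h1, h2 <- Δ g) f (mul (act h1 m) (act h2 m')) = f (act g (mul m m')).
  by move=> lf; rewrite act_mul (lin_tsum _ _ lf).
via (esym (eq_tsum (Δ h) (fun h1 h2 => eq_tsum3 Φ (fun X1 X2 X3 =>
  eq_tsum3 Φi (fun x1 x2 x3 => eq_tsum3 Φ (fun Y1 Y2 Y3 =>
  eq_tsum (L (act (x1 * Y1) a)) (fun c n => eq_tsum (L (act Y2 a')) (fun d p =>
  act_mulF _ (F (h1 * (X1 * c * x2 * d * Y3))) h2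
   (act X2 n) (act (X3 * x3) p) _)))))))).
via (esym (quasi_assoc Q (fun e f g =>
  \tsum3_(x1, x2, x3 <- Φi) \tsum3_(Y1, Y2, Y3 <- Φ)
  \tsum_(c, n <- L (act (x1 * Y1) a)) \tsum_(d, p <- L (act Y2 a'))
  F (e * c * x2 * d * Y3) (mul (act f n) (act (g * x3) p))) h)).
via (eq_tsum (Δ h) (fun h1 h2 => eq_tsum3 Φi (fun x1 x2 x3 =>
  eq_tsum3 Φ (fun Y1 Y2 Y3 => ydLF (fun c n => \tsum3_(X1, X2, X3 <- Φ)
  \tsum_(d, p <- L (act Y2 a'))
  F (X1 * c * x2 * d * Y3) (mul (act X2 n) (act (X3 * h2 * x3) p)))
  h1 (act (x1 * Y1) a))))).
via (esym (quasi_assoc_inv Q (fun e f g =>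
  \tsum3_(X1, X2, X3 <- Φ) \tsum3_(Y1, Y2, Y3 <- Φ)
  \tsum_(c, n <- L (act (e * Y1) a)) \tsum_(d, p <- L (act Y2 a'))
  F (X1 * c * f * d * Y3) (mul (act X2 n) (act (X3 * g) p))) h)).
via (eq_tsum (Δ h) (fun h1 h2 => eq_tsum3 Φi (fun x1 x2 x3 =>
  eq_tsum3 Φ (fun Y1 Y2 Y3 => ydLF (fun d p => \tsum3_(X1, X2, X3 <- Φ)
  \tsum_(c, n <- L (act (x1 * h1 * Y1) a))
  F (X1 * c * x2 * d * Y3) (mul (act X2 n) (act (X3 * x3) p)))
  h2 (act Y2 a'))))).
via (esym (quasi_assoc Q (fun e f g =>
  \tsum3_(X1, X2, X3 <- Φ) \tsum3_(x1, x2, x3 <- Φi)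
  \tsum_(c, n <- L (act (x1 * e) a)) \tsum_(d, p <- L (act f a'))
  F (X1 * c * x2 * d * g) (mul (act X2 n) (act (X3 * x3) p))) h)).
by psum.
Qed.
End Multiplication.

Section CoactionCoact.

(** This lemma and the next give the compatibility with [h], along Δ in the first two legs, for the
    two sides of coassociativity; again the condition for testing them against all [h]. *)
Lemma yd_coassoc_l_act (U : lmodType k) (F : H -> H -> A -> U) h a : Trilin F ->
  \tsum_(h1, h2 <- Δ h) \tsum_(h11, h12 <- Δ h1) \tsum3_(Y1, Y2, Y3 <- Φ)
  \tsum_(c, n <- L (act Y1 a)) \tsum_(c1, c2 <- Δ c)
    F (h11 * c1 * Y2) (h12 * c2 * Y3) (act h2 n)
  = \tsum_(h1, h2 <- Δ h) \tsum_(h11, h12 <- Δ h1) \tsum3_(Y1, Y2, Y3 <- Φ)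
    \tsum_(c, n <- L (act Y1 (act h11 a))) \tsum_(c1, c2 <- Δ c)
    F (c1 * Y2 * h12) (c2 * Y3 * h2) n.
Proof.
move=> tF.
via (eq_tsum3 Φ (fun Y1 Y2 Y3 => ydLF (fun c n => \tsum_(c1, c2 <- Δ c)
  F (c1 * Y2) (c2 * Y3) n) h (act Y1 a))).
via (esym (quasi_assoc Q (fun e f g => \tsum_(c, n <- L (act e a))
  \tsum_(c1, c2 <- Δ c) F (c1 * f) (c2 * g) n) h)).
by psum.
Qed.

Lemma yd_coassoc_r_act (U : lmodType k) (F : H -> H -> A -> U) h a : Trilin F ->
  \tsum_(h1, h2 <- Δ h) \tsum_(h11, h12 <- Δ h1)
  \tsum3_(x1, x2, x3 <- Φi) \tsum3_(X1, X2, X3 <- Φ)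
  \tsum_(c, m <- L a) \tsum_(d, n <- L (act X2 m))
    F (h11 * x1 * X1 * c) (h12 * x2 * d * X3) (act (h2 * x3) n)
  = \tsum_(h1, h2 <- Δ h) \tsum_(h11, h12 <- Δ h1)
    \tsum3_(x1, x2, x3 <- Φi) \tsum3_(X1, X2, X3 <- Φ)
    \tsum_(c, m <- L (act h11 a)) \tsum_(d, n <- L (act X2 m))
    F (x1 * X1 * c * h12) (x2 * d * X3 * h2) (act x3 n).
Proof.
move=> tF.
via (esym (quasi_assoc_inv Q (fun e f g => \tsum3_(X1, X2, X3 <- Φ)
  \tsum_(c, m <- L a) \tsum_(d, n <- L (act X2 m))
    F (e * X1 * c) (f * d * X3) (act g n)) h)).
via (eq_tsum (Δ h) (fun h1 h2 => eq_tsum3 Φ (fun X1 X2 X3 =>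
  eq_tsum (L a) (fun c m => ydLF (fun d n => \tsum3_(x1, x2, x3 <- Φi)
  F (x1 * h1 * X1 * c) (x2 * d * X3) (act x3 n)) h2 (act X2 m))))).
via (esym (quasi_assoc Q (fun e f g => \tsum3_(x1, x2, x3 <- Φi)
  \tsum_(c, m <- L a) \tsum_(d, n <- L (act f m))
    F (x1 * e * c) (x2 * d * g) (act x3 n)) h)).
via (eq_tsum (Δ h) (fun h1 h2 => ydLF (fun c m =>
  \tsum3_(x1, x2, x3 <- Φi) \tsum3_(X1, X2, X3 <- Φ)
  \tsum_(d, n <- L (act X2 m))
  F (x1 * X1 * c) (x2 * d * X3 * h2) (act x3 n)) h1 a)).
by psum.
Qed.
End CoactionCoact.

Section Coassociativity.
Variable lam : B -> H ⊗ B.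
Hypotheses (llam : linear lam) (lam_th : forall a, lam (th a) = G a)
  (lamM : forall b h,
    lam (b * v h) = lam b * \tsum_(h1, h2 <- Δ h) (h1 ⊗ v h2)).

Lemma lamMF (U : lmodType k) (F : H -> B -> U) b h : Bilin F ->
  \tsum_(g, c <- lam (b * v h)) F g c
  = \tsum_(g, c <- lam b) \tsum_(h1, h2 <- Δ h) F (g * h1) (c * v h2).
Proof.
move=> bF; rewrite lamM tsumM; apply: eq_tsum => g c; by expand.
Qed.
#[local] Arguments lamMF {U} F b h {_}.

Lemma cov_gen_coassoc_l (U : lmodType k) (F : H -> H -> B -> U) a : Trilin F ->
  \tsum3_(T1, T2, T3 <- Φ) \tsum_(T11, T12 <- Δ T1) \tsum3_(Y1, Y2, Y3 <- Φ)
  \tsum_(c, n <- L (act Y1 a)) \tsum_(c1, c2 <- Δ c)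
    F (T11 * c1 * Y2) (T12 * c2 * Y3) (th (act T2 n) * v T3)
  = \tsum3_(X1, X2, X3 <- Φ) \tsum_(X21, X22 <- Δ X2) \tsum3_(Y1, Y2, Y3 <- Φ)
    \tsum_(g, b <- G (act (X1 * Y1) a)) \tsum_(g1, g2 <- Δ g)
    F (g1 * X21 * Y2) (g2 * X22 * Y3) (b * v X3).
Proof.
move=> tF.
via (eq_tsum3 Φ (fun Y1 Y2 Y3 => cov_gen_coact (fun g b =>
  \tsum_(g1, g2 <- Δ g) F (g1 * Y2) (g2 * Y3) b) (act Y1 a))).
by psum.
Qed.

(** The inner coaction is first completed to G(m) for a suitable m; as this equals [lam (th m)], the
    outer coaction can then be completed to G under [lam]. *)
Lemma cov_gen_coassoc_r (U : lmodType k) (F : H -> H -> B -> U) a : Trilin F ->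
  \tsum3_(T1, T2, T3 <- Φ) \tsum_(T11, T12 <- Δ T1) \tsum3_(x1, x2, x3 <- Φi)
  \tsum3_(X1, X2, X3 <- Φ) \tsum_(c, m <- L a) \tsum_(d, n <- L (act X2 m))
    F (T11 * x1 * X1 * c) (T12 * x2 * d * X3) (th (act (T2 * x3) n) * v T3)
  = \tsum3_(X1, X2, X3 <- Φ) \tsum_(X21, X22 <- Δ X2) \tsum3_(Y1, Y2, Y3 <- Φ)
    \tsum3_(x1, x2, x3 <- Φi) \tsum3_(Z1, Z2, Z3 <- Φ)
    \tsum_(g, b <- G (act (X1 * Y1) a)) \tsum_(g', b' <- lam b)
    F (x1 * g * Z1 * X21 * Y2) (x2 * g' * Z2 * X22 * Y3)
      (v x3 * b' * v (Z3 * X3)).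
Proof.
move=> tF.
via (pentagon_ec Q (fun e f g h =>
  \tsum3_(X1, X2, X3 <- Φ) \tsum_(c, m <- L a) \tsum_(d, n <- L (act X2 m))
    F (e * X1 * c) (f * d * X3) (th (act g n) * v h))).
via (eq_tsum3 Φi (fun x1 x2 x3 => eq_tsum3 Φ (fun Z1 Z2 Z3 =>
  eq_tsum3 Φ (fun W1 W2 W3 => eq_tsum (Δ W2) (fun W21 W22 =>
  eq_tsum3 Φ (fun X1 X2 X3 => eq_tsum (L a) (fun c m =>
  eq_tsum (L (act X2 m)) (fun d n =>
  vthF (fun b => F (x1 * W1 * X1 * c) (x2 * Z1 * W21 * d * X3)
    (b * v (Z3 * W3))) x3 (act (Z2 * W22) n))))))))).
via (eq_tsum3 Φ (fun W1 W2 W3 => eq_tsum3 Φ (fun X1 X2 X3 =>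
  eq_tsum (L a) (fun c m => ydLF (fun d n =>
  \tsum3_(x1, x2, x3 <- Φi) \tsum3_(Z1, Z2, Z3 <- Φ)
  F (x1 * W1 * X1 * c) (x2 * Z1 * d * X3)
    (v x3 * th (act Z2 n) * v (Z3 * W3))) W2 (act X2 m))))).
via (eq_tsum3 Φ (fun W1 W2 W3 => eq_tsum3 Φ (fun X1 X2 X3 =>
  eq_tsum (L a) (fun c m => eq_tsum (Δ W2) (fun W21 W22 =>
  cov_gen_coact (fun g b => \tsum3_(x1, x2, x3 <- Φi)
  F (x1 * W1 * X1 * c) (x2 * g * W22 * X3)
    (v x3 * b * v W3)) (act (W21 * X2) m)))))).
via (pentagon Q (fun e f g h => \tsum3_(x1, x2, x3 <- Φi)
  \tsum_(c, m <- L a) \tsum_(d, b <- G (act f m))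
  F (x1 * e * c) (x2 * d * g) (v x3 * b * v h))).
via (eq_tsum3 Φ (fun V1 V2 V3 => ydLF (fun c m =>
  \tsum3_(x1, x2, x3 <- Φi) \tsum3_(U1, U2, U3 <- Φ) \tsum_(U31, U32 <- Δ U3)
  \tsum_(g, b <- G (act U2 m))
  F (x1 * U1 * c) (x2 * g * U31 * V2) (v x3 * b * v (U32 * V3))) V1 a)).
transitivity (\tsum3_(V1, V2, V3 <- Φ) \tsum_(V11, V12 <- Δ V1)
  \tsum_(c, m <- L (act V11 a)) \tsum3_(x1, x2, x3 <- Φi)
  \tsum3_(U1, U2, U3 <- Φ) \tsum_(U31, U32 <- Δ U3)
  \tsum_(g, b <- lam (th (act U2 m)))
  F (x1 * U1 * c * V12) (x2 * g * U31 * V2) (v x3 * b * v (U32 * V3))).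
  do 2 (apply: eq_tsum3 => ? ? ? || apply: eq_tsum => ? ?).
  apply: eq_tsum => ? ?; apply: eq_tsum3 => ? ? ?; apply: eq_tsum3 => ? ? ?.
  by apply: eq_tsum => ? ?; rewrite lam_th; psum.
via (esym (eq_tsum3 Φ (fun V1 V2 V3 => eq_tsum (Δ V1) (fun V11 V12 =>
  eq_tsum (L (act V11 a)) (fun c m => eq_tsum3 Φi (fun x1 x2 x3 =>
  eq_tsum3 Φ (fun U1 U2 U3 => lamMF (fun g b =>
  F (x1 * U1 * c * V12) (x2 * g * V2) (v x3 * b * v V3))
    (th (act U2 m)) U3))))))).
via (eq_tsum3 Φ (fun V1 V2 V3 => eq_tsum (Δ V1) (fun V11 V12 =>
  cov_gen_coact (fun c b => \tsum3_(x1, x2, x3 <- Φi) \tsum_(g, b' <- lam b)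
  F (x1 * c * V12) (x2 * g * V2) (v x3 * b' * v V3)) (act V11 a)))).
via (eq_tsum3 Φ (fun V1 V2 V3 => eq_tsum (Δ V1) (fun V11 V12 =>
  eq_tsum3 Φi (fun x1 x2 x3 => eq_tsum3 Φ (fun X1 X2 X3 =>
  eq_tsum (G (act (X1 * V11) a)) (fun c b => lamMF (fun g b' =>
  F (x1 * c * X2 * V12) (x2 * g * V2) (v x3 * b' * v V3)) b X3)))))).
via (esym (pentagon Q (fun e f g h => \tsum3_(x1, x2, x3 <- Φi)
  \tsum_(c, b <- G (act e a)) \tsum_(d, b' <- lam b)
  F (x1 * c * f) (x2 * d * g) (v x3 * b' * v h)))).
by psum.
Qed.
End Coassociativity.
End Covariant.

(** * The module algebra B^v, studied through theta *)

Section Twisted.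
Variables (k : fieldType) (H : algType k) (Q : quasi_hopf H).
Local Notation Δ := (comul Q).
Local Notation ε := (counit Q).
Local Notation Φ := (Phi Q).
Local Notation Φi := (Phi_inv Q).
Local Notation S := (antipode Q).
Local Notation α := (alpha Q).
Local Notation β := (beta Q).
Let cΦ := @counital_Phi _ _ Q.
Let cΦi := @counital_Phi_inv _ _ Q.
Variables (B : algType k) (v : {lrmorphism H -> B}).

#[local] Ltac leaf_simpl ::=
  rewrite ?antipodeM ?antipode1 ?(rmorphM v) ?(rmorph1 v).
#[local] Ltac src_simpl ::= rewrite ?(rmorphM v) ?(rmorph1 v) ?mulrA.

Definition ad (h : H) (b : B) : B := \tsum_(h1, h2 <- Δ h) (v h1 * b * v (S h2)).
Definition star (b b' : B) : B :=
  \tsum3_(X1, X2, X3 <- Φ) \tsum3_(x1, x2, x3 <- Φi) \tsum_(X31, X32 <- Δ X3)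
    (v X1 * b * v (S (x1 * X2) * α * x2 * X31) * b' * v (S (x3 * X32))).
(* The operator by which an element of B^v acts on the regular B-module in the
   tensor category of H-modules. *)
Definition theta (b : B) : B :=
  \tsum3_(X1, X2, X3 <- Φ) (v X1 * b * v (S X2 * α * X3)).

Lemma bilin_ad : is_bilinear ad. Proof. by rewrite /ad; lin. Qed.
Lemma bilin_star : is_bilinear star. Proof. by rewrite /star; lin. Qed.
Lemma lin_theta : linear theta. Proof. by rewrite /theta; lin. Qed.
Let bad := bilin_ad.
Let bstar := bilin_star.
Let lth := lin_theta.

Lemma ad1 b : ad 1 b = b.
Proof. by rewrite /ad tsum_comul1 antipode1 rmorph1 mul1r mulr1. Qed.

Lemma adM g h b : ad (g * h) b = ad g (ad h b).
Proof. by rewrite /ad; psum. Qed.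

Lemma ad_beta h : ad h (v β) = ε h *: v β.
Proof.
rewrite -(tsum_beta Q v).
by apply: eq_tsum => *; rewrite !rmorphM.
Qed.

Lemma theta_beta : theta (v β) = 1.
Proof.
transitivity (v 1); last exact: rmorph1.
by rewrite -(antipode_PhiE Q v) /theta; psum.
Qed.

(** This is [qR_comul] with [b] placed between the two legs. *)
Lemma v_theta h b :
  v h * theta b = \tsum_(h1, h2 <- Δ h) (theta (ad h1 b) * v h2).
Proof.
rewrite /theta /ad; symmetry.
have adE h1 : \tsum3_(X1, X2, X3 <- Φ)
    (v X1 * (\tsum_(h11, h12 <- Δ h1) (v h11 * b * v (S h12))) * v (S X2 * α * X3))
  = \tsum3_(X1, X2, X3 <- Φ) \tsum_(h11, h12 <- Δ h1)
    (v X1 * v h11 * b * v (S (X2 * h12) * α * X3)) by psum.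
transitivity (\tsum_(h1, h2 <- Δ h) ((\tsum3_(X1, X2, X3 <- Φ)
   \tsum_(h11, h12 <- Δ h1) (v X1 * v h11 * b * v (S (X2 * h12) * α * X3))) * v h2)).
  by apply: eq_tsum => *; rewrite adE.
via (qR_comul Q (fun e f => v e * b * v f) h).
by psum.
Qed.

Lemma ad_star h b b' :
  ad h (star b b') = \tsum_(h1, h2 <- Δ h) star (ad h1 b) (ad h2 b').
Proof.
symmetry; rewrite /star /ad.
via (quasi_assoc Q (fun e f g => \tsum3_(x1, x2, x3 <- Φi) \tsum_(g1, g2 <- Δ g)
  (v e * b * v (S (x1 * f) * α * x2 * g1) * b' * v (S (x3 * g2)))) h).
via (eq_tsum (Δ h) (fun h1 h2 => quasi_assoc_inv Q (fun e f g =>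
  \tsum3_(X1, X2, X3 <- Φ) \tsum_(X31, X32 <- Δ X3)
  (v (h1 * X1) * b * v (S (e * X2) * α * f * X31) * b' * v (S (g * X32)))) h2)).
via (eq_tsum (Δ h) (fun h1 h2 => alpha_comul_l Q (fun e f =>
  \tsum3_(X1, X2, X3 <- Φ) \tsum_(X31, X32 <- Δ X3) \tsum3_(x1, x2, x3 <- Φi)
  (v (h1 * X1) * b * v (S (x1 * X2) * e * x2 * X31) * b' * v (S (f * x3 * X32))))
   h2)).
by psum.
Qed.

Lemma v_thetaF (U : lmodType k) (F : B -> U) h b : Lin F ->
  \tsum_(h1, h2 <- Δ h) F (theta (ad h1 b) * v h2) = F (v h * theta b).
Proof. by move=> lF; rewrite v_theta; symmetry; exact: lin_tsum. Qed.
#[local] Arguments v_thetaF {U} F h b {_}.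

(** The product of two values of [theta] carries one α between [b] and [b'] and one after [b']. The
    pentagon arranges the copies of Φ so that each α kills one of them; the remaining Φ^{-1} is the
    one in the definition of [star]. *)
Lemma theta_star b b' : theta (star b b')
  = \tsum3_(X1, X2, X3 <- Φ) (theta (ad X1 b) * theta (ad X2 b') * v X3).
Proof.
symmetry.
transitivity (\tsum3_(X1, X2, X3 <- Φ) \tsum3_(Y1, Y2, Y3 <- Φ)
  \tsum_(X11, X12 <- Δ X1)
  (v (Y1 * X11) * b * v (S (Y2 * X12) * α) * (v Y3 * theta (ad X2 b')) * v X3)).
  by apply: eq_tsum3 => *; rewrite {1}/theta /ad; psum.
via (esym (eq_tsum3 Φ (fun X1 X2 X3 => eq_tsum3 Φ (fun Y1 Y2 Y3 =>
  eq_tsum (Δ X1) (fun X11 X12 => v_thetaF (fun c =>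
  v (Y1 * X11) * b * v (S (Y2 * X12) * α) * c * v X3) Y3 (ad X2 b')))))).
transitivity (\tsum3_(X1, X2, X3 <- Φ) \tsum3_(Y1, Y2, Y3 <- Φ)
  \tsum_(Y31, Y32 <- Δ Y3) \tsum_(X11, X12 <- Δ X1)
  (v (Y1 * X11) * b * v (S (Y2 * X12) * α) * theta (ad (Y31 * X2) b')
   * v (Y32 * X3))).
  do 2!apply: eq_tsum3 => ? ? ?; rewrite tsum_exchange.
  by do 2!apply: eq_tsum => ? ?; rewrite adM; leaf.
via (esym (pentagon Q (fun e f g h =>
  v e * b * v (S f * α) * theta (ad g b') * v h))).
transitivity (\tsum3_(X1, X2, X3 <- Φ) \tsum_(X21, X22 <- Δ X2)
  \tsum_(X221, X222 <- Δ X22) \tsum3_(Y1, Y2, Y3 <- Φ) \tsum_(Y31, Y32 <- Δ Y3)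
  \tsum3_(Z1, Z2, Z3 <- Φ) \tsum3_(W1, W2, W3 <- Φ) \tsum_(Z21, Z22 <- Δ Z2)
  (v (X1 * Y1) * b * v (S (Z1 * X21 * Y2) * α * (W1 * Z21) * X221 * Y31) * b'
   * v (S (W2 * Z22 * X222 * Y32) * α * (W3 * Z3) * X3))).
  by rewrite /theta /ad; psum.
via (eq_tsum3 Φ (fun X1 X2 X3 => eq_tsum (Δ X2) (fun X21 X22 =>
  eq_tsum (Δ X22) (fun X221 X222 => eq_tsum3 Φ (fun Y1 Y2 Y3 =>
  eq_tsum (Δ Y3) (fun Y31 Y32 => pentagon_ab Q (fun e f g h =>
  v (X1 * Y1) * b * v (S (e * X21 * Y2) * α * f * X221 * Y31) * b'
   * v (S (g * X222 * Y32) * α * h * X3)))))))).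
via (alpha_kill3 (fun u1 u2 a =>
  \tsum3_(X1, X2, X3 <- Φ) \tsum_(X21, X22 <- Δ X2)
  \tsum_(X221, X222 <- Δ X22) \tsum3_(Y1, Y2, Y3 <- Φ) \tsum_(Y31, Y32 <- Δ Y3)
  \tsum3_(V1, V2, V3 <- Φ) \tsum_(V11, V12 <- Δ V1) \tsum3_(y1, y2, y3 <- Φi)
  (v (X1 * Y1) * b
   * v (S (u1 * V11 * y1 * X21 * Y2) * α * u2 * V12 * y2 * X221 * Y31) * b'
   * v (S (V2 * y3 * X222 * Y32) * a * V3 * X3))) cΦ).
via (alpha_kill1 (fun a V2 V3 =>
  \tsum3_(X1, X2, X3 <- Φ) \tsum_(X21, X22 <- Δ X2)
  \tsum_(X221, X222 <- Δ X22) \tsum3_(Y1, Y2, Y3 <- Φ) \tsum_(Y31, Y32 <- Δ Y3)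
  \tsum3_(y1, y2, y3 <- Φi)
  (v (X1 * Y1) * b * v (S (y1 * X21 * Y2) * a * y2 * X221 * Y31) * b'
   * v (S (V2 * y3 * X222 * Y32) * α * V3 * X3))) cΦ).
via (eq_tsum3 Φ (fun X1 X2 X3 => quasi_assoc_inv Q (fun e f g =>
  \tsum3_(Y1, Y2, Y3 <- Φ) \tsum_(Y31, Y32 <- Δ Y3)
  (v (X1 * Y1) * b * v (S (e * Y2) * α * f * Y31) * b'
   * v (S (g * Y32) * α * X3))) X2)).
via (eq_tsum3 Φ (fun X1 X2 X3 => alpha_comul_l Q (fun e f =>
  \tsum3_(Y1, Y2, Y3 <- Φ) \tsum_(Y31, Y32 <- Δ Y3) \tsum3_(y1, y2, y3 <- Φi)
  (v (X1 * Y1) * b * v (S (y1 * Y2) * e * y2 * Y31) * b'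
   * v (S (f * y3 * Y32) * α * X3))) X2)).
by rewrite /theta /star; psum.
Qed.

(** Unfolded, the two legs of [pq_cancel] stand on the two sides of [b]. *)
Lemma theta_recover b :
  \tsum3_(x1, x2, x3 <- Φi) (theta (ad x1 b) * v (x2 * β * S x3)) = b.
Proof.
rewrite /theta /ad.
via (pq_cancel Q (fun e f => v e * b * v f)).
by rewrite rmorph1 mul1r mulr1.
Qed.

Lemma theta_ad h b : theta (ad h b)
  = \tsum3_(Z1, Z2, Z3 <- Φ) \tsum_(h1, h2 <- Δ h)
    (v (Z1 * h1) * b * v (S (Z2 * h2) * α * Z3)).
Proof. by rewrite /theta /ad; psum. Qed.

(** The device by which identities in B^v are proved: after [theta (ad h _)] the twisted product
    becomes that of [B]. *)
Lemma theta_inj b c : (forall h, theta (ad h b) = theta (ad h c)) -> b = c.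
Proof.
move=> bc; rewrite -[b]theta_recover -[c]theta_recover.
by apply: eq_tsum3 => *; rewrite bc.
Qed.

Lemma theta_ad_starF (U : lmodType k) (F : B -> U) h b c : Lin F ->
  \tsum_(h1, h2 <- Δ h) \tsum3_(X1, X2, X3 <- Φ)
    F (theta (ad (X1 * h1) b) * theta (ad (X2 * h2) c) * v X3)
  = F (theta (ad h (star b c))).
Proof. by move=> lF; apply: (th_act_mul adM lth ad_star theta_star). Qed.
#[local] Arguments theta_ad_starF {U} F h b c {_}.

Lemma star_beta_l b : star (v β) b = b.
Proof.
apply: theta_inj => h; rewrite ad_star.
transitivity (theta (star (v β) (ad h b))).
  rewrite -(tsum_counitl Q (fun h => theta (star (v β) (ad h b)))).
  rewrite (lin_tsum _ _ lth); apply: eq_tsum => h1 h2; rewrite ad_beta.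
  by rewrite -(linZ (f := fun c => theta (star c (ad h2 b)))); last lin.
rewrite theta_star.
have [cX _ _] := @cΦ _ (fun X2 X3 => theta (ad (X2 * h) b) * v X3) _.
transitivity (\tsum3_(X1, X2, X3 <- Φ) (ε X1 *: (theta (ad (X2 * h) b) * v X3))).
  apply: eq_tsum3 => *; rewrite ad_beta (linZ _ _ lth) theta_beta -adM.
  by rewrite scalerAl -!scalerAl mul1r.
by rewrite cX rmorph1 mulr1 mul1r.
Qed.

Lemma star_beta_r b : star b (v β) = b.
Proof.
apply: theta_inj => h; rewrite ad_star.
transitivity (theta (star (ad h b) (v β))).
  rewrite -(tsum_counitr Q (fun h => theta (star (ad h b) (v β)))).
  rewrite (lin_tsum _ _ lth); apply: eq_tsum => h1 h2; rewrite ad_beta.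
  by rewrite -(linZ (f := fun c => theta (star (ad h1 b) c))); last lin.
rewrite theta_star.
have [_ cX _] := @cΦ _ (fun X1 X3 => theta (ad (X1 * h) b) * v X3) _.
transitivity (\tsum3_(X1, X2, X3 <- Φ) (ε X2 *: (theta (ad (X1 * h) b) * v X3))).
  apply: eq_tsum3 => *; rewrite ad_beta (linZ _ _ lth) theta_beta -adM.
  by rewrite -scalerAr mulr1 -scalerAl.
by rewrite cX rmorph1 mulr1 mul1r.
Qed.

#[local] Ltac src_simpl ::=
  rewrite ?mul1r ?mulr1 ?adM ?ad1 ?(rmorphM v) ?(rmorph1 v) ?mulrA.
#[local] Ltac leaf_simpl ::=
  rewrite ?antipodeM ?antipode1 ?adM ?ad1 ?(rmorphM v) ?(rmorph1 v).

(** Both sides reduce to products of three values of [theta] and one of [v]; the two bracketings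
    differ exactly by the two sides of the pentagon. *)
Lemma theta_star_assoc b b' b'' : theta (star (star b b') b'')
  = \tsum3_(X1, X2, X3 <- Φ)
      theta (star (ad X1 b) (star (ad X2 b') (ad X3 b''))).
Proof.
rewrite theta_star.
via (esym (eq_tsum3 Φ (fun X1 X2 X3 => theta_ad_starF (fun c =>
  c * theta (ad X2 b'') * v X3) X1 b b'))).
via (esym (eq_tsum3 Φ (fun X1 X2 X3 => eq_tsum (Δ X1) (fun X11 X12 =>
  eq_tsum3 Φ (fun Y1 Y2 Y3 => v_thetaF (fun c =>
  theta (ad (Y1 * X11) b) * theta (ad (Y2 * X12) b') * c * v X3)
  Y3 (ad X2 b'')))))).
via (esym (pentagon Q (fun e f g h =>
  theta (ad e b) * theta (ad f b') * theta (ad g b'') * v h))).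
symmetry.
transitivity (\tsum3_(Y1, Y2, Y3 <- Φ) \tsum3_(X1, X2, X3 <- Φ)
  (theta (ad (X1 * Y1) b) * theta (ad X2 (star (ad Y2 b') (ad Y3 b''))) * v X3)).
  apply: eq_tsum3 => *; rewrite theta_star; apply: eq_tsum3 => *.
  by rewrite adM.
via (esym (eq_tsum3 Φ (fun Y1 Y2 Y3 => eq_tsum3 Φ (fun X1 X2 X3 =>
  theta_ad_starF (fun c => theta (ad (X1 * Y1) b) * c * v X3) X2
    (ad Y2 b') (ad Y3 b''))))).
by psum.
Qed.

Lemma star_assoc b b' b'' : star (star b b') b''
  = \tsum3_(X1, X2, X3 <- Φ) star (ad X1 b) (star (ad X2 b') (ad X3 b'')).
Proof.
apply: theta_inj => h; rewrite ad_star.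
transitivity (\tsum_(h1, h2 <- Δ h) \tsum_(h11, h12 <- Δ h1)
  theta (star (star (ad h11 b) (ad h12 b')) (ad h2 b''))).
  rewrite (lin_tsum _ _ lth); apply: eq_tsum => h1 h2; rewrite ad_star.
  by rewrite -(lin_tsum (f := fun c => theta (star c (ad h2 b'')))); last lin.
via (eq_tsum (Δ h) (fun h1 h2 => eq_tsum (Δ h1) (fun h11 h12 =>
  theta_star_assoc (ad h11 b) (ad h12 b') (ad h2 b'')))).
via (quasi_assoc Q (fun e f g =>
  theta (star (ad e b) (star (ad f b') (ad g b'')))) h).
rewrite (lin_tsum3 (f := fun c => theta (ad h c))); last lin.
apply: eq_tsum3 => X1 X2 X3; rewrite ad_star (lin_tsum _ _ lth).
apply: eq_tsum => h1 h2; rewrite ad_star.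
rewrite (lin_tsum (f := fun c => theta (star (ad h1 (ad X1 b)) c))); last lin.
by apply: eq_tsum => *; rewrite !adM.
Qed.

(** * The coaction of B^v for a comodule algebra B *)

Section Coaction.
Variable lam : B -> H ⊗ B.
(** These say that [B] is a left H-comodule algebra and [v] a comodule map. With Φ_v = (id ⊗ id ⊗
    v)(Φ), [lam_coassoc] is the test form of (id ⊗ lam)lam(b) Φ_v = Φ_v (Δ ⊗ id)lam(b). *)
Hypotheses (llam : linear lam) (lamM : forall b c, lam (b * c) = lam b * lam c)
  (lam_v : forall h, lam (v h) = \tsum_(h1, h2 <- Δ h) (h1 ⊗ v h2))
  (lam_counit : forall b, \tsum_(g, c <- lam b) (ε g *: c) = b)
  (lam_coassoc : forall (U : lmodType k) (F : H -> H -> B -> U) b, Trilin F ->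
    \tsum_(g, c <- lam b) \tsum_(g', c' <- lam c) \tsum3_(Z1, Z2, Z3 <- Φ)
      F (g * Z1) (g' * Z2) (c' * v Z3)
    = \tsum3_(Z1, Z2, Z3 <- Φ) \tsum_(g, c <- lam b) \tsum_(g1, g2 <- Δ g)
      F (Z1 * g1) (Z2 * g2) (v Z3 * c)).

Lemma lam_mulvF (U : lmodType k) (F : H -> B -> U) b h : Bilin F ->
  \tsum_(g, c <- lam (b * v h)) F g c
  = \tsum_(g, c <- lam b) \tsum_(h1, h2 <- Δ h) F (g * h1) (c * v h2).
Proof.
by move=> bF; rewrite lamM lam_v tsumM; apply: eq_tsum => g c; expand.
Qed.
#[local] Arguments lam_mulvF {U} F b h {_}.

Lemma lam_vmulF (U : lmodType k) (F : H -> B -> U) h b : Bilin F ->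
  \tsum_(g, c <- lam (v h * b)) F g c
  = \tsum_(h1, h2 <- Δ h) \tsum_(g, c <- lam b) F (h1 * g) (v h2 * c).
Proof. by move=> bF; rewrite lamM lam_v tsumM; psum. Qed.
#[local] Arguments lam_vmulF {U} F h b {_}.

(** The solution of lam(theta(b)) = G(b): with the Yetter-Drinfeld compatibility, that equation
    determines [theta_coact h] of the coaction, and [theta_coact_recover] followed by the pentagon
    yields this formula. *)
Definition ad_coact (b : B) : H ⊗ B :=
  \tsum3_(X1, X2, X3 <- Φ) \tsum3_(x1, x2, x3 <- Φi) \tsum3_(y1, y2, y3 <- Φi)
  \tsum_(g, c <- lam (theta (ad x1 b) * v x2))
    ((X1 * g * y1) ⊗ (v X2 * c * v (y2 * β * S (X3 * x3 * y3)))).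

Lemma lin_ad_coact : linear ad_coact. Proof. by rewrite /ad_coact; lin. Qed.
Let lL := lin_ad_coact.

Lemma ad_coactF (U : lmodType k) (F : H -> B -> U) b : Bilin F ->
  tsum (ad_coact b) F
  = \tsum3_(X1, X2, X3 <- Φ) \tsum3_(x1, x2, x3 <- Φi) \tsum3_(y1, y2, y3 <- Φi)
    \tsum_(g, c <- lam (theta (ad x1 b) * v x2))
      F (X1 * g * y1) (v X2 * c * v (y2 * β * S (X3 * x3 * y3))).
Proof. by move=> bF; rewrite /ad_coact; expand. Qed.
#[local] Arguments ad_coactF {U} F b {_}.

#[local] Ltac src_simpl ::=
  rewrite ?mul1r ?mulr1 ?adM ?ad1 ?(rmorphM v) ?(rmorph1 v) ?mulrA.
#[local] Ltac leaf_simpl ::=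
  rewrite ?antipodeM ?antipode1 ?adM ?ad1 ?(rmorphM v) ?(rmorph1 v).

(** Starting on the right, [h] enters through p_R by [pR_comul] and then passes Φ^{-1}, [theta],
    [lam] and Φ. *)
Lemma ad_coact_yd h m :
  \tsum_(h1, h2 <- Δ h) \tsum_(c, n <- ad_coact m) ((h1 * c) ⊗ ad h2 n)
  = \tsum_(h1, h2 <- Δ h) \tsum_(c, n <- ad_coact (ad h1 m)) ((c * h2) ⊗ n).
Proof.
symmetry.
via (eq_tsum (Δ h) (fun h1 h2 => ad_coactF (fun c n => (c * h2) ⊗ n) (ad h1 m))).
via (esym (eq_tsum (Δ h) (fun h1 h2 => pR_comul Q (fun e f =>
  \tsum3_(X1, X2, X3 <- Φ) \tsum3_(x1, x2, x3 <- Φi)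
  \tsum_(g, c <- lam (theta (ad (x1 * h1) m) * v x2))
  ((X1 * g * e) ⊗ (v X2 * c * v (f * S (X3 * x3))))) h2))).
via (esym (eq_tsum (Δ h) (fun h1 h2 => eq_tsum (Δ h2) (fun h21 h22 =>
  eq_tsum3 Φi (fun x1 x2 x3 => lam_mulvF (fun g c =>
  \tsum3_(X1, X2, X3 <- Φ) \tsum3_(y1, y2, y3 <- Φi)
  ((X1 * g * y1) ⊗ (v X2 * c * v (y2 * β * S (X3 * x3 * h22 * y3)))))
  (theta (ad (x1 * h1) m) * v x2) h21))))).
via (quasi_assoc_inv Q (fun e f g => \tsum_(a, c <- lam (theta (ad e m) * v f))
  \tsum3_(X1, X2, X3 <- Φ) \tsum3_(y1, y2, y3 <- Φi)
  ((X1 * a * y1) ⊗ (v X2 * c * v (y2 * β * S (X3 * g * y3))))) h).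
via (eq_tsum (Δ h) (fun h1 h2 => eq_tsum3 Φi (fun x1 x2 x3 => v_thetaF (fun b =>
  \tsum_(a, c <- lam (b * v x2)) \tsum3_(X1, X2, X3 <- Φ) \tsum3_(y1, y2, y3 <- Φi)
  ((X1 * a * y1) ⊗ (v X2 * c * v (y2 * β * S (X3 * h2 * x3 * y3)))))
  h1 (ad x1 m)))).
via (eq_tsum (Δ h) (fun h1 h2 => eq_tsum3 Φi (fun x1 x2 x3 => lam_vmulF (fun a c =>
  \tsum3_(X1, X2, X3 <- Φ) \tsum3_(y1, y2, y3 <- Φi)
  ((X1 * a * y1) ⊗ (v X2 * c * v (y2 * β * S (X3 * h2 * x3 * y3)))))
  h1 (theta (ad x1 m) * v x2)))).
via (quasi_assoc Q (fun e f g => \tsum3_(x1, x2, x3 <- Φi)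
  \tsum3_(y1, y2, y3 <- Φi) \tsum_(a, c <- lam (theta (ad x1 m) * v x2))
  ((e * a * y1) ⊗ (v f * c * v (y2 * β * S (g * x3 * y3))))) h).
apply: etrans (esym (eq_tsum (Δ h) (fun h1 h2 =>
  ad_coactF (fun c n => (h1 * c) ⊗ ad h2 n) m))).
by cbv beta; rewrite /ad; psum.
Qed.

Lemma theta_coactF (U : lmodType k) (F : H -> B -> U) a : Bilin F ->
  \tsum3_(T1, T2, T3 <- Φ) \tsum_(c, n <- ad_coact a)
    F (T1 * c) (theta (ad T2 n) * v T3)
  = \tsum3_(X1, X2, X3 <- Φ) \tsum_(g, b <- lam (theta (ad X1 a)))
    F (g * X2) (b * v X3).
Proof.
move=> bF.
via (eq_tsum3 Φ (fun T1 T2 T3 => ad_coactF (fun c n =>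
  F (T1 * c) (theta (ad T2 n) * v T3)) a)).
transitivity (\tsum3_(T1, T2, T3 <- Φ) \tsum3_(X1, X2, X3 <- Φ)
  \tsum3_(x1, x2, x3 <- Φi) \tsum3_(y1, y2, y3 <- Φi)
  \tsum_(g, c <- lam (theta (ad x1 a) * v x2))
  \tsum3_(Z1, Z2, Z3 <- Φ) \tsum_(T21, T22 <- Δ T2)
  F (T1 * X1 * g * y1) (v (Z1 * T21 * X2) * c * v (y2 * β
    * S (Z2 * T22 * X3 * x3 * y3) * α * Z3 * T3))).
  do 4!apply: eq_tsum3 => ? ? ?; apply: eq_tsum => g c.
  by rewrite theta_ad; psum.
via (pentagon Q (fun e f g h =>
  \tsum3_(x1, x2, x3 <- Φi) \tsum3_(y1, y2, y3 <- Φi)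
  \tsum_(d, c <- lam (theta (ad x1 a) * v x2))
  F (e * d * y1) (v f * c * v (y2 * β * S (g * x3 * y3) * α * h)))).
via (alpha_kill3 (fun u1 u2 z => \tsum3_(V1, V2, V3 <- Φ) \tsum_(V11, V12 <- Δ V1)
  \tsum3_(x1, x2, x3 <- Φi) \tsum3_(y1, y2, y3 <- Φi)
  \tsum_(d, c <- lam (theta (ad x1 a) * v x2))
  F (u1 * V11 * d * y1)
    (v (u2 * V12) * c * v (y2 * β * S (V2 * x3 * y3) * z * V3))) cΦ).
via (esym (eq_tsum3 Φ (fun V1 V2 V3 => eq_tsum3 Φi (fun x1 x2 x3 =>
  lam_vmulF (fun d c => \tsum3_(y1, y2, y3 <- Φi)
  F (d * y1) (c * v (y2 * β * S (V2 * x3 * y3) * α * V3)))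
  V1 (theta (ad x1 a) * v x2))))).
via (esym (eq_tsum3 Φ (fun V1 V2 V3 => eq_tsum3 Φi (fun x1 x2 x3 =>
  v_thetaF (fun b => \tsum_(d, c <- lam (b * v x2)) \tsum3_(y1, y2, y3 <- Φi)
  F (d * y1) (c * v (y2 * β * S (V2 * x3 * y3) * α * V3))) V1 (ad x1 a))))).
via (pentagon_ec Q (fun e f g h => \tsum_(d, c <- lam (theta (ad e a) * v f))
  \tsum3_(y1, y2, y3 <- Φi)
  F (d * y1) (c * v (y2 * β * S (g * y3) * α * h)))).
via (alpha_kill3 (fun x1 x2 z => \tsum3_(Z1, Z2, Z3 <- Φ)
  \tsum3_(X1, X2, X3 <- Φ) \tsum_(X21, X22 <- Δ X2)
  \tsum_(d, c <- lam (theta (ad (x1 * X1) a) * v (x2 * Z1 * X21)))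
  \tsum3_(y1, y2, y3 <- Φi)
  F (d * y1) (c * v (y2 * β * S (Z2 * X22 * y3) * z * Z3 * X3))) cΦi).
via (eq_tsum3 Φ (fun Z1 Z2 Z3 => eq_tsum3 Φ (fun X1 X2 X3 =>
  eq_tsum (Δ X2) (fun X21 X22 => lam_mulvF (fun d c =>
  \tsum3_(y1, y2, y3 <- Φi)
  F (d * y1) (c * v (y2 * β * S (Z2 * X22 * y3) * α * Z3 * X3)))
  (theta (ad X1 a)) (Z1 * X21))))).
via (eq_tsum3 Φ (fun X1 X2 X3 => pR_comul Q (fun e f =>
  \tsum3_(Z1, Z2, Z3 <- Φ) \tsum_(Z11, Z12 <- Δ Z1)
  \tsum_(d, c <- lam (theta (ad X1 a)))
  F (d * Z11 * e) (c * v (Z12 * f * S Z2 * α * Z3 * X3))) X2)).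
via (eq_tsum3 Φ (fun X1 X2 X3 => qp_cancel Q (fun e f =>
  \tsum_(d, c <- lam (theta (ad X1 a))) F (d * e * X2) (c * v (f * X3))))).
by psum.
Qed.
#[local] Arguments theta_coactF {U} F a {_}.

Lemma lam_theta a : lam (theta a) = cov_gen Q ad ad_coact v theta a.
Proof.
symmetry; rewrite /cov_gen.
via (eq_tsum3 Φi (fun t1 t2 t3 => theta_coactF (fun c b =>
  (c * t2) ⊗ (b * v t3)) (ad t1 a))).
via (PhiK Q (fun e f g => \tsum_(d, c <- lam (theta (ad e a)))
  ((d * f) ⊗ (c * v g)))).
by rewrite -[RHS]tsumK; psum.
Qed.

Section Injectivity.
Variables (C : algType k) (u : {lrmorphism H -> C}).
#[local] Ltac leaf_simpl ::= rewrite ?antipodeM ?antipode1 ?adM ?ad1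
  ?(rmorphM v) ?(rmorph1 v) ?(rmorphM u) ?(rmorph1 u).

(** The analogue of [theta (ad h _)] on C ⊗ B. Multiplicativity takes [u] the identity of [H],
    coassociativity takes [u] the coproduct. *)
Definition theta_coact (h : H) (m : C ⊗ B) : C ⊗ B :=
  \tsum3_(T1, T2, T3 <- Φ) \tsum_(h1, h2 <- Δ h) \tsum_(c, n <- m)
    ((u (T1 * h1) * c) ⊗ (theta (ad (T2 * h2) n) * v T3)).

(** Once [v X2] has moved past [theta], the pentagon lets β kill a copy of Φ, and [theta_recover]
    applies to the second leg. *)
Lemma theta_coact_recover (m : C ⊗ B) :
  \tsum3_(X1, X2, X3 <- Φ) \tsum3_(y1, y2, y3 <- Φi)
  \tsum_(c, b <- theta_coact y1 m)
    ((u X1 * c) ⊗ (v X2 * b * v (y2 * β * S (X3 * y3))))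
  = m.
Proof.
rewrite /theta_coact.
transitivity (\tsum3_(X1, X2, X3 <- Φ) \tsum3_(y1, y2, y3 <- Φi)
  \tsum3_(T1, T2, T3 <- Φ) \tsum_(y11, y12 <- Δ y1) \tsum_(c, n <- m)
  ((u (X1 * T1 * y11) * c)
    ⊗ ((v X2 * theta (ad (T2 * y12) n)) * v (T3 * y2 * β * S (X3 * y3))))).
  by psum.
via (esym (eq_tsum3 Φ (fun X1 X2 X3 => eq_tsum3 Φi (fun y1 y2 y3 =>
  eq_tsum3 Φ (fun T1 T2 T3 => eq_tsum (Δ y1) (fun y11 y12 =>
  eq_tsum m (fun c n => v_thetaF (fun b => (u (X1 * T1 * y11) * c)
    ⊗ (b * v (T3 * y2 * β * S (X3 * y3)))) X2 (ad (T2 * y12) n)))))))).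
via (esym (pentagon_ad Q (fun e f g h => \tsum_(c, n <- m)
  ((u e * c) ⊗ (theta (ad f n) * v (g * β * S h)))))).
via (beta_kill3 (fun X1 X2 z => \tsum3_(x1, x2, x3 <- Φi) \tsum_(c, n <- m)
  ((u X1 * c) ⊗ (theta (ad (x1 * X2) n) * v (x2 * z * S x3)))) cΦ).
rewrite -[RHS]tsumK tsum3_tsum; apply: eq_tsum => c n.
rewrite -[in RHS](theta_recover n) (lin_tsum3 _ _ (f := pure c)); last lin.
by psum.
Qed.

Lemma theta_coact_inj (m m' : C ⊗ B) :
  (forall h, theta_coact h m = theta_coact h m') -> m = m'.
Proof.
move=> mm; rewrite -[m]theta_coact_recover -[m']theta_coact_recover.
by do 2!apply: eq_tsum3 => ? ? ?; rewrite mm.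
Qed.
End Injectivity.

Lemma lam_theta_star (U : lmodType k) (F : H -> B -> U) h a a' : Bilin F ->
  \tsum_(g, b <- lam (theta (ad h (star a a')))) F g b
  = \tsum_(h1, h2 <- Δ h) \tsum3_(U1, U2, U3 <- Φ) \tsum_(U31, U32 <- Δ U3)
    \tsum_(g, b <- lam (theta (ad (U1 * h1) a)))
    \tsum_(g', b' <- lam (theta (ad (U2 * h2) a')))
    F (g * g' * U31) (b * b' * v U32).
Proof.
move=> bF; rewrite ad_star.
rewrite (lin_tsum (f := fun b => tsum (lam (theta b)) F)); last lin.
apply: eq_tsum => h1 h2.
rewrite theta_star (lin_tsum3 (f := fun b => tsum (lam b) F)); last lin.
apply: eq_tsum3 => U1 U2 U3; rewrite lamM lam_v lamM -!adM tsumM tsumM.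
by psum.
Qed.
#[local] Arguments lam_theta_star {U} F h a a' {_}.

Let cov_genE : cov_gen Q ad ad_coact v theta = fun a => lam (theta a).
Proof. by apply/funext => a; rewrite lam_theta. Qed.

(** Tested by [theta_coact], the left side becomes lam(theta(star)), which multiplicativity of [lam]
    splits; the right side becomes the same product of values of G by [cov_gen_mul]. *)
Lemma ad_coact_star a a' :
  ad_coact (star a a') = yd_mul_coact Q ad ad_coact star a a'.
Proof.
apply: (theta_coact_inj (u := idfun)) => h; rewrite /theta_coact /=.
via (ydLF ad_coact_yd (F := fun c n => \tsum3_(T1, T2, T3 <- Φ)
  ((T1 * c) ⊗ (theta (ad T2 n) * v T3))) h (star a a') _).
via (eq_tsum (Δ h) (fun h1 h2 => theta_coactF (fun c b =>
  (c * h2) ⊗ b) (ad h1 (star a a')))).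
via (eq_tsum (Δ h) (fun h1 h2 => eq_tsum3 Φ (fun X1 X2 X3 => lam_theta_star
  (fun g b => (g * X2 * h2) ⊗ (b * v X3)) (X1 * h1) a a'))).
symmetry.
via (yd_mul_coact_act bad adM lL ad_coact_yd bstar ad_star
  (F := fun c n => \tsum3_(T1, T2, T3 <- Φ)
  ((T1 * c) ⊗ (theta (ad T2 n) * v T3))) h a a' _).
via (eq_tsum (Δ h) (fun h1 h2 => eq_tsum (Δ h1) (fun h11 h12 =>
  cov_gen_mul bad ad1 adM lL ad_coact_yd lth v_theta ad_star theta_star
  (F := fun c b => (c * h2) ⊗ b) (ad h11 a) (ad h12 a') _))).
by rewrite cov_genE; psum.
Qed.

Let lam_mulv b h : lam (b * v h) = lam b * \tsum_(h1, h2 <- Δ h) (h1 ⊗ v h2).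
Proof. by rewrite lamM lam_v. Qed.

(** This and [comul_coact] are the two sides of coassociativity after multiplication by Φ^{-1} on
    the left; in this form they commute with [h] along Δ. *)
Definition coact_coact (b : B) : H ⊗ H ⊗ B :=
  \tsum3_(x1, x2, x3 <- Φi) \tsum3_(X1, X2, X3 <- Φ)
  \tsum_(c, m <- ad_coact b) \tsum_(d, n <- ad_coact (ad X2 m))
    ((x1 * X1 * c) ⊗ (x2 * d * X3) ⊗ ad x3 n).

Definition comul_coact (b : B) : H ⊗ H ⊗ B :=
  \tsum3_(Y1, Y2, Y3 <- Φ) \tsum_(c, n <- ad_coact (ad Y1 b))
  \tsum_(c1, c2 <- Δ c) ((c1 * Y2) ⊗ (c2 * Y3) ⊗ n).

Lemma theta_coact_comul h (F : B -> H ⊗ H ⊗ B) b :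
  theta_coact Δ h (F b)
  = \tsum3_(T1, T2, T3 <- Φ) \tsum_(T11, T12 <- Δ T1) \tsum_(h1, h2 <- Δ h)
    \tsum_(h11, h12 <- Δ h1) \tsum3_(c, d, n <- F b)
    ((T11 * h11 * c) ⊗ (T12 * h12 * d) ⊗ (theta (ad (T2 * h2) n) * v T3)).
Proof.
rewrite /theta_coact.
transitivity (\tsum3_(T1, T2, T3 <- Φ) \tsum_(h1, h2 <- Δ h) \tsum_(e, n <- F b)
  (((\tsum_(d1, d2 <- Δ (T1 * h1)) (d1 ⊗ d2)) * \tsum_(e1, e2 <- e) (e1 ⊗ e2))
   ⊗ (theta (ad (T2 * h2) n) * v T3))).
  apply: eq_tsum3 => *; apply: eq_tsum => *; apply: eq_tsum => *.
  by rewrite !tsumK.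
by rewrite /tsum3; psum.
Qed.

(** Both sides, tested along Δ, turn into expressions in lam(theta(b)), where coassociativity of
    [lam] identifies them. *)
Lemma coact_coactE b : coact_coact b = comul_coact b.
Proof.
apply: (theta_coact_inj (u := Δ)) => h.
rewrite (theta_coact_comul h coact_coact) (theta_coact_comul h comul_coact).
rewrite /coact_coact /comul_coact.
via (yd_coassoc_r_act bad adM lL ad_coact_yd (F := fun c d n =>
  \tsum3_(T1, T2, T3 <- Φ) \tsum_(T11, T12 <- Δ T1)
  ((T11 * c) ⊗ (T12 * d) ⊗ (theta (ad T2 n) * v T3))) h b _).
via (eq_tsum (Δ h) (fun h1 h2 => eq_tsum (Δ h1) (fun h11 h12 =>
  cov_gen_coassoc_r bad ad1 adM lL ad_coact_yd lth v_theta llam lam_theta lam_mulv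
  (F := fun c d n => (c * h12) ⊗ (d * h2) ⊗ n) (ad h11 b) _))).
rewrite cov_genE.
via (eq_tsum (Δ h) (fun h1 h2 => eq_tsum (Δ h1) (fun h11 h12 =>
  eq_tsum3 Φ (fun X1 X2 X3 => eq_tsum (Δ X2) (fun X21 X22 =>
  eq_tsum3 Φ (fun Y1 Y2 Y3 => eq_tsum3 Φi (fun x1 x2 x3 =>
  lam_coassoc (F := fun e f c => (x1 * e * X21 * Y2 * h12)
    ⊗ (x2 * f * X22 * Y3 * h2) ⊗ (v x3 * c * v X3))
   (theta (ad (X1 * Y1) (ad h11 b))) _))))))).
via (Phi_invK Q (fun e f g => \tsum_(h1, h2 <- Δ h) \tsum_(h11, h12 <- Δ h1)
  \tsum3_(X1, X2, X3 <- Φ) \tsum_(X21, X22 <- Δ X2) \tsum3_(Y1, Y2, Y3 <- Φ)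
  \tsum_(a, c <- lam (theta (ad (X1 * Y1) (ad h11 b)))) \tsum_(a1, a2 <- Δ a)
  ((e * a1 * X21 * Y2 * h12) ⊗ (f * a2 * X22 * Y3 * h2) ⊗ (v g * c * v X3)))).
symmetry.
via (yd_coassoc_l_act bad adM lL ad_coact_yd (F := fun c d n =>
  \tsum3_(T1, T2, T3 <- Φ) \tsum_(T11, T12 <- Δ T1)
  ((T11 * c) ⊗ (T12 * d) ⊗ (theta (ad T2 n) * v T3))) h b _).
via (eq_tsum (Δ h) (fun h1 h2 => eq_tsum (Δ h1) (fun h11 h12 =>
  cov_gen_coassoc_l Q v bad ad1 adM lL lth
  (F := fun c d n => (c * h12) ⊗ (d * h2) ⊗ n) (ad h11 b) _))).
by rewrite cov_genE; psum.
Qed.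

Lemma ad_coact_coassoc b :
  \tsum3_(X1, X2, X3 <- Φ) \tsum_(c, n <- ad_coact b)
  \tsum_(d, p <- ad_coact (ad X2 n)) ((X1 * c) ⊗ (d * X3) ⊗ p)
  = \tsum3_(X1, X2, X3 <- Φ) \tsum3_(Y1, Y2, Y3 <- Φ)
    \tsum_(c, n <- ad_coact (ad Y1 b)) \tsum_(c1, c2 <- Δ c)
      ((X1 * c1 * Y2) ⊗ (X2 * c2 * Y3) ⊗ ad X3 n).
Proof.
transitivity (tsum3 (comul_coact b) (fun e f n => \tsum3_(W1, W2, W3 <- Φ)
  ((W1 * e) ⊗ (W2 * f) ⊗ ad W3 n))); last by rewrite /comul_coact; psum.
rewrite -coact_coactE /coact_coact.
via (esym (PhiK Q (fun e f g => \tsum3_(X1, X2, X3 <- Φ) \tsum_(c, m <- ad_coact b)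
  \tsum_(d, n <- ad_coact (ad X2 m)) ((e * X1 * c) ⊗ (f * d * X3) ⊗ ad g n)))).
by psum.
Qed.

(** Under ε the copies of Φ and Φ^{-1} around [lam] disappear, and [lam_counit] leaves the formula
    of [theta_recover]. *)
Lemma ad_coact_counit b : \tsum_(c, n <- ad_coact b) (ε c *: n) = b.
Proof.
via (ad_coactF (fun c n => ε c *: n) b).
transitivity (\tsum3_(X1, X2, X3 <- Φ) \tsum3_(x1, x2, x3 <- Φi)
  \tsum3_(y1, y2, y3 <- Φi) \tsum_(g, c <- lam (theta (ad x1 b) * v x2))
  (ε X1 *: (ε y1 *: (ε g *: (v X2 * c * v (y2 * β * S (X3 * x3 * y3))))))).
  do 3!apply: eq_tsum3 => ? ? ?; apply: eq_tsum => *.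
  by rewrite !rmorphM !scalerA mulrAC.
have [cX _ _] := @cΦ _ (fun X2 X3 => \tsum3_(x1, x2, x3 <- Φi)
  \tsum3_(y1, y2, y3 <- Φi) \tsum_(g, c <- lam (theta (ad x1 b) * v x2))
  (ε y1 *: (ε g *: (v X2 * c * v (y2 * β * S (X3 * x3 * y3)))))) _.
via cX.
have [cy _ _] := @cΦi _ (fun y2 y3 => \tsum3_(x1, x2, x3 <- Φi)
  \tsum_(g, c <- lam (theta (ad x1 b) * v x2))
  (ε g *: (c * v (y2 * β * S (x3 * y3))))) _.
via cy.
transitivity (\tsum3_(x1, x2, x3 <- Φi) \tsum_(g, c <- lam (theta (ad x1 b) * v x2))
  (ε g *: (c * v (β * S x3)))); first by psum.
rewrite -[RHS]theta_recover; apply: eq_tsum3 => x1 x2 x3.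
transitivity ((\tsum_(g, c <- lam (theta (ad x1 b) * v x2)) (ε g *: c))
  * v (β * S x3)); last by rewrite lam_counit; leaf.
apply: etrans (esym (mulr_tsuml _ _ _)).
by apply: eq_tsum => g c; rewrite scalerAl.
Qed.

Lemma ad_coact_beta : ad_coact (v β) = 1 ⊗ v β.
Proof.
have lam1 : lam 1 = 1 ⊗ 1.
  by rewrite -[X in lam X](rmorph1 v) lam_v tsum_comul1 rmorph1.
pose G x2 x3 b := \tsum3_(X1, X2, X3 <- Φ) \tsum3_(y1, y2, y3 <- Φi)
  \tsum_(g, c <- lam (b * v x2))
    ((X1 * g * y1) ⊗ (v X2 * c * v (y2 * β * S (X3 * x3 * y3)))).
have lG x2 x3 : linear (G x2 x3) by rewrite /G; lin.
have bG : Bilin (fun x2 x3 => G x2 x3 1) by rewrite /G; lin.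
transitivity (\tsum3_(x1, x2, x3 <- Φi) (ε x1 *: G x2 x3 1)).
  rewrite /ad_coact tsum3_exchange; apply: eq_tsum3 => x1 x2 x3.
  rewrite -[LHS]/(G x2 x3 (theta (ad x1 (v β)))) ad_beta (linZ _ _ lth) theta_beta.
  by rewrite (linZ _ _ (lG _ _)).
have [-> _ _] := @cΦi _ _ bG; rewrite /G mul1r (rmorph1 v) lam1.
via (PhiK Q (fun e f g => e ⊗ v (f * β * S g))).
by leaf.
Qed.

Lemma twist_inv_qRF (U : lmodType k) (F : H -> H -> U) h : Bilin F ->
  \tsum_(g1, g2 <- drinfeld_twist_inv Q) \tsum_(q1, q2 <- qR Q)
  \tsum_(h1, h2 <- Δ h) F (g1 * S (q2 * h2)) (g2 * S (q1 * h1))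
  = \tsum3_(w1, w2, w3 <- Φi) \tsum3_(y1, y2, y3 <- Φi)
    \tsum_(d1, d2 <- Δ (S (w1 * h) * α * w2))
      F (d1 * y1) (d2 * (y2 * β * S (w3 * y3))).
Proof.
move=> bF; apply: etrans (etrans (congr1 (fun t => tsum t F) (twist_inv_qR Q h)) _).
  by cbv beta; psum.
rewrite (lin_tsum3 (f := fun t => tsum t F)); last lin.
apply: eq_tsum3 => *; rewrite (lin_tsum3 (f := fun t => tsum t F)); last lin.
by apply: eq_tsum3 => *; rewrite tsumM; apply: eq_tsum => *; rewrite tsumE.
Qed.
#[local] Arguments twist_inv_qRF {U} F h {_}.

#[local] Ltac src_simpl ::= rewrite ?mul1r ?mulr1 ?antipodeM ?adM ?ad1
  ?(rmorphM v) ?(rmorph1 v) ?mulrA.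

(** Common generalisation of the displayed coactions: B = H with [lam] the coproduct gives that of
    [H0], and B = A # H that of the theorem. *)
Definition twisted_coact (b : B) : H ⊗ B :=
  \tsum3_(X1, X2, X3 <- Φ) \tsum3_(Y1, Y2, Y3 <- Φ)
  \tsum_(Y11, Y12 <- Δ Y1) \tsum_(Y21, Y22 <- Δ Y2)
  \tsum_(c, n <- lam b)
  \tsum_(g1, g2 <- drinfeld_twist_inv Q) \tsum_(q1, q2 <- qR Q)
    ((X1 * Y11 * c * g1 * S (q2 * Y22) * Y3)
     ⊗ (v (X2 * Y12) * n * v (g2 * S (X3 * q1 * Y21)))).

(** On the twisted side [twist_inv_qRF] removes the twist and q_R, and the factors around [b] are
    gathered under [lam]. Unfolding [theta] on the other side, with one pentagon and one α killed,
    gives the same sum. *)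
Lemma twisted_coactE b : twisted_coact b = ad_coact b.
Proof.
rewrite /twisted_coact.
via (eq_tsum3 Φ (fun X1 X2 X3 => eq_tsum3 Φ (fun Y1 Y2 Y3 =>
  eq_tsum (Δ Y1) (fun Y11 Y12 => eq_tsum (lam b) (fun c n =>
  twist_inv_qRF (fun d1 d2 => (X1 * Y11 * c * d1 * Y3)
     ⊗ (v (X2 * Y12) * n * v (d2 * S X3))) Y2))))).
via (esym (eq_tsum3 Φ (fun Y1 Y2 Y3 => pR_comul Q (fun e f =>
  \tsum3_(X1, X2, X3 <- Φ) \tsum_(Y11, Y12 <- Δ Y1) \tsum_(c, n <- lam b)
  \tsum3_(w1, w2, w3 <- Φi) \tsum_(d1, d2 <- Δ (S (w1 * Y2) * α * w2))
  ((X1 * Y11 * c * d1 * e)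
     ⊗ (v (X2 * Y12) * n * v (d2 * f * S w3 * S X3)))) Y3))).
via (esym (eq_tsum3 Φ (fun Y1 Y2 Y3 => lam_vmulF (fun c n =>
  \tsum_(Y31, Y32 <- Δ Y3) \tsum3_(w1, w2, w3 <- Φi)
  \tsum_(d1, d2 <- Δ (S (w1 * Y2) * α * w2 * Y31))
  \tsum3_(X1, X2, X3 <- Φ) \tsum3_(y1, y2, y3 <- Φi)
  ((X1 * c * d1 * y1)
     ⊗ (v X2 * n * v (d2 * y2 * β * S (X3 * w3 * Y32 * y3))))) Y1 b))).
via (esym (eq_tsum3 Φ (fun Y1 Y2 Y3 => eq_tsum (Δ Y3) (fun Y31 Y32 =>
  eq_tsum3 Φi (fun w1 w2 w3 => lam_mulvF (fun c n =>
  \tsum3_(X1, X2, X3 <- Φ) \tsum3_(y1, y2, y3 <- Φi)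
  ((X1 * c * y1) ⊗ (v X2 * n * v (y2 * β * S (X3 * w3 * Y32 * y3)))))
  (v Y1 * b) (S (w1 * Y2) * α * w2 * Y31)))))).
symmetry; rewrite /ad_coact.
transitivity (\tsum3_(Z1, Z2, Z3 <- Φ) \tsum3_(x1, x2, x3 <- Φi)
  \tsum_(x11, x12 <- Δ x1)
  \tsum_(c, n <- lam (v (Z1 * x11) * b * v (S (Z2 * x12) * α * Z3 * x2)))
  \tsum3_(X1, X2, X3 <- Φ) \tsum3_(y1, y2, y3 <- Φi)
  ((X1 * c * y1) ⊗ (v X2 * n * v (y2 * β * S (X3 * x3 * y3))))).
  symmetry; rewrite tsum3_exchange.
  transitivity (\tsum3_(x1, x2, x3 <- Φi) \tsum_(c, n <- lam (theta (ad x1 b) * v x2))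
    \tsum3_(X1, X2, X3 <- Φ) \tsum3_(y1, y2, y3 <- Φi)
    ((X1 * c * y1) ⊗ (v X2 * n * v (y2 * β * S (X3 * x3 * y3))))); last by psum.
  apply: eq_tsum3 => x1 x2 x3; rewrite theta_ad.
  set F := fun c n => tsum3 _ _.
  rewrite (lin_tsum3 (f := fun b => tsum (lam (b * v x2)) F)); last by rewrite /F; lin.
  apply: eq_tsum3 => Z1 Z2 Z3.
  rewrite (lin_tsum (f := fun b => tsum (lam (b * v x2)) F)); last by rewrite /F; lin.
  by apply: eq_tsum => x11 x12; rewrite /F; psum.
via (pentagon_ce Q (fun e f g h =>
  \tsum_(c, n <- lam (v e * b * v (S f * α * g)))
  \tsum3_(X1, X2, X3 <- Φ) \tsum3_(y1, y2, y3 <- Φi)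
  ((X1 * c * y1) ⊗ (v X2 * n * v (y2 * β * S (X3 * h * y3)))))).
via (alpha_kill2 (fun u1 a u3 => \tsum3_(z1, z2, z3 <- Φi)
  \tsum3_(Y1, Y2, Y3 <- Φ) \tsum_(Y31, Y32 <- Δ Y3)
  \tsum_(c, n <- lam (v (u1 * Y1) * b * v (S (z1 * Y2) * a * z2 * Y31)))
  \tsum3_(X1, X2, X3 <- Φ) \tsum3_(y1, y2, y3 <- Φi)
  ((X1 * c * y1) ⊗ (v X2 * n * v (y2 * β * S (X3 * u3 * z3 * Y32 * y3))))) cΦi).
by psum.
Qed.

Theorem twisted_yd_algebra : is_yd_algebra Q
  {| ydalg_modalg := twisted_modalg Q *%R v; acoact := twisted_coact |}.
Proof.
have -> : twisted_coact = ad_coact by apply/funext => b; exact: twisted_coactE.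
have ad_module : is_left_module ad by split; [exact: bad | exact: ad1 | exact: adM].
split=> /=.
- split=> //; first by move=> b; split; [exact: star_beta_l | exact: star_beta_r].
  by split; [exact: star_assoc | exact: ad_star | exact: ad_beta].
- split; [exact: ad_module | exact: lL |].
  by split; [exact: ad_coact_coassoc | exact: ad_coact_counit | exact: ad_coact_yd].
- exact: ad_coact_beta.
- exact: ad_coact_star.
Qed.

Lemma H0_coactE h : acoact (H0 Q) h =
  \tsum3_(X1, X2, X3 <- Φ) \tsum3_(Y1, Y2, Y3 <- Φ)
  \tsum_(Y11, Y12 <- Δ Y1) \tsum_(Y21, Y22 <- Δ Y2) \tsum_(h1, h2 <- Δ h)
  \tsum_(g1, g2 <- drinfeld_twist_inv Q) \tsum_(q1, q2 <- qR Q)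
    ((X1 * Y11 * h1 * g1 * S (q2 * Y22) * Y3)
     ⊗ (X2 * Y12 * h2 * g2 * S (X3 * q1 * Y21))).
Proof. by []. Qed.

Lemma H0_mulE a b : amul (H0 Q) a b =
  \tsum3_(X1, X2, X3 <- Φ) \tsum3_(x1, x2, x3 <- Φi) \tsum_(X31, X32 <- Δ X3)
    (X1 * a * (S (x1 * X2) * α * x2 * X31) * b * S (x3 * X32)).
Proof. by []. Qed.

Theorem twisted_yd_algebra_morphism : is_yd_algebra_morphism (H0 Q)
  {| ydalg_modalg := twisted_modalg Q *%R v; acoact := twisted_coact |} v.
Proof.
split; [exact: linearP | | | by [] |].
- move=> h a; apply: etrans (lin_tsum _ _ (linearP v)) _.
  by apply: eq_tsum => *; rewrite !rmorphM.
- move=> h; rewrite H0_coactE -[LHS]/(twisted_coact (v h)) /twisted_coact lam_v.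
  by psum.
- move=> a a'; rewrite H0_mulE -[RHS]/(star (v a) (v a')) /star.
  by psum.
Qed.
End Coaction.
End Twisted.

(** * The comodule algebra structure on a smash product *)

Section Comodule.
Variables (k : fieldType) (H : algType k) (Q : quasi_hopf H).
Local Notation Δ := (comul Q).
Local Notation ε := (counit Q).
Local Notation Φ := (Phi Q).
Local Notation Φi := (Phi_inv Q).
Let cΦ := @counital_Phi _ _ Q.
Let cΦi := @counital_Phi_inv _ _ Q.
Variables (A : lmodType k) (act : H -> A -> A) (L : A -> H ⊗ A).
Variables (mul : A -> A -> A) (one : A).
Hypotheses (bact : is_bilinear act) (act1 : forall m, act 1 m = m)
  (actM : forall g h m, act (g * h) m = act g (act h m)) (lL : linear L)
  (ydL : forall h m,
    \tsum_(h1, h2 <- Δ h) \tsum_(c, n <- L m) ((h1 * c) ⊗ act h2 n)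
    = \tsum_(h1, h2 <- Δ h) \tsum_(c, n <- L (act h1 m)) ((c * h2) ⊗ n))
  (bmul : is_bilinear mul)
  (act_mul : forall h a a',
    act h (mul a a') = \tsum_(h1, h2 <- Δ h) mul (act h1 a) (act h2 a'))
  (act_one : forall h, act h one = ε h *: one)
  (L_one : L one = 1 ⊗ one)
  (L_mul : forall a a', L (mul a a') = yd_mul_coact Q act L mul a a')
  (L_counit : forall m, \tsum_(c, n <- L m) (ε c *: n) = m)
  (L_coassoc : forall m,
    \tsum3_(X1, X2, X3 <- Φ) \tsum_(c, n <- L m) \tsum_(d, p <- L (act X2 n))
      ((X1 * c) ⊗ (d * X3) ⊗ p)
    = \tsum3_(X1, X2, X3 <- Φ) \tsum3_(Y1, Y2, Y3 <- Φ)
      \tsum_(c, n <- L (act Y1 m)) \tsum_(c1, c2 <- Δ c)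
        ((X1 * c1 * Y2) ⊗ (X2 * c2 * Y3) ⊗ act X3 n)).
Variables (B : algType k) (v : {lrmorphism H -> B}) (th : A -> B).
(** The relations between the two inclusions into A # H; [th_v_ext] says that a linear map is
    determined by its values on the products [th a * v h]. *)
Hypotheses (lth : linear th) (th_one : th one = 1)
  (vth : forall h a,
    v h * th a = \tsum_(h1, h2 <- Δ h) (th (act h1 a) * v h2))
  (th_th : forall a a', th a * th a' = \tsum3_(x1, x2, x3 <- Φi)
    (th (mul (act x1 a) (act x2 a')) * v x3))
  (th_mul : forall a a', th (mul a a')
    = \tsum3_(X1, X2, X3 <- Φ) (th (act X1 a) * th (act X2 a') * v X3))
  (th_v_ext : forall (U : lmodType k) (f g : B -> U), linear f -> linear g ->
    (forall a h, f (th a * v h) = g (th a * v h)) -> f =1 g).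
Local Notation G := (cov_gen Q act L v th).
Local Notation δ h := (\tsum_(h1, h2 <- Δ h) (h1 ⊗ v h2)).
Variable lam : B -> H ⊗ B.
Hypotheses (llam : linear lam) (lam_th_v : forall a h, lam (th a * v h) = G a * δ h).
Let lG : linear G := lin_cov_gen Q v bact lL lth.

#[local] Ltac leaf_simpl ::= rewrite ?actM ?act1 ?(rmorphM v) ?(rmorph1 v).
#[local] Ltac src_simpl ::=
  rewrite ?mul1r ?mulr1 ?actM ?act1 ?(rmorphM v) ?(rmorph1 v) ?mulrA.

Lemma cov_gen_one : G one = 1.
Proof.
rewrite /cov_gen.
transitivity (\tsum3_(t1, t2, t3 <- Φi) (ε t1 *: \tsum3_(T1, T2, T3 <- Φ)
  (ε T2 *: ((T1 * t2) ⊗ (v (T3 * t3)))))).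
  apply: eq_tsum3 => t1 t2 t3.
  rewrite (lin_tsum3 (f := fun z => ε t1 *: z)); last lin.
  apply: eq_tsum3 => T1 T2 T3.
  rewrite act_one (linZ (f := fun m => tsum (L m) _)); last lin.
  rewrite L_one tsumE act_one mulr1 (linZ (f := fun m => _ ⊗ (th m * _))); last lin.
  by rewrite th_one mul1r.
have [ct _ _] := @cΦi _ (fun t2 t3 => \tsum3_(T1, T2, T3 <- Φ)
  (ε T2 *: ((T1 * t2) ⊗ (v (T3 * t3))))) _.
rewrite ct.
have [_ cT _] := @cΦ _ (fun T1 T3 => ((T1 * 1) ⊗ (v (T3 * 1)))) _.
by rewrite cT !mulr1 rmorph1.
Qed.

Lemma comodule_coact_th a : lam (th a) = G a.
Proof.
rewrite -[th a]mulr1 -[X in _ * X](rmorph1 v) lam_th_v tsum_comul1 (rmorph1 v).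
exact: mulr1.
Qed.

Lemma comodule_coact_v h : lam (v h) = δ h.
Proof. by rewrite -[v h]mul1r -th_one lam_th_v cov_gen_one mul1r. Qed.

Lemma comul_vM g h : δ (g * h) = δ g * δ h.
Proof. by symmetry; psum. Qed.

Lemma comodule_coact_mul_v b h : lam (b * v h) = lam b * δ h.
Proof.
move: b; apply: th_v_ext; [lin | lin | move=> a g].
by rewrite -mulrA -rmorphM !lam_th_v comul_vM mulrA.
Qed.

(** [cov_gen_mul] yields this only with an extra Φ acting on [a], [a'] and the result (the local
    fact [E]); a copy of Φ^{-1} inserted on both sides cancels it. *)
Lemma cov_gen_mulF (U : lmodType k) (F : H -> B -> U) a a' : Bilin F ->
  \tsum_(g, b <- G (mul a a')) F g b
  = \tsum3_(U1, U2, U3 <- Φ) \tsum_(U31, U32 <- Δ U3)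
    \tsum_(g, b <- G (act U1 a)) \tsum_(g', b' <- G (act U2 a'))
    F (g * g' * U31) (b * b' * v U32).
Proof.
move=> bF.
have E (F' : H -> B -> U) m m' : Bilin F' ->
    \tsum3_(V1, V2, V3 <- Φ) \tsum_(V11, V12 <- Δ V1)
    \tsum_(g, b <- G (mul (act V11 m) (act V12 m'))) F' (g * V2) (b * v V3)
  = \tsum3_(U1, U2, U3 <- Φ) \tsum_(U31, U32 <- Δ U3)
    \tsum3_(V1, V2, V3 <- Φ) \tsum_(V11, V12 <- Δ V1)
    \tsum_(g, b <- G (act (U1 * V11) m)) \tsum_(g', b' <- G (act (U2 * V12) m'))
    F' (g * g' * U31 * V2) (b * b' * v U32 * v V3).
  move=> bF'; rewrite -(cov_gen_mul bact act1 actM lL ydL lth vth act_mul th_mul (F := F')) //.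
  rewrite -L_mul (cov_gen_coact Q v bact act1 actM lL lth (F := F')) //.
  apply: eq_tsum3 => V1 V2 V3; rewrite act_mul; symmetry.
  by apply: (lin_tsum (f := fun m => \tsum_(g, b <- G m) F' (g * V2) (b * v V3))); lin.
via (esym (PhiK Q (fun e f h => \tsum_(e1, e2 <- Δ e)
  \tsum_(g, b <- G (mul (act e1 a) (act e2 a'))) F (g * f) (b * v h)))).
via (eq_tsum3 Φi (fun y1 y2 y3 => eq_tsum (Δ y1) (fun y11 y12 =>
  E (fun g b => F (g * y2) (b * v y3)) (act y11 a) (act y12 a') _))).
via (PhiK Q (fun e f h => \tsum3_(U1, U2, U3 <- Φ) \tsum_(U31, U32 <- Δ U3)
  \tsum_(e1, e2 <- Δ e) \tsum_(g, b <- G (act (U1 * e1) a))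
  \tsum_(g', b' <- G (act (U2 * e2) a'))
  F (g * g' * U31 * f) (b * b' * v (U32 * h)))).
by psum.
Qed.
#[local] Arguments cov_gen_mulF {U} F a a' {_}.

Lemma comodule_coact_th_th a a' : lam (th a * th a') = G a * G a'.
Proof.
rewrite th_th (lin_tsum3 _ _ llam).
transitivity (\tsum3_(x1, x2, x3 <- Φi) \tsum_(x31, x32 <- Δ x3)
  \tsum_(g, b <- G (mul (act x1 a) (act x2 a'))) ((g * x31) ⊗ (b * v x32))).
  apply: eq_tsum3 => x1 x2 x3; rewrite lam_th_v -[G _ as X in X * _]tsumK; psum.
via (eq_tsum3 Φi (fun x1 x2 x3 => eq_tsum (Δ x3) (fun x31 x32 => cov_gen_mulF
  (fun g b => (g * x31) ⊗ (b * v x32)) (act x1 a) (act x2 a')))).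
via (PhiK Q (fun e f h => \tsum_(h1, h2 <- Δ h) \tsum_(g, b <- G (act e a))
  \tsum_(g', b' <- G (act f a')) ((g * g' * h1) ⊗ (b * b' * v h2)))).
rewrite -[G a in RHS]tsumK -[G a' in RHS]tsumK; psum.
Qed.

Lemma comul_v_cov_gen h a : δ h * G a = \tsum_(h1, h2 <- Δ h) (G (act h1 a) * δ h2).
Proof.
transitivity (\tsum_(h1, h2 <- Δ h) \tsum_(g, b <- G a) ((h1 * g) ⊗ (v h2 * b))).
  by rewrite -[G a in LHS]tsumK; psum.
rewrite -(cov_gen_act bact actM lL ydL lth vth (F := fun g b => g ⊗ b)).
apply: eq_tsum => h1 h2; rewrite -[G _ in RHS]tsumK; psum.
Qed.

(** By [th_v_ext] the claim reduces to (th a v(h)) (th a'). The relation [vth] moves v(h) to the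
    right, [comul_v_cov_gen] does the same for the images, and only products of two values of [th]
    remain. *)
Lemma comodule_coactM b c : lam (b * c) = lam b * lam c.
Proof.
move: c; apply: th_v_ext; [lin | lin | move=> a' h'].
rewrite mulrA !comodule_coact_mul_v mulrA comodule_coact_th; congr (_ * _).
move: b; apply: (th_v_ext (f := fun b => lam (b * th a'))); [lin | lin | move=> a h].
rewrite -mulrA vth mulr_tsumr (lin_tsum _ _ llam) lam_th_v -mulrA comul_v_cov_gen.
by rewrite mulr_tsumr; apply: eq_tsum => *;
  rewrite !mulrA comodule_coact_mul_v comodule_coact_th_th.
Qed.

Lemma cov_gen_counit a : \tsum_(g, b <- G a) (ε g *: b) = th a.
Proof.
rewrite (cov_genF Q act L v th (F := fun g b => ε g *: b)).
transitivity (\tsum3_(t1, t2, t3 <- Φi) (ε t2 *: \tsum3_(T1, T2, T3 <- Φ)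
  (ε T1 *: (th (act T2 (act t1 a)) * v (T3 * t3))))).
  apply: eq_tsum3 => t1 t2 t3.
  rewrite (lin_tsum3 (f := fun z => ε t2 *: z)); last lin.
  apply: eq_tsum3 => T1 T2 T3.
  rewrite -[in RHS](L_counit (act t1 a)) scalerA.
  rewrite (lin_tsum (f := fun m => _ *: (th (act T2 m) * _))); last lin.
  apply: eq_tsum => c n; rewrite (linZ (f := fun m => _ *: (th (act T2 m) * _))); last lin.
  by rewrite !rmorphM scalerA; congr (_ *: _); rewrite mulrC mulrA mulrC mulrA.
have [_ ct _] := @cΦi _ (fun t1 t3 => \tsum3_(T1, T2, T3 <- Φ)
  (ε T1 *: (th (act T2 (act t1 a)) * v (T3 * t3)))) _.
rewrite ct.
have [cT _ _] := @cΦ _ (fun T2 T3 => (th (act T2 (act 1 a)) * v (T3 * 1))) _.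
by rewrite cT !act1 mulr1 rmorph1 mulr1.
Qed.

Lemma comodule_coact_counit b : \tsum_(g, c <- lam b) (ε g *: c) = b.
Proof.
move: b; apply: th_v_ext; [lin | lin | move=> a h].
rewrite lam_th_v.
transitivity (\tsum_(g, c <- G a) \tsum_(h1, h2 <- Δ h)
   (ε h1 *: (ε g *: (c * v h2)))).
  rewrite -[G a in LHS]tsumK.
  transitivity (\tsum_(g, c <- G a) \tsum_(h1, h2 <- Δ h)
    (ε (g * h1) *: (c * v h2))); first by psum.
  by do 2!apply: eq_tsum => ? ?; rewrite rmorphM scalerA mulrC.
rewrite -[th a]cov_gen_counit mulr_tsuml; apply: eq_tsum => g c.
rewrite (tsum_counitl Q (fun h => ε g *: (c * v h))).
by rewrite scalerAl.
Qed.

Lemma L_coassocF (U : lmodType k) (F : H -> H -> A -> U) m : Trilin F ->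
  \tsum3_(X1, X2, X3 <- Φ) \tsum_(c, n <- L m) \tsum_(d, p <- L (act X2 n))
    F (X1 * c) (d * X3) p
  = \tsum3_(X1, X2, X3 <- Φ) \tsum3_(Y1, Y2, Y3 <- Φ)
    \tsum_(c, n <- L (act Y1 m)) \tsum_(c1, c2 <- Δ c)
      F (X1 * c1 * Y2) (X2 * c2 * Y3) (act X3 n).
Proof.
move=> tF; apply: etrans (etrans (congr1 (fun t => tsum3 t F) (L_coassoc m)) _).
  by symmetry; expand.
by expand.
Qed.
#[local] Arguments L_coassocF {U} F m {_}.

(** The coassociativity of [A], transported: its two sides become the two sides here by
    [cov_gen_coassoc_r] and [cov_gen_coassoc_l]. *)
Lemma cov_gen_coassoc_mixed (U : lmodType k) (F : H -> H -> B -> U) a : Trilin F ->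
  \tsum3_(X1, X2, X3 <- Φ) \tsum_(X21, X22 <- Δ X2) \tsum3_(Y1, Y2, Y3 <- Φ)
  \tsum3_(x1, x2, x3 <- Φi) \tsum3_(Z1, Z2, Z3 <- Φ)
  \tsum_(g, b <- G (act (X1 * Y1) a)) \tsum_(g', b' <- lam b)
    F (x1 * g * Z1 * X21 * Y2) (x2 * g' * Z2 * X22 * Y3)
      (v x3 * b' * v (Z3 * X3))
  = \tsum3_(X1, X2, X3 <- Φ) \tsum_(X21, X22 <- Δ X2) \tsum3_(Y1, Y2, Y3 <- Φ)
    \tsum_(g, b <- G (act (X1 * Y1) a)) \tsum_(g1, g2 <- Δ g)
    F (g1 * X21 * Y2) (g2 * X22 * Y3) (b * v X3).
Proof.
move=> tF.
rewrite -(cov_gen_coassoc_r bact act1 actM lL ydL lth vth llam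
  comodule_coact_th comodule_coact_mul_v (F := F)) //.
rewrite -(cov_gen_coassoc_l Q v bact act1 actM lL lth (F := F)) //.
via (L_coassocF (fun e f n => \tsum3_(x1, x2, x3 <- Φi) \tsum3_(T1, T2, T3 <- Φ)
  \tsum_(T11, T12 <- Δ T1)
  F (T11 * x1 * e) (T12 * x2 * f) (th (act (T2 * x3) n) * v T3)) a).
via (Phi_invK Q (fun e f h => \tsum3_(T1, T2, T3 <- Φ) \tsum_(T11, T12 <- Δ T1)
  \tsum3_(Y1, Y2, Y3 <- Φ) \tsum_(c, n <- L (act Y1 a)) \tsum_(c1, c2 <- Δ c)
  F (T11 * e * c1 * Y2) (T12 * f * c2 * Y3) (th (act (T2 * h) n) * v T3))).
by psum.
Qed.
#[local] Arguments cov_gen_coassoc_mixed {U} F a {_}.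

(** Both sides of [cov_gen_coassoc_mixed] carry two spare copies of Φ; inverse copies inserted
    through [PhiK] cancel them. *)
Lemma cov_gen_coassoc (U : lmodType k) (F : H -> H -> B -> U) a : Trilin F ->
  \tsum3_(x1, x2, x3 <- Φi) \tsum3_(Z1, Z2, Z3 <- Φ)
  \tsum_(g, b <- G a) \tsum_(g', b' <- lam b)
    F (x1 * g * Z1) (x2 * g' * Z2) (v x3 * b' * v Z3)
  = \tsum_(g, b <- G a) \tsum_(g1, g2 <- Δ g) F g1 g2 b.
Proof.
move=> tF.
via (esym (PhiK Q (fun e f h => \tsum_(f1, f2 <- Δ f)
  \tsum3_(x1, x2, x3 <- Φi) \tsum3_(Z1, Z2, Z3 <- Φ)
  \tsum_(g, b <- G (act e a)) \tsum_(g', b' <- lam b)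
  F (x1 * g * Z1 * f1) (x2 * g' * Z2 * f2) (v x3 * b' * v (Z3 * h))))).
via (esym (eq_tsum3 Φ (fun X1 X2 X3 => eq_tsum3 Φi (fun w1 w2 w3 =>
  eq_tsum (Δ X2) (fun X21 X22 => eq_tsum (Δ w2) (fun w21 w22 =>
  PhiK Q (fun e f h =>
  \tsum3_(x1, x2, x3 <- Φi) \tsum3_(Z1, Z2, Z3 <- Φ)
  \tsum_(g, b <- G (act (X1 * e * w1) a)) \tsum_(g', b' <- lam b)
  F (x1 * g * Z1 * X21 * f * w21) (x2 * g' * Z2 * X22 * h * w22)
  (v x3 * b' * v (Z3 * X3 * w3))))))))).
via (eq_tsum3 Φi (fun y1 y2 y3 => eq_tsum3 Φi (fun w1 w2 w3 =>
  eq_tsum (Δ w2) (fun w21 w22 => cov_gen_coassoc_mixed (fun e f b =>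
  F (e * y2 * w21) (f * y3 * w22) (b * v w3)) (act (y1 * w1) a))))).
via (eq_tsum3 Φ (fun X1 X2 X3 => eq_tsum3 Φi (fun w1 w2 w3 =>
  eq_tsum (Δ X2) (fun X21 X22 => eq_tsum (Δ w2) (fun w21 w22 =>
  PhiK Q (fun e f h =>
  \tsum_(g, b <- G (act (X1 * e * w1) a)) \tsum_(g1, g2 <- Δ g)
  F (g1 * X21 * f * w21) (g2 * X22 * h * w22) (b * v (X3 * w3)))))))).
via (PhiK Q (fun e f h => \tsum_(f1, f2 <- Δ f) \tsum_(g, b <- G (act e a))
  \tsum_(g1, g2 <- Δ g) F (g1 * f1) (g2 * f2) (b * v h))).
by psum.
Qed.
#[local] Arguments cov_gen_coassoc {U} F a {_}.

Lemma comodule_coact_coassoc (U : lmodType k) (F : H -> H -> B -> U) b : Trilin F ->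
  \tsum_(g, c <- lam b) \tsum_(g', c' <- lam c) \tsum3_(Z1, Z2, Z3 <- Φ)
    F (g * Z1) (g' * Z2) (c' * v Z3)
  = \tsum3_(Z1, Z2, Z3 <- Φ) \tsum_(g, c <- lam b) \tsum_(g1, g2 <- Δ g)
    F (Z1 * g1) (Z2 * g2) (v Z3 * c).
Proof.
move=> tF; move: b; apply: th_v_ext; [lin | lin | move=> a h].
rewrite lam_th_v -[G a]tsumK.
transitivity (\tsum_(g, c <- G a) \tsum_(h1, h2 <- Δ h) \tsum_(g', c' <- lam (c * v h2))
  \tsum3_(Z1, Z2, Z3 <- Φ) F (g * h1 * Z1) (g' * Z2) (c' * v Z3)); first by psum.
via (eq_tsum (G a) (fun g c => eq_tsum (Δ h) (fun h1 h2 => lamMF comodule_coact_mul_v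
  (F := fun g' c' => \tsum3_(Z1, Z2, Z3 <- Φ) F (g * h1 * Z1) (g' * Z2) (c' * v Z3))
  c h2 _))).
via (esym (quasi_assoc Q (fun e f i => \tsum_(g, c <- G a) \tsum_(g', c' <- lam c)
  F (g * e) (g' * f) (c' * v i)) h)).
via (esym (PhiK Q (fun e f i => \tsum3_(Z1, Z2, Z3 <- Φ)
  \tsum_(h1, h2 <- Δ h) \tsum_(h11, h12 <- Δ h1)
  \tsum_(g, c <- G a) \tsum_(g', c' <- lam c)
  F (e * g * Z1 * h11) (f * g' * Z2 * h12) (v i * c' * v (Z3 * h2))))).
via (eq_tsum3 Φ (fun W1 W2 W3 => eq_tsum (Δ h) (fun h1 h2 =>
  eq_tsum (Δ h1) (fun h11 h12 => cov_gen_coassoc (fun e f c =>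
  F (W1 * e * h11) (W2 * f * h12) (v W3 * c * v h2)) a)))).
by psum.
Qed.
End Comodule.

(** * The smash product as an instance *)

Section Smash.
Variables (k : fieldType) (H : algType k) (Q : quasi_hopf H).
Variables (A : lmodType k) (D : ydalg_ops H A).
Hypothesis hD : is_yd_algebra Q D.
Local Notation Δ := (comul Q).
Local Notation ε := (counit Q).
Local Notation Φ := (Phi Q).
Local Notation Φi := (Phi_inv Q).
Local Notation S := (antipode Q).
Let cΦi := @counital_Phi_inv _ _ Q.
Local Notation mul := (amul D).
Local Notation one := (aone D).
Local Notation act := (aact D).
Local Notation L := (acoact D).

Let bact : is_bilinear act. Proof. by have [[[]]] := hD. Qed.
Let act1 m : act 1 m = m. Proof. by have [[[_ a1]]] := hD. Qed.
Let actM g h m : act (g * h) m = act g (act h m).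
Proof. by have [[[_ _ aM]]] := hD. Qed.
Let bmul : is_bilinear mul. Proof. by have [[_ ?]] := hD. Qed.
Let mul1a a : mul one a = a. Proof. by have [[_ _ /(_ a)[]]] := hD. Qed.
Let mula1 a : mul a one = a. Proof. by have [[_ _ /(_ a)[]]] := hD. Qed.
Let mul_assoc a a' a'' : mul (mul a a') a''
  = \tsum3_(X1, X2, X3 <- Φ) mul (act X1 a) (mul (act X2 a') (act X3 a'')).
Proof. by have [[_ _ _ [aA _ _]] _ _ _] := hD; exact: aA. Qed.
Let act_mul h a a' :
  act h (mul a a') = \tsum_(h1, h2 <- Δ h) mul (act h1 a) (act h2 a').
Proof. by have [[_ _ _ [_ aM _]] _ _ _] := hD; exact: aM. Qed.
Let act_one h : act h one = ε h *: one.
Proof. by have [[_ _ _ [_ _ a1]] _ _ _] := hD; exact: a1. Qed.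
Let lL : linear L. Proof. by have [_ []] := hD. Qed.
Let L_coassoc m :
  \tsum3_(X1, X2, X3 <- Φ) \tsum_(c, n <- L m) \tsum_(d, p <- L (act X2 n))
    ((X1 * c) ⊗ (d * X3) ⊗ p)
  = \tsum3_(X1, X2, X3 <- Φ) \tsum3_(Y1, Y2, Y3 <- Φ)
    \tsum_(c, n <- L (act Y1 m)) \tsum_(c1, c2 <- Δ c)
      ((X1 * c1 * Y2) ⊗ (X2 * c2 * Y3) ⊗ act X3 n).
Proof. by have [_ [_ _ [cA _ _]] _ _] := hD; exact: cA. Qed.
Let L_counit m : \tsum_(c, n <- L m) (ε c *: n) = m.
Proof. by have [_ [_ _ [_ c1 _]] _ _] := hD; exact: c1. Qed.
Let ydL h m :
  \tsum_(h1, h2 <- Δ h) \tsum_(c, n <- L m) ((h1 * c) ⊗ act h2 n)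
  = \tsum_(h1, h2 <- Δ h) \tsum_(c, n <- L (act h1 m)) ((c * h2) ⊗ n).
Proof. by have [_ [_ _ [_ _ yd]] _ _] := hD; exact: yd. Qed.
Let L_one : L one = 1 ⊗ one. Proof. by have [_ _ ? _] := hD. Qed.
Let L_mul a a' : L (mul a a') = yd_mul_coact Q act L mul a a'.
Proof. by have [_ _ _ LM] := hD; exact: LM. Qed.

#[local] Ltac src_simpl ::= rewrite ?mul1r ?mulr1 ?actM ?act1 ?mulrA.
#[local] Ltac leaf_simpl ::= rewrite ?actM ?act1.

Lemma act_mulF (U : lmodType k) (f : A -> U) g m m' : Lin f ->
  \tsum_(h1, h2 <- Δ g) f (mul (act h1 m) (act h2 m')) = f (act g (mul m m')).
Proof. by move=> lf; rewrite act_mul (lin_tsum _ _ lf). Qed.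
#[local] Arguments act_mulF {U} f g m m' {_}.

Lemma mul_assocF (U : lmodType k) (f : A -> U) a a' a'' : Lin f ->
  \tsum3_(X1, X2, X3 <- Φ) f (mul (act X1 a) (mul (act X2 a') (act X3 a'')))
  = f (mul (mul a a') a'').
Proof. by move=> lf; rewrite mul_assoc (lin_tsum3 _ _ lf). Qed.
#[local] Arguments mul_assocF {U} f a a' a'' {_}.

Lemma smash_mulE s t : smash_mul Q D s t =
  \tsum_(a, h <- s) \tsum_(a', h' <- t)
  \tsum3_(x1, x2, x3 <- Φi) \tsum_(h1, h2 <- Δ h)
    (mul (act x1 a) (act (x2 * h1) a') ⊗ (x3 * h2 * h')).
Proof. by []. Qed.

Lemma smash_mul_bilinear : is_bilinear (smash_mul Q D).
Proof.
have E : smash_mul Q D = fun s t => \tsum_(a, h <- s) \tsum_(a', h' <- t)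
  \tsum3_(x1, x2, x3 <- Φi) \tsum_(h1, h2 <- Δ h)
    (mul (act x1 a) (act (x2 * h1) a') ⊗ (x3 * h2 * h')) by [].
by rewrite E; lin.
Qed.
Let bsm := smash_mul_bilinear.

Lemma smash_mul_pure a h a' h' : smash_mul Q D (a ⊗ h) (a' ⊗ h')
  = \tsum3_(x1, x2, x3 <- Φi) \tsum_(h1, h2 <- Δ h)
    (mul (act x1 a) (act (x2 * h1) a') ⊗ (x3 * h2 * h')).
Proof. by rewrite smash_mulE; expand. Qed.

(** Associativity of [A] contributes a Φ, which [pentagon_ced] absorbs into the two copies of
    Φ^{-1}; [quasi_assoc_inv] handles the coproduct of [h]. *)
Lemma smash_mulA : associative (smash_mul Q D).
Proof.
move=> s t r; move: s; apply: tensor_ext; [lin | lin | move=> a h].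
move: t; apply: tensor_ext; [lin | lin | move=> a' h'].
move: r; apply: tensor_ext; [lin | lin | move=> a'' h''].
symmetry; rewrite !smash_mul_pure !smash_mulE.
via (esym (eq_tsum3 Φi (fun x1 x2 x3 => eq_tsum (Δ h) (fun h1 h2 =>
  eq_tsum3 Φi (fun y1 y2 y3 => eq_tsum (Δ (x3 * h2 * h')) (fun e1 e2 =>
  act_mulF (fun b => mul b (act (y2 * e1) a'') ⊗ (y3 * e2 * h''))
  y1 (act x1 a) (act (x2 * h1) a'))))))).
via (esym (eq_tsum3 Φi (fun x1 x2 x3 => eq_tsum (Δ h) (fun h1 h2 =>
  eq_tsum3 Φi (fun y1 y2 y3 => eq_tsum (Δ y1) (fun y11 y12 =>
  eq_tsum (Δ (x3 * h2 * h')) (fun e1 e2 =>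
  mul_assocF (fun b => b ⊗ (y3 * e2 * h'')) (act (y11 * x1) a)
    (act (y12 * x2 * h1) a') (act (y2 * e1) a'')))))))).
via (pentagon_ced Q (fun e f g q => \tsum_(h1, h2 <- Δ h)
  \tsum_(h21, h22 <- Δ h2) \tsum_(h'1, h'2 <- Δ h')
  (mul (act e a) (mul (act (f * h1) a') (act (g * h21 * h'1) a''))
  ⊗ (q * h22 * h'2 * h'')))).
via (quasi_assoc_inv Q (fun e f g => \tsum3_(x1, x2, x3 <- Φi)
  \tsum_(x21, x22 <- Δ x2) \tsum_(h'1, h'2 <- Δ h')
  (mul (act x1 a) (mul (act (x21 * e) a') (act (x22 * f * h'1) a''))
  ⊗ (x3 * g * h'2 * h''))) h).
via (eq_tsum3 Φi (fun x1 x2 x3 => eq_tsum (Δ h) (fun h1 h2 =>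
  eq_tsum3 Φi (fun y1 y2 y3 => eq_tsum (Δ h') (fun h'1 h'2 =>
  act_mulF (fun b => mul (act x1 a) b ⊗ (x3 * h2 * y3 * h'2 * h'')) (x2 * h1)
    (act y1 a') (act (y2 * h'1) a'')))))).
by psum.
Qed.

Lemma smash_mul_pure_one a g h : smash_mul Q D (a ⊗ g) (one ⊗ h) = a ⊗ (g * h).
Proof.
rewrite smash_mul_pure.
transitivity (\tsum3_(x1, x2, x3 <- Φi) (ε x2 *: \tsum_(g1, g2 <- Δ g)
   (ε g1 *: (act x1 a ⊗ (x3 * g2 * h))))).
  apply: eq_tsum3 => x1 x2 x3.
  apply: etrans (esym (lin_tsum (f := fun z => ε x2 *: z) _ _ _)); last by lin.
  apply: eq_tsum => g1 g2; rewrite act_one.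
  rewrite (linZ (f := fun z => mul (act x1 a) z ⊗ (x3 * g2 * h))) ?mula1; last lin.
  by rewrite scalerA rmorphM.
have [_ ck _] := @cΦi _ (fun x1 x3 => \tsum_(g1, g2 <- Δ g)
   (ε g1 *: (act x1 a ⊗ (x3 * g2 * h)))) _.
rewrite ck -[in RHS](act1 a) -(tsum_counitl Q (fun g => act 1 a ⊗ (g * h))).
by apply: eq_tsum => *; rewrite mul1r.
Qed.

Lemma smash_mul_one_pure g a h :
  smash_mul Q D (one ⊗ g) (a ⊗ h) = \tsum_(g1, g2 <- Δ g) (act g1 a ⊗ (g2 * h)).
Proof.
rewrite smash_mul_pure.
transitivity (\tsum3_(x1, x2, x3 <- Φi) (ε x1 *: \tsum_(g1, g2 <- Δ g)
   (act (x2 * g1) a ⊗ (x3 * g2 * h)))).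
  apply: eq_tsum3 => x1 x2 x3.
  apply: etrans (esym (lin_tsum (f := fun z => ε x1 *: z) _ _ _)); last by lin.
  apply: eq_tsum => g1 g2; rewrite act_one.
  by rewrite (linZ (f := fun z => mul z (act (x2 * g1) a) ⊗ (x3 * g2 * h))) ?mul1a;
    last lin.
have [ck _ _] := @cΦi _ (fun x2 x3 => \tsum_(g1, g2 <- Δ g)
   (act (x2 * g1) a ⊗ (x3 * g2 * h))) _.
by rewrite ck; apply: eq_tsum => *; rewrite !mul1r.
Qed.

Lemma smash_mul1 : left_id (one ⊗ 1) (smash_mul Q D).
Proof.
apply: tensor_ext; [lin | lin | move=> a h].
by rewrite smash_mul_one_pure tsum_comul1 act1 mul1r.
Qed.

Lemma smash_mulr1 : right_id (one ⊗ 1) (smash_mul Q D).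
Proof.
apply: (tensor_ext (f := (smash_mul Q D)^~ _)); [lin | lin | move=> a h].
by rewrite smash_mul_pure_one mulr1.
Qed.

Hypothesis smash_neq0 : one ⊗ 1 != 0 :> A ⊗ H.

Let smash_mulDl : left_distributive (smash_mul Q D) +%R.
Proof. by move=> s t r; apply: (linD _ _ (bsm.1 r)). Qed.
Let smash_mulDr : right_distributive (smash_mul Q D) +%R.
Proof. by move=> s t r; apply: (linD _ _ (bsm.2 s)). Qed.

(** The [let]s make the type depend on both proofs, so that the algebra instances declared on it can
    recover them. The second provides 1 ≠ 0, which [algType] requires, together with the module
    algebra laws of the first. *)
Definition smash : Type := let _ := smash_neq0 in let _ := hD in (A ⊗ H)%type.
HB.instance Definition _ := GRing.Lmodule.on smash.
HB.instance Definition _ := GRing.Zmodule_isNzRing.Build smash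
  smash_mulA smash_mul1 smash_mulr1 smash_mulDl smash_mulDr smash_neq0.

Let smash_scalerAl (c : k) (s t : smash) : c *: (s * t) = (c *: s) * t.
Proof. by symmetry; apply: (linZ _ _ (bsm.1 t)). Qed.
Let smash_scalerAr (c : k) (s t : smash) : c *: (s * t) = s * (c *: t).
Proof. by symmetry; apply: (linZ _ _ (bsm.2 s)). Qed.
HB.instance Definition _ := GRing.Lmodule_isLalgebra.Build k smash smash_scalerAl.
HB.instance Definition _ := GRing.Lalgebra_isAlgebra.Build k smash smash_scalerAr.

Definition smash_incl (a : A) : smash := a ⊗ 1.
Definition smash_mor (h : H) : smash := one ⊗ h.

Let linear_incl : linear smash_incl. Proof. exact: (pure_bilinear _ _).1. Qed.
Let linear_mor : linear smash_mor. Proof. exact: (pure_bilinear _ _).2. Qed.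
Let morM g h : smash_mor (g * h) = smash_mor g * smash_mor h.
Proof. by symmetry; exact: smash_mul_pure_one. Qed.
Let mor_monoid : monoid_morphism smash_mor.
Proof. by split=> [|g h]; [|exact: morM]. Qed.
HB.instance Definition _ :=
  GRing.isLinear.Build k H smash *:%R smash_mor linear_mor.
HB.instance Definition _ :=
  GRing.isMonoidMorphism.Build H smash smash_mor mor_monoid.

Lemma smash_incl_mor a h : smash_incl a * smash_mor h = a ⊗ h :> smash.
Proof. by apply: etrans (smash_mul_pure_one a 1 h) _; rewrite mul1r. Qed.

Lemma smash_mor_incl h a : smash_mor h * smash_incl a
  = \tsum_(h1, h2 <- Δ h) (smash_incl (act h1 a) * smash_mor h2).
Proof.
apply: etrans (smash_mul_one_pure h a 1) _; apply: eq_tsum => h1 h2.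
by rewrite smash_incl_mor mulr1.
Qed.

Lemma smash_incl_incl a a' : smash_incl a * smash_incl a'
  = \tsum3_(x1, x2, x3 <- Φi)
      (smash_incl (mul (act x1 a) (act x2 a')) * smash_mor x3).
Proof.
apply: etrans (smash_mul_pure a 1 a' 1) _; apply: eq_tsum3 => x1 x2 x3.
by rewrite tsum_comul1 !mulr1 smash_incl_mor.
Qed.

Lemma smash_incl_mul a a' : smash_incl (mul a a')
  = \tsum3_(X1, X2, X3 <- Φ)
      (smash_incl (act X1 a) * smash_incl (act X2 a') * smash_mor X3).
Proof.
transitivity (\tsum3_(X1, X2, X3 <- Φ) \tsum3_(x1, x2, x3 <- Φi)
  (smash_incl (mul (act (x1 * X1) a) (act (x2 * X2) a')) * smash_mor (x3 * X3))).
  via (esym (Phi_invK Q (fun e f g =>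
    smash_incl (mul (act e a) (act f a')) * smash_mor g))).
  by psum.
apply: eq_tsum3 => X1 X2 X3; rewrite smash_incl_incl mulr_tsum3l.
by apply: eq_tsum3 => *; rewrite morM !actM mulrA.
Qed.

Local Notation incl := smash_incl.
Local Notation mor := smash_mor.
Local Notation G := (cov_gen Q act L mor incl).
Local Notation δ h := (\tsum_(h1, h2 <- Δ h) (h1 ⊗ mor h2)).

Lemma smash_ext (U : lmodType k) (f g : smash -> U) : linear f -> linear g ->
  (forall a h, f (incl a * mor h) = g (incl a * mor h)) -> f =1 g.
Proof.
move=> lf lg fg; apply: (tensor_ext lf lg) => a h.
by have := fg a h; rewrite smash_incl_mor.
Qed.

Definition smash_lam (s : smash) : H ⊗ smash := \tsum_(a, h <- s) (G a * δ h).

Let lG : linear G.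
Proof. exact: (lin_cov_gen Q smash_mor bact lL linear_incl). Qed.

Lemma linear_smash_lam : linear smash_lam.
Proof. by apply: tsum_linear; lin. Qed.

Lemma smash_lam_incl_mor a h : smash_lam (incl a * mor h) = G a * δ h.
Proof. by rewrite smash_incl_mor /smash_lam tsumE. Qed.

#[local] Ltac src_simpl ::=
  rewrite ?mul1r ?mulr1 ?actM ?act1 ?morM ?mulrA.
#[local] Ltac leaf_simpl ::= rewrite ?antipodeM ?actM ?act1 ?morM.

Lemma smash_mor_inclF (U : lmodType k) (f : smash -> U) h a : Lin f ->
  \tsum_(h1, h2 <- Δ h) f (incl (act h1 a) * mor h2) = f (mor h * incl a).
Proof. by move=> lf; rewrite smash_mor_incl (lin_tsum _ _ lf). Qed.
#[local] Arguments smash_mor_inclF {U} f h a {_}.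

Lemma smash_lamF (U : lmodType k) (F : H -> smash -> U) a h : Bilin F ->
  tsum (smash_lam (incl a * mor h)) F
  = \tsum3_(t1, t2, t3 <- Φi) \tsum3_(T1, T2, T3 <- Φ)
    \tsum_(c, n <- L (act t1 a)) \tsum_(h1, h2 <- Δ h)
      F (T1 * c * t2 * h1) (incl (act T2 n) * mor (T3 * t3 * h2)).
Proof.
move=> bF; rewrite smash_lam_incl_mor /cov_gen /=; psum.
Qed.
#[local] Arguments smash_lamF {U} F a h {_}.

Lemma smash_coactE a h : smash_coact Q D (a ⊗ h)
  = \tsum3_(X1, X2, X3 <- Φ) \tsum3_(Y1, Y2, Y3 <- Φ) \tsum3_(T1, T2, T3 <- Φ)
    \tsum3_(t1, t2, t3 <- Φi)
    \tsum_(g1, g2 <- drinfeld_twist_inv Q) \tsum_(q1, q2 <- qR Q)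
    \tsum_(X21, X22 <- Δ X2)
    \tsum_(Y11, Y12 <- Δ Y1) \tsum_(Y121, Y122 <- Δ Y12)
    \tsum_(Y21, Y22 <- Δ Y2)
    \tsum_(h1, h2 <- Δ h) \tsum_(c, n <- L (act t1 a))
    ((X1 * Y11 * T1 * c * t2 * h1 * g1 * S (q2 * Y22) * Y3)
    ⊗ (incl (act (X21 * Y121 * T2) n)
       * mor (X22 * Y122 * T3 * t3 * h2 * g2 * S (X3 * q1 * Y21)))).
Proof.
transitivity (\tsum3_(X1, X2, X3 <- Φ) \tsum3_(Y1, Y2, Y3 <- Φ)
    \tsum3_(T1, T2, T3 <- Φ) \tsum3_(t1, t2, t3 <- Φi)
    \tsum_(g1, g2 <- drinfeld_twist_inv Q) \tsum_(q1, q2 <- qR Q)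
    \tsum_(X21, X22 <- Δ X2)
    \tsum_(Y11, Y12 <- Δ Y1) \tsum_(Y121, Y122 <- Δ Y12)
    \tsum_(Y21, Y22 <- Δ Y2)
    \tsum_(h1, h2 <- Δ h) \tsum_(c, n <- L (act t1 a))
    ((X1 * Y11 * T1 * c * t2 * h1 * g1 * S (q2 * Y22) * Y3)
    ⊗ (act (X21 * Y121 * T2) n
       ⊗ (X22 * Y122 * T3 * t3 * h2 * g2 * S (X3 * q1 * Y21))))).
  by apply: tsumE; lin.
do 4!apply: eq_tsum3 => ? ? ?; do 8!apply: eq_tsum => ? ?.
by rewrite smash_incl_mor.
Qed.

(** In [twisted_coact] the factor j(X^2 Y^1_2) stands to the left of i(T^2.n). Moving it to the
    right by the smash relation produces the coproducts of X^2 and Y^1_2 in the displayed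
    formula. *)
Lemma smash_coact_twisted : smash_coact Q D = twisted_coact Q mor smash_lam.
Proof.
have E : smash_coact Q D = fun s => \tsum_(a, h <- s)
    \tsum3_(X1, X2, X3 <- Φ) \tsum3_(Y1, Y2, Y3 <- Φ) \tsum3_(T1, T2, T3 <- Φ)
    \tsum3_(t1, t2, t3 <- Φi)
    \tsum_(g1, g2 <- drinfeld_twist_inv Q) \tsum_(q1, q2 <- qR Q)
    \tsum_(X21, X22 <- Δ X2)
    \tsum_(Y11, Y12 <- Δ Y1) \tsum_(Y121, Y122 <- Δ Y12)
    \tsum_(Y21, Y22 <- Δ Y2)
    \tsum_(h1, h2 <- Δ h) \tsum_(c, n <- L (act t1 a))
    ((X1 * Y11 * T1 * c * t2 * h1 * g1 * S (q2 * Y22) * Y3)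
    ⊗ (act (X21 * Y121 * T2) n
       ⊗ (X22 * Y122 * T3 * t3 * h2 * g2 * S (X3 * q1 * Y21)))) by [].
have ll := linear_smash_lam.
apply/funext; apply: smash_ext => [||a h].
- by rewrite E; apply: tsum_linear; lin.
- by rewrite /twisted_coact; lin.
rewrite [in LHS]smash_incl_mor smash_coactE.
rewrite /twisted_coact /=; symmetry.
via (eq_tsum3 Φ (fun X1 X2 X3 => eq_tsum3 Φ (fun Y1 Y2 Y3 =>
  eq_tsum (Δ Y1) (fun Y11 Y12 => eq_tsum (Δ Y2) (fun Y21 Y22 =>
  eq_tsum (drinfeld_twist_inv Q) (fun g1 g2 => eq_tsum (qR Q) (fun q1 q2 =>
  smash_lamF (fun c n => (X1 * Y11 * c * g1 * S (q2 * Y22) * Y3)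
     ⊗ (mor (X2 * Y12) * n * mor (g2 * S (X3 * q1 * Y21)))) a h))))))).
via (esym (eq_tsum3 Φ (fun X1 X2 X3 => eq_tsum3 Φ (fun Y1 Y2 Y3 =>
  eq_tsum3 Φ (fun T1 T2 T3 => eq_tsum3 Φi (fun t1 t2 t3 =>
  eq_tsum (drinfeld_twist_inv Q) (fun g1 g2 => eq_tsum (qR Q) (fun q1 q2 =>
  eq_tsum (Δ Y1) (fun Y11 Y12 => eq_tsum (Δ Y2) (fun Y21 Y22 =>
  eq_tsum (Δ h) (fun h1 h2 => eq_tsum (L (act t1 a)) (fun c n =>
  smash_mor_inclF (fun b =>
    (X1 * Y11 * T1 * c * t2 * h1 * g1 * S (q2 * Y22) * Y3)
    ⊗ (b * mor (T3 * t3 * h2 * g2 * S (X3 * q1 * Y21))))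
    (X2 * Y12) (act T2 n))))))))))))).
by psum.
Qed.

Lemma smash_yd_algebra : is_yd_algebra Q (smash_ydalg Q D)
  /\ is_yd_algebra_morphism (H0 Q) (smash_ydalg Q D) (smash_j D).
Proof.
have E : smash_ydalg Q D =
  {| ydalg_modalg := twisted_modalg Q *%R mor;
     acoact := twisted_coact Q mor smash_lam |}.
  by rewrite -smash_coact_twisted.
rewrite E; have ll := linear_smash_lam; have lamG := smash_lam_incl_mor.
have lamv := comodule_coact_v bact lL act_one L_one linear_incl erefl lamG.
split; last exact (twisted_yd_algebra_morphism lamv).
have lamm := comodule_coactM bact act1 actM lL ydL bmul act_mul L_mul linear_incl
  smash_mor_incl smash_incl_incl smash_incl_mul smash_ext ll lamG.
have lamc := comodule_coact_counit bact act1 L_counit linear_incl smash_ext ll lamG.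
refine (twisted_yd_algebra ll lamm lamv lamc _) => U F b tF.
exact: (comodule_coact_coassoc bact act1 actM lL ydL L_coassoc linear_incl
    smash_mor_incl smash_ext ll lamG b tF).
Qed.
End Smash.

Lemma tensor_all_equal (k : fieldType) (V W : lmodType k) :
  (forall w w' : W, w = w') -> forall t t' : V ⊗ W, t = t'.
Proof.
move=> W0; suff t0 (t : V ⊗ W) : t = 0 by move=> t t'; rewrite (t0 t) (t0 t').
rewrite [t]tensorE big1 // => p _; rewrite (W0 p.2 0).
by rewrite (lin0 ((pure_bilinear _ _).2 p.1)).
Qed.

Theorem corollary4p5 (k : fieldType) (H : algType k) (Q : quasi_hopf H)
    (A : lmodType k) (D : ydalg_ops H A) (hD : is_yd_algebra Q D) :
  is_yd_algebra Q (smash_ydalg Q D) /\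
  is_yd_algebra_morphism (H0 Q) (smash_ydalg Q D) (smash_j D).
Proof.
have [one0|] := eqVneq (aone D ⊗ 1 : A ⊗ H) 0; last exact: smash_yd_algebra.
have eqAH (s t : A ⊗ H) : s = t.
  suff r0 (r : A ⊗ H) : r = 0 by rewrite (r0 s) (r0 t).
  rewrite -[r](smash_mul1 hD) one0.
  exact: (lin0 ((smash_mul_bilinear hD).1 r)).
have eqHAH := tensor_all_equal (V := H) eqAH.
have eqHHAH := tensor_all_equal (V := (H ⊗ H)%type) eqAH.
(* With A ⊗ H = 0, each conjunct is an equation in A ⊗ H, in H ⊗ (A ⊗ H) or in H ⊗ H ⊗ (A ⊗ H). *)
by repeat (split || move=> ?) => *; first [exact: eqAH | exact: eqHAH | exact: eqHHAH].
Qed.
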